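(* Let $b\in(0,1)$. There exist two constants $C>0$ and $R_0>1$ such that, for all $R\ge R_0$ and all $\circ\in\{D,N,p\}$ (where, in the case $\circ=p$, $R$ is restricted to values with $R^2\in 2\pi\mathbb N$), $$-\big(-2E_{\rm blk}(b)\big)^{1/2}-\frac{C}{R}\big(-2E_{\rm blk}(b)\big)^{-1/2}\;\le\; \frac{\mathfrak m^{\circ}(b,R)}{R}\;\le\; -\big(-2E_{\rm blk}(b)\big)^{1/2}+\frac{C}{R}.$$ In particular, for every $b\in(0,1)$ and every $\circ\in\{D,N,p\}$, $$E_{\rm blk}(b)=-\frac12\left(\lim_{R\to\infty}\frac{\mathfrak m^{\circ}(b,R)}{R}\right)^2$$ (with the limit taken along $R^2\in2\pi\mathbb N$ when $\circ=p$). Moreover, for the Dirichlet boundary condition, the lower bound is $$-\big(-2E_{\rm blk}(b)\big)^{1/2}\le \frac{\mathfrak m^{D}(b,R)}{R},$$ and it is valid for all $b\in(0,1]$ and all $R\ge 1$.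
   Context: All functions are complex-valued. For $R>0$ let $Q_R=(-R/2,R/2)\times(-R/2,R/2)\subset\mathbb R^2$, and let $\mathbf A_0(x_1,x_2)=\frac12(-x_2,x_1)$, so that $\operatorname{curl}\mathbf A_0=\partial_{x_1}(\mathbf A_0)_2-\partial_{x_2}(\mathbf A_0)_1=1$. Function spaces: $H^1(Q_R)$ and $H^1_0(Q_R)$ are the usual Sobolev spaces. For $R^2\in2\pi\mathbb N$, $H^1_{\rm mag,per}(Q_R)$ is the space of all $u\in L^2_{\rm loc}(\mathbb R^2)$ with $(\nabla-i\mathbf A_0)u\in L^2_{\rm loc}(\mathbb R^2)$ and $$u(x_1+R,x_2)=e^{iRx_2/2}u(x_1,x_2),\qquad u(x_1,x_2+R)=e^{-iRx_1/2}u(x_1,x_2).$$ Set $\mathcal H^D_R=H^1_0(Q_R)$, $\mathcal H^N_R=H^1(Q_R)$, $\mathcal H^p_R=H^1_{\rm mag,per}(Q_R)$; whenever $\circ=p$ it is assumed that $R^2\in2\pi\mathbb N$. Bulk energy: for $b\in(0,1]$, $$\mathcal E_{\rm blk}(u;b,R)=\int_{Q_R}\Big(b|(\nabla-i\mathbf A_0)u|^2-|u|^2+\tfrac12|u|^4\Big)\,dx,\qquad e^{\circ}(b,R)=\inf\{\mathcal E_{\rm blk}(u;b,R): u\in\mathcal H^\circ_R\}.$$ It is known that for every $b\in(0,1]$ the limit $$E_{\rm blk}(b)=\lim_{R\to\infty}\frac{e^{\circ}(b,R)}{R^2}$$ exists and is the same for $\circ\in\{D,N,p\}$ (along $R^2\in2\pi\mathbb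 N$ when $\circ=p$); this defines $E_{\rm blk}(b)$. The function $E_{\rm blk}$ is continuous and increasing, with $E_{\rm blk}(0)=-\frac12$ and $E_{\rm blk}(1)=0$. Linear energy: for $b\in(0,1]$, $$\mathcal E_{\rm lin}(u;b,R)=\int_{Q_R}\Big(b|(\nabla-i\mathbf A_0)u|^2-|u|^2\Big)\,dx,\qquad \mathfrak m^{\circ}(b,R)=\inf\left\{\frac{\mathcal E_{\rm lin}(u;b,R)}{\big(\int_{Q_R}|u|^4\,dx\big)^{1/2}}: u\in\mathcal H^\circ_R\setminus\{0\}\right\}.$$ *)

(* Defs.v *)
From HB Require Import structures.
From mathcomp Require Import all_boot all_order all_algebra.
From mathcomp Require Import complex.
From mathcomp Require Import all_classical all_reals all_analysis.

Set Implicit Arguments.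
Unset Strict Implicit.
Unset Printing Implicit Defensive.

Import Order.TTheory GRing.Theory Num.Theory.
Import numFieldNormedType.Exports.

Local Open Scope classical_set_scope.
Local Open Scope ring_scope.
Local Open Scope complex_scope.

Section Plane.
Context {R : realType}.

Definition lebesgue2 : set (measurableTypeR R * measurableTypeR R) -> \bar R :=
  (@lebesgue_measure R \x @lebesgue_measure R)%E.

HB.instance Definition _ := Measure.on lebesgue2.

(* Domain typed with the sigma-algebra of lebesgue_measure (Borel sets). *)
Definition measurable_plane (Omega : set (R * R)) (f : R * R -> R) : Prop :=
  @measurable_fun _ _ (measurableTypeR R * measurableTypeR R)%type R Omega f.

Definition normC (z : R[i]) : R := ComplexField.Normc.normc z.

Definition Re_fun (u : R * R -> R[i]) (x : R * R) : R := complex.Re (u x).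
Definition Im_fun (u : R * R -> R[i]) (x : R * R) : R := complex.Im (u x).

(* A coordinate direction is a boolean: false is x_1, true is x_2. *)
Definition coord (j : bool) (x : R * R) : R := if j then x.2 else x.1.

Definition slice (j : bool) (f : R * R -> R) (x : R * R) (t : R) : R :=
  if j then f (x.1, t) else f (t, x.2).

Definition partial (j : bool) (f : R * R -> R) (x : R * R) : R :=
  derive1 (slice j f x) (coord j x).

Fixpoint iter_partial (w : seq bool) (f : R * R -> R) : R * R -> R :=
  if w is j :: w' then partial j (iter_partial w' f) else f.

(* C^oo: every iterated partial derivative exists and is continuous; the
   derivability clause is needed because derive1 is total. *)
Definition smooth (f : R * R -> R) : Prop :=
  forall w : seq bool,
    continuous (iter_partial w f) /\
    forall (j : bool) (x : R * R),
      derivable (slice j (iter_partial w f) x) (coord j x) 1.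

Definition test_fun (Omega : set (R * R)) (phi : R * R -> R) : Prop :=
  [/\ smooth phi,
      compact (closure [set x | phi x != 0]) &
      closure [set x | phi x != 0] `<=` Omega].

Definition test_funC (Omega : set (R * R)) (phi : R * R -> R[i]) : Prop :=
  test_fun Omega (Re_fun phi) /\ test_fun Omega (Im_fun phi).

Definition L1loc (Omega : set (R * R)) (f : R * R -> R) : Prop :=
  measurable_plane Omega f /\
  forall K : set (R * R), compact K -> K `<=` Omega ->
    lebesgue2.-integrable K (EFin \o f).

Definition measurableC (Omega : set (R * R)) (u : R * R -> R[i]) : Prop :=
  measurable_plane Omega (Re_fun u) /\ measurable_plane Omega (Im_fun u).

Definition L2 (Omega : set (R * R)) (u : R * R -> R[i]) : Prop :=
  measurableC Omega u /\
  (\int[lebesgue2]_(x in Omega) (normC (u x) ^+ 2)%:E < +oo)%E.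

Definition L2loc (Omega : set (R * R)) (u : R * R -> R[i]) : Prop :=
  measurableC Omega u /\
  forall K : set (R * R), compact K -> K `<=` Omega ->
    (\int[lebesgue2]_(x in K) (normC (u x) ^+ 2)%:E < +oo)%E.

Definition is_weak_partial (Omega : set (R * R)) (j : bool)
    (f g : R * R -> R) : Prop :=
  [/\ L1loc Omega f, L1loc Omega g &
      forall phi : R * R -> R, test_fun Omega phi ->
        (\int[lebesgue2]_(x in Omega) (f x * partial j phi x)%:E =
         - \int[lebesgue2]_(x in Omega) (g x * phi x)%:E)%E].

(* A representative of the weak partial derivative, which is unique up to
   a.e. equality on Omega (junk value 0 if there is none). *)
Definition weak_partial (Omega : set (R * R)) (j : bool)
    (f : R * R -> R) : R * R -> R :=
  xget (fun=> 0) [set g | is_weak_partial Omega j f g].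

Definition weakly_diff (Omega : set (R * R)) (u : R * R -> R[i]) : Prop :=
  forall j : bool,
    (exists g, is_weak_partial Omega j (Re_fun u) g) /\
    (exists g, is_weak_partial Omega j (Im_fun u) g).

Definition weak_partialC (Omega : set (R * R)) (j : bool)
    (u : R * R -> R[i]) (x : R * R) : R[i] :=
  weak_partial Omega j (Re_fun u) x +i* weak_partial Omega j (Im_fun u) x.

Definition A0 (j : bool) (x : R * R) : R :=
  if j then x.1 / 2 else - x.2 / 2.

Definition mag_partial (Omega : set (R * R)) (j : bool)
    (u : R * R -> R[i]) (x : R * R) : R[i] :=
  weak_partialC Omega j u x - (0 +i* A0 j x) * u x.

Definition mag_grad_sq (Omega : set (R * R)) (u : R * R -> R[i])
    (x : R * R) : R :=
  normC (mag_partial Omega false u x) ^+ 2 +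
  normC (mag_partial Omega true u x) ^+ 2.

Definition square (r : R) : set (R * R) :=
  `]- (r / 2), r / 2[ `*` `]- (r / 2), r / 2[.

Definition H1 (Omega : set (R * R)) (u : R * R -> R[i]) : Prop :=
  [/\ L2 Omega u, weakly_diff Omega u &
      forall j : bool, L2 Omega (weak_partialC Omega j u)].

Definition H1_norm_sq (Omega : set (R * R)) (u : R * R -> R[i]) : \bar R :=
  (\int[lebesgue2]_(x in Omega)
    (normC (u x) ^+ 2 + normC (weak_partialC Omega false u x) ^+ 2 +
     normC (weak_partialC Omega true u x) ^+ 2)%:E)%E.

(* Closure of the test functions in H1. *)
Definition H10 (Omega : set (R * R)) (u : R * R -> R[i]) : Prop :=
  H1 Omega u /\
  forall e : R, 0 < e -> exists phi : R * R -> R[i],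
    test_funC Omega phi /\
    (H1_norm_sq Omega (fun x => (u x - phi x)%R) < e%:E)%E.

Definition expi (t : R) : R[i] := cos t +i* sin t.

Definition H1_mag_per (r : R) (u : R * R -> R[i]) : Prop :=
  [/\ L2loc setT u,
      weakly_diff setT u,
      forall j : bool, L2loc setT (mag_partial setT j u),
      {ae lebesgue2, forall x : R * R,
        u (x.1 + r, x.2) = expi (r * x.2 / 2) * u x} &
      {ae lebesgue2, forall x : R * R,
        u (x.1, x.2 + r) = expi (- (r * x.1 / 2)) * u x}].

End Plane.

Inductive bdry_cond : Set := Dirichlet | Neumann | MagPeriodic.

Section Energies.
Context {R : realType}.

Definition Hspace (o : bdry_cond) (r : R) : set (R * R -> R[i]) :=
  match o with
  | Dirichlet => H10 (square r)
  | Neumann => H1 (square r)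
  | MagPeriodic => H1_mag_per r
  end.

Definition admissible (o : bdry_cond) (r : R) : Prop :=
  o = MagPeriodic -> exists n : nat, r ^+ 2 = 2 * pi * n%:R.

Definition side_to_infty (o : bdry_cond) : set_system R :=
  within (admissible o) (pinfty_nbhs R).

(* Extended-real integral: it is +oo if u is not in L^4(Q_r), although the
   Sobolev embedding rules this out for u in Hspace.
   The weak derivatives are taken on Q_r for every boundary condition; for
   u in H1_mag_per they agree a.e. on Q_r with those on the whole plane. *)
Definition Eblk_fun (u : R * R -> R[i]) (b r : R) : \bar R :=
  (\int[lebesgue2]_(x in square r)
    (b * mag_grad_sq (square r) u x - normC (u x) ^+ 2 +
     2^-1 * normC (u x) ^+ 4)%:E)%E.

Definition eblk (o : bdry_cond) (b r : R) : \bar R :=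
  ereal_inf [set Eblk_fun u b r | u in Hspace o r].

Definition Eblk (b : R) : R :=
  get [set E : R | forall o : bdry_cond,
    (eblk o b r / (r ^+ 2)%:E)%E @[r --> side_to_infty o] --> E%:E].

Definition Elin_fun (u : R * R -> R[i]) (b r : R) : \bar R :=
  (\int[lebesgue2]_(x in square r)
    (b * mag_grad_sq (square r) u x - normC (u x) ^+ 2)%:E)%E.

Definition L4_sq (u : R * R -> R[i]) (r : R) : \bar R :=
  sqrte (\int[lebesgue2]_(x in square r) (normC (u x) ^+ 4)%:E)%E.

Definition ae_zero (r : R) (u : R * R -> R[i]) : Prop :=
  {ae lebesgue2, forall x : R * R, square r x -> u x = 0}.

Definition mlin (o : bdry_cond) (b r : R) : \bar R :=
  ereal_inf [set (Elin_fun u b r / L4_sq u r)%E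
            | u in [set u | Hspace o r u /\ ~ ae_zero r u]].

End Energies.

(* Main.v *)
From HB Require Import structures.
Require Import Defs.
From mathcomp Require Import all_boot all_order all_algebra.
From mathcomp Require Import complex ring lra.
From mathcomp Require Import all_classical all_reals all_analysis.
From mathcomp Require Import measurable_realfun.

(** The quartic functional and the linear one are related by scaling. Writing
    [l] for the linear energy of a function and [q] for the integral of its
    fourth power, the bulk energy of [t * u] is [t ^+ 2 * l + t ^+ 4 * q / 2],
    whose minimum over [t] is [- (l / sqrt q) ^+ 2 / 2] when [l < 0]. A lower
    bound [- A] for the bulk energy is thus the lower bound [- sqrt (2 * A)] for
    the quotient ([quotient_ge], [mlin_ge]), and a function of bulk energy
    [- A] yields a quotient at most [- sqrt (2 * A)] ([quotient_le],
    [mlin_le]). The theorem follows once the bulk energy in the square of side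
    [r] is known to be [E * r ^+ 2] up to an error [O(r)], with a bound free of
    error under the Dirichlet condition, and once [E] is identified with [Eblk]
    and shown to be negative for [b < 1].

    The number [E], called [ebulk], is the infimum over [r] of [einf b r / r ^+ 2],
    where [einf b r] is the infimum of the energy over functions of the whole
    plane that vanish off the square of side [r]. Four facts give the estimate.
    - Magnetic translates of such a function to [n ^ 2] disjoint cells can be
      added up, so [einf b (n * r) <= n ^ 2 * einf b r] ([einf_glue]).
    - Conversely a function on any domain can be cut off near the sides of a
      square. With the cutoff [1 - eta ^+ 4], the pointwise increase of the energy
      density is bounded by a constant, because the error terms have the form
      [c * X - X ^+ 2 / 2], where [X] is [eta ^+ 2] times the density of the
      function ([eblkd_cutoff]). The cost is therefore proportional to the area
      of the layer, which is [O(r)] ([einf_cut]). Applied to all cells of a large square this gives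
      [einf b r <= E * r ^+ 2 + O(r)] ([einf_le_ebulk]); applied to one square it
      gives the lower bound for functions without boundary condition
      ([energy_ge]).
    - The three spaces lie between these two classes: functions of [H10] extend
      by zero ([H10_W]), functions vanishing off a smaller square belong to
      [H10], by mollification ([W_H10]), and have a magnetic periodic extension
      when the flux is a multiple of [2 * pi] ([H1_mag_per_ext]); all three
      spaces restrict to [H1] of the square ([Hspace_H1]).
    - A Gaussian is a ground state of the magnetic Laplacian with eigenvalue 1,
      so a localized Gaussian of small amplitude has negative energy when
      [b < 1] ([ebulk_lt0]).

    Complex functions are handled as pairs of real functions indexed by [bool],
    and their weak derivatives as explicit companions ([W]). Since the weak
    derivatives of a Sobolev function are defined by a choice up to null sets,
    the passage between both views rests on the uniqueness of weak derivatives
    ([fundamental_lemma], [weak_partial_unique]), hence on mollification and on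
    the continuity of translations in mean. *)

Import Order.TTheory GRing.Theory Num.Theory.
Import numFieldNormedType.Exports.

Local Open Scope classical_set_scope.
Local Open Scope ring_scope.

Set Implicit Arguments.
Unset Strict Implicit.
Unset Printing Implicit Defensive.

Local Notation coord := Defs.coord.

(** * Lebesgue measure on the plane *)

(** The theorems of Fubini and Tonelli for functions on pairs of points of the
    plane require this instance. *)
Lemma sigma_finite_lebesgue2 (R : realType) : sigma_finite setT (@lebesgue2 R).
Proof.
exists (fun n => `](- n%:R : R), n%:R[ `*` `](- n%:R : R), n%:R[).
  apply/seteqP; split=> // -[x y] _; exists (Num.truncn (`|x| + `|y|)).+1 => //=.
  have xyn := truncnS_gt (`|x| + `|y|).
  split; rewrite /= in_itv/= -ltr_norml; apply: le_lt_trans xyn.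
  - by rewrite lerDl.
  - by rewrite lerDr.
move=> n; split; first by apply: measurableX; exact: measurable_itv.
rewrite /lebesgue2 product_measure1E; try exact: measurable_itv.
rewrite /= !lebesgue_measure_itv/=; case: ifP => _; last by rewrite mule0 ltry.
by rewrite -!EFinB -EFinM ltry.
Qed.

HB.instance Definition _ (R : realType) :=
  @Measure_isSigmaFinite.Build _ _ _ (@lebesgue2 R) (@sigma_finite_lebesgue2 R).

Section PlaneMeasure.
Context {R : realType}.
Local Notation RM := (measurableTypeR R).
Local Notation plane := (measurableTypeR R * measurableTypeR R)%type.
Local Notation mu := (@lebesgue_measure R).
Local Notation mu2 := (@lebesgue2 R).
Implicit Types (A B : set (R * R)) (c x : R * R).

Lemma measurable_rect (I J : interval R) :
  measurable ([set` I] `*` [set` J] : set plane).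
Proof. by apply: measurableX; exact: measurable_itv. Qed.

Lemma lebesgue2_setX (B C : set RM) : measurable B -> measurable C ->
  (mu2 (B `*` C) = mu B * mu C)%E.
Proof. by move=> mB mC; rewrite /lebesgue2 product_measure1E. Qed.

(** The product sigma-algebra contains the open sets because an open set is a
    countable union of boxes with rational vertices. *)
Lemma open_measurable2 A : open A -> measurable (A : set plane).
Proof.
move=> oA.
pose box (q : rat * rat * (rat * rat)) : set plane :=
  `]ratr q.1.1, ratr q.1.2[ `*` `]ratr q.2.1, ratr q.2.2[.
pose boxA q : set plane := if pselect (box q `<=` A) then box q else set0.
have -> : A = \bigcup_q boxA q.
  apply/seteqP; split=> [x Ax|x [q _]]; last first.
    by rewrite /boxA; case: pselect => // qA; exact: qA.
  have [[/= P Q] [Px Qx] PQA] : nbhs x A by exact: open_nbhs_nbhs.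
  have [e1 /= e10 P1] := Px; have [e2 /= e20 Q1] := Qx.
  have ex (y e : R) : 0 < e -> exists q : rat * rat,
      (y \in `]ratr q.1, ratr q.2[) /\
      forall z, (z \in `]ratr q.1, ratr q.2[) -> `|y - z| < e.
    move=> e0.
    have [|a] := @rat_in_itvoo R (y - e) y; first by rewrite ltrBlDr ltrDl.
    rewrite in_itv/= => /andP[ya ay].
    have [|b] := @rat_in_itvoo R y (y + e); first by rewrite ltrDl.
    rewrite in_itv/= => /andP[yb be].
    exists (a, b) => /=; rewrite in_itv/= ay yb; split => // z.
    rewrite in_itv/= => /andP[az zb]; rewrite ltr_norml; apply/andP; split; lra.
  have [q1 [xq1 Hq1]] := ex x.1 e1 e10.
  have [q2 [xq2 Hq2]] := ex x.2 e2 e20.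
  exists (q1, q2) => //; rewrite /boxA; case: pselect => // nA; exfalso; apply: nA.
  move=> z [/= z1q z2q]; apply: PQA; split => /=.
  - by apply: P1 => /=; exact: Hq1.
  - by apply: Q1 => /=; exact: Hq2.
apply: countable_bigcupT_measurable => [|q].
  by [].
rewrite /boxA; case: (pselect _) => [?|?]; last exact: measurable0.
exact: (measurable_rect `]ratr q.1.1, ratr q.1.2[ `]ratr q.2.1, ratr q.2.2[).
Qed.

Lemma closed_measurable2 A : closed A -> measurable (A : set plane).
Proof.
move=> cA; rewrite -[A]setCK; apply: measurableC.
by apply: open_measurable2; exact: closed_openC.
Qed.

Lemma compact_measurable2 A : compact A -> measurable (A : set plane).
Proof.
move=> cA; apply: closed_measurable2; exact: compact_closed.
Qed.

Lemma continuous_measurable2 (f : R * R -> R) :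
  continuous f -> measurable_fun setT (f : plane -> R).
Proof.
move=> /continuousP cf.
apply: (measurability (@measurable_realfun.RGenOpens.G R)).
  exact: measurable_realfun.RGenOpens.measurableE.
move=> _ [_ [a [b ->]] <-]; rewrite setTI; apply: open_measurable2.
by apply: cf; exact: interval_open.
Qed.

Definition shift2 c x : R * R := (x.1 + c.1, x.2 + c.2).

Lemma measurable_shift2 c : measurable_fun setT (shift2 c : plane -> plane).
Proof.
by apply/measurable_fun_pairP; split; apply: measurable_funD.
Qed.

Lemma measurable_addc (a : R) :
  measurable_fun setT (fun t : RM => t + a : RM).
Proof. by apply: measurable_funD. Qed.

Definition addc_mfun (a : R) : {mfun RM >-> RM} :=
  HB.pack (fun t : RM => t + a : RM)
    (isMeasurableFun.Build _ _ _ _ _ (measurable_addc a)).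

Lemma lebesgue_measure_addc (a : R) (A : set RM) :
  measurable A -> pushforward mu (addc_mfun a) A = mu A.
Proof.
move=> mA; apply/esym.
apply: lebesgue_measure_unique => //= _ [[x y]] _ <-.
have -> : pushforward mu (addc_mfun a) `](x, y).1, (x, y).2] = mu `]x - a, y - a].
  congr (mu _); apply/seteqP; split => t /=; rewrite !in_itv/= ltrBlDr lerBrDr;
    by case/andP => -> ->.
rewrite !lebesgue_measure_itv/= !lte_fin ltrD2r.
by case: ifP => // _; rewrite !EFinN -!EFinD; congr EFin; lra.
Qed.

Definition shift2_mfun c : {mfun plane >-> plane} :=
  HB.pack (shift2 c : plane -> plane)
    (isMeasurableFun.Build _ _ _ _ _ (measurable_shift2 c)).

(** Rectangles determine a product measure, which reduces translation
    invariance to the one-dimensional case. *)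
Lemma lebesgue2_shift2 c (A : set plane) :
  measurable A -> pushforward mu2 (shift2_mfun c) A = mu2 A.
Proof.
move=> mA; apply/esym; apply: product_measure_unique => //= B C mB mC.
rewrite /pushforward.
have -> : shift2_mfun c @^-1` (B `*` C) =
    ((addc_mfun c.1 @^-1` B) `*` (addc_mfun c.2 @^-1` C)).
  by apply/seteqP; split => -[x y].
rewrite lebesgue2_setX//=.
- by rewrite -[in RHS](lebesgue_measure_addc c.1)// -[in RHS](lebesgue_measure_addc c.2).
- by rewrite -[X in measurable X]setTI; exact: measurable_addc.
- by rewrite -[X in measurable X]setTI; exact: measurable_addc.
Qed.

Lemma integral_shift2 c (f : plane -> \bar R) : measurable_fun setT f ->
  (\int[mu2]_x f (shift2 c x) = \int[mu2]_x f x)%E.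
Proof.
move=> mf.
have pos (g : plane -> \bar R) : measurable_fun setT g -> (forall x, 0 <= g x)%E ->
    (\int[mu2]_x g (shift2 c x) = \int[mu2]_x g x)%E.
  move=> mg g0.
  transitivity (\int[pushforward mu2 (shift2_mfun c)]_x g x)%E.
    by rewrite ge0_integral_pushforward// preimage_setT.
  by apply: eq_measure_integral => A mA _; exact: lebesgue2_shift2.
rewrite integralE [RHS]integralE; congr (_ - _)%E.
  rewrite -(pos f^\+%E) //; last exact: measurable_funepos.
  by apply: eq_integral => x _; rewrite !funeposE.
rewrite -(pos f^\-%E) //; last exact: measurable_funeneg.
by apply: eq_integral => x _; rewrite !funenegE.
Qed.

End PlaneMeasure.

(** * Smooth functions of two variables *)

Section Smooth.
Context {R : realType}.
Implicit Types (f g : R * R -> R) (x c : R * R) (S : (R * R -> R) -> Prop).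

(** Existence and value of a partial derivative at once; this is the form in
    which the rules of calculus compose. *)
Definition pd (j : bool) f x (d : R) : Prop :=
  is_derive (coord j x) (1 : R) (slice j f x) d.

Lemma pd_derivable j f x d : pd j f x d -> derivable (slice j f x) (coord j x) 1.
Proof. by case. Qed.

Lemma pd_partial j f x d : pd j f x d -> partial j f x = d.
Proof. by case=> _ <-; rewrite /partial derive1E. Qed.

(** Smoothness quantifies over all iterated derivatives; it suffices to exhibit
    a family of continuous functions stable under partial derivatives. *)
Lemma smooth_coind S :
  (forall f, S f -> continuous f /\
     forall j, exists2 f', S f' & forall x, pd j f x (f' x)) ->
  forall f, S f -> smooth f.
Proof.
move=> hS f Sf w.
have Sw : S (iter_partial w f).
  elim: w => [//|j w IH] /=; have [_ /(_ j)[f' Sf' f'P]] := hS _ IH.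
  suff -> : partial j (iter_partial w f) = f' by [].
  by apply/funext => x; exact: pd_partial (f'P x).
have [cf hf] := hS _ Sw; split=> // j x.
by have [f' _ /(_ x)/pd_derivable] := hf j.
Qed.

Lemma smooth_continuous f : smooth f -> continuous f.
Proof. by move=> /(_ [::])[]. Qed.

Lemma smooth_pd f j x : smooth f -> pd j f x (partial j f x).
Proof.
move=> /(_ [::])[_ /(_ j x)] df.
by apply: DeriveDef => //; rewrite /partial derive1E.
Qed.

Lemma smooth_partial f j : smooth f -> smooth (partial j f).
Proof.
move=> sf w; have -> : iter_partial w (partial j f) = iter_partial (rcons w j) f.
  by elim: w => //= i w ->.
exact: sf.
Qed.

Lemma slice_coord j f x : slice j f x (coord j x) = f x.
Proof. by case: x => x1 x2; case: j. Qed.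

Lemma pdD j f g x a b : pd j f x a -> pd j g x b -> pd j (fun y => f y + g y) x (a + b).
Proof.
rewrite /pd => fa gb.
have -> : slice j (fun y => f y + g y) x = slice j f x + slice j g x.
  by apply/funext => t; rewrite /slice; case: j {fa gb}.
exact: is_deriveD.
Qed.

Lemma pdM j f g x a b : pd j f x a -> pd j g x b ->
  pd j (fun y => f y * g y) x (f x * b + a * g x).
Proof.
rewrite /pd => fa gb.
have -> : slice j (fun y => f y * g y) x = slice j f x * slice j g x.
  by apply/funext => t; rewrite /slice; case: j {fa gb}.
apply: is_derive_eq.
by rewrite !slice_coord /GRing.scale/= (mulrC (g x)).
Qed.

Lemma pd_cst j (k : R) x : pd j (fun=> k) x 0.
Proof.
rewrite /pd; have -> : slice j (fun=> k) x = cst k.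
  by apply/funext => t; rewrite /slice; case: j.
exact: is_derive_cst.
Qed.

Lemma slice_shift2 j f c x t :
  slice j (f \o shift2 c) x t = slice j f (shift2 c x) (t + coord j c).
Proof. by rewrite /slice /shift2; case: j. Qed.

Lemma pd_shift2 j f c x a : pd j f (shift2 c x) a -> pd j (f \o shift2 c) x a.
Proof.
rewrite /pd => fa.
have -> : slice j (f \o shift2 c) x =
    slice j f (shift2 c x) \o (fun t => t + coord j c).
  by apply/funext => t; rewrite slice_shift2.
rewrite -(mulr1 a); apply: is_derive1_comp.
  by move: fa; congr is_derive; case: j.
by apply: is_derive_eq; rewrite addr0.
Qed.

Lemma continuous_shift2 c : continuous (shift2 c).
Proof.
move=> x; apply: (@cvg_pair _ _ _ (nbhs x) (nbhs (x.1 + c.1)) (nbhs (x.2 + c.2)) _ _ _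
    (fun y => y.1 + c.1) (fun y => y.2 + c.2)).
  by apply: cvgD; [exact: cvg_fst|exact: cvg_cst].
by apply: cvgD; [exact: cvg_snd|exact: cvg_cst].
Qed.

(** The family to which [smooth_coind] applies in order to show that sums and
    products of smooth functions are smooth. *)
Inductive smooth_alg : (R * R -> R) -> Prop :=
| sa_smooth f of smooth f : smooth_alg f
| sa_cst (k : R) : smooth_alg (fun=> k)
| sa_add f g of smooth_alg f & smooth_alg g : smooth_alg (fun x => f x + g x)
| sa_mul f g of smooth_alg f & smooth_alg g : smooth_alg (fun x => f x * g x).

Lemma smooth_algP f : smooth_alg f -> smooth f.
Proof.
apply: smooth_coind => {}f; elim=> {f} [f sf|k|f g fa [cf df] ga [cg dg]|f g fa [cf df] ga [cg dg]].
- split; first exact: smooth_continuous.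
  move=> j; exists (partial j f) => [|x]; last exact: smooth_pd.
  exact/sa_smooth/smooth_partial.
- split; first by move=> x; exact: cvg_cst.
  by move=> j; exists (fun=> 0) => [|x]; [exact: sa_cst|exact: pd_cst].
- split; first by move=> x; apply: cvgD; [exact: cf|exact: cg].
  move=> j; have [f' sf' f'P] := df j; have [g' sg' g'P] := dg j.
  by exists (fun x => f' x + g' x) => [|x]; [exact: sa_add|exact: pdD].
- split; first by move=> x; apply: cvgM; [exact: cf|exact: cg].
  move=> j; have [f' sf' f'P] := df j; have [g' sg' g'P] := dg j.
  exists (fun x => f x * g' x + f' x * g x) => [|x]; last exact: pdM.
  by apply: sa_add; exact: sa_mul.
Qed.

Lemma smooth_cst (k : R) : smooth (fun _ : R * R => k).
Proof. exact/smooth_algP/sa_cst. Qed.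

Lemma smoothD f g : smooth f -> smooth g -> smooth (fun x => f x + g x).
Proof. by move=> sf sg; apply/smooth_algP/sa_add; exact: sa_smooth. Qed.

Lemma smoothM f g : smooth f -> smooth g -> smooth (fun x => f x * g x).
Proof. by move=> sf sg; apply/smooth_algP/sa_mul; exact: sa_smooth. Qed.

Lemma smooth_shift2 f c : smooth f -> smooth (f \o shift2 c).
Proof.
move=> sf; apply: (@smooth_coind (fun h => exists2 g, smooth g & h = g \o shift2 c)); last by exists f.
move=> _ [g sg ->]; split.
  by move=> x; apply: continuous_comp; [exact: continuous_shift2|exact: smooth_continuous].
move=> j; exists (partial j g \o shift2 c).
  by exists (partial j g); [exact: smooth_partial|].
by move=> x; apply: pd_shift2; exact: smooth_pd.
Qed.

Lemma partialD j f g x : smooth f -> smooth g ->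
  partial j (fun x => f x + g x) x = partial j f x + partial j g x.
Proof. by move=> sf sg; apply/pd_partial/pdD; exact: smooth_pd. Qed.

Lemma partialM j f g x : smooth f -> smooth g ->
  partial j (fun x => f x * g x) x = f x * partial j g x + partial j f x * g x.
Proof. by move=> sf sg; apply/pd_partial/pdM; exact: smooth_pd. Qed.

Lemma partial_shift2 j f c x : smooth f ->
  partial j (f \o shift2 c) x = partial j f (shift2 c x).
Proof. by move=> sf; apply/pd_partial/pd_shift2; exact: smooth_pd. Qed.

Lemma smooth_lin_trig (p q al be ka : R) :
  smooth (fun x => p * cos (al * x.1 + be * x.2 + ka) + q * sin (al * x.1 + be * x.2 + ka)).
Proof.
apply: (@smooth_coind (fun h => exists p q, h =
  fun x => p * cos (al * x.1 + be * x.2 + ka) + q * sin (al * x.1 + be * x.2 + ka))); last by exists p, q.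
move=> _ [{}p [{}q ->]]; split.
  have cl : continuous (fun x : R * R => al * x.1 + be * x.2 + ka).
    move=> x; apply: cvgD; last exact: cvg_cst.
    by apply: cvgD; apply: cvgMr; [exact: cvg_fst|exact: cvg_snd].
  move=> x; apply: cvgD; apply: cvgMr.
    by apply: (continuous_comp (cl x)); exact: continuous_cos.
  by apply: (continuous_comp (cl x)); exact: continuous_sin.
move=> j; pose m := if j then be else al.
exists (fun x => (q * m) * cos (al * x.1 + be * x.2 + ka) + (- p * m) * sin (al * x.1 + be * x.2 + ka)).
  by exists (q * m), (- p * m).
move=> x; rewrite /pd.
pose l := fun t : R => m * t + ((if j then al * x.1 else be * x.2) + ka).
have -> : slice j (fun x => p * cos (al * x.1 + be * x.2 + ka) + q * sin (al * x.1 + be * x.2 + ka)) x =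
    (fun t => p * (cos \o l) t + q * (sin \o l) t).
  apply/funext => t; rewrite /slice /l /m; case: j {m l} => /=.
    by rewrite (addrC (al * _)) -addrA.
  by rewrite -addrA.
have lx : l (coord j x) = al * x.1 + be * x.2 + ka.
  by rewrite /l /m /coord; case: j {m l} => /=; ring.
have dl : is_derive (coord j x) 1 l m.
  rewrite /l; apply: is_derive_eq.
  by rewrite /GRing.scale /=; ring.
have dcl := is_derive1_comp (is_derive_cos (l (coord j x))) dl.
have dsl := is_derive1_comp (is_derive_sin (l (coord j x))) dl.
apply: is_derive_eq.
by rewrite /GRing.scale/= lx; ring.
Qed.

(** A function of one coordinate has only zero or one-dimensional derivatives,
    so a family stable under differentiation on the line lifts to the plane. *)
Lemma smooth1_fst (S1 : (R -> R) -> Prop) :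
  (forall h, S1 h -> exists2 h', S1 h' & forall t : R, is_derive t (1 : R) h (h' t)) ->
  forall h, S1 h -> smooth (fun x => h x.1) /\ smooth (fun x => h x.2).
Proof.
move=> hS h Sh.
have ch k : S1 k -> continuous k.
  move=> /hS[h' _ kh'] t; apply: differentiable_continuous.
  by apply/derivable1_diffP; case: (kh' t).
pose T (i : bool) g := (exists2 k, S1 k & g = fun x => k (coord i x)) \/ g = fun=> 0.
suff sT i : forall g, T i g -> smooth g.
  by split; [apply: (sT false)|apply: (sT true)]; left; exists h.
apply: smooth_coind => g [[k Sk ->]|->]; split.
- move=> x; apply: (@continuous_comp _ _ _ (coord i)); last exact: ch.
  by case: i => /=; [exact: cvg_snd|exact: cvg_fst].
- move=> j; have [k' Sk' kk'] := hS _ Sk.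
  have [->|ij] := eqVneq j i.
    exists (fun x => k' (coord i x)); first by left; exists k'.
    move=> x; rewrite /pd.
    have -> : slice i (fun x => k (coord i x)) x = k by apply/funext => t; case: i.
    exact: kk'.
  exists (fun=> 0); first by right.
  move=> x; rewrite /pd.
  have -> : slice j (fun x => k (coord i x)) x = cst (k (coord i x)).
    by apply/funext => t; case: i j ij => -[].
  exact: is_derive_cst.
- by move=> x; exact: cvg_cst.
- by move=> j; exists (fun=> 0) => [|x]; [right|exact: pd_cst].
Qed.

End Smooth.

(** * Smooth functions of one variable and smooth steps *)

Section Smooth1.
Context {R : realType}.
Implicit Types (h k : R -> R).

(** Coinductive form of smoothness on the line: membership in a family stable
    under differentiation. *)
Definition smooth1 h : Prop :=
  exists2 S : (R -> R) -> Prop, S h &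
    forall k, S k -> exists2 k', S k' & forall t : R, is_derive t (1 : R) k (k' t).

Lemma smooth1_derive h : smooth1 h ->
  exists2 h', smooth1 h' & forall t : R, is_derive t (1 : R) h (h' t).
Proof.
by move=> [S Sh hS]; have [h' Sh' h'P] := hS _ Sh; exists h' => //; exists S.
Qed.

Lemma smooth1_continuous h : smooth1 h -> continuous h.
Proof.
move=> /smooth1_derive[h' _ hh'] t; apply: differentiable_continuous.
by apply/derivable1_diffP; case: (hh' t).
Qed.

Inductive smooth1_alg : (R -> R) -> Prop :=
| s1_smooth h of smooth1 h : smooth1_alg h
| s1_cst (a : R) : smooth1_alg (fun=> a)
| s1_add h k of smooth1_alg h & smooth1_alg k : smooth1_alg (fun t => h t + k t)
| s1_mul h k of smooth1_alg h & smooth1_alg k : smooth1_alg (fun t => h t * k t)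
| s1_inv h of smooth1_alg h & (forall t, h t != 0) : smooth1_alg (fun t => (h t)^-1).

Lemma smooth1_algP h : smooth1_alg h -> smooth1 h.
Proof.
move=> sh; exists smooth1_alg => // {sh}h.
elim=> {h} [h /smooth1_derive[h' sh' hh']|a|h k ha [h' sh' hh'] ka [k' sk' kk']
  |h k ha [h' sh' hh'] ka [k' sk' kk']|h ha [h' sh' hh'] h0].
- by exists h' => //; exact: s1_smooth.
- by exists (fun=> 0); [exact: s1_cst|move=> t; exact: is_derive_cst].
- by exists (fun t => h' t + k' t); [exact: s1_add|move=> t; exact: is_deriveD].
- exists (fun t => h t * k' t + k t * h' t); last by move=> t; exact: is_deriveM.
  by apply: s1_add; exact: s1_mul.
- exists (fun t => (- 1) * ((h t)^-1 * (h t)^-1) * h' t).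
    apply: s1_mul => //; apply: s1_mul; first exact: s1_cst.
    by apply: s1_mul; exact: s1_inv.
  move=> t; have := is_deriveV (h0 t) (hh' t).
  suff -> : - h t ^- 2 *: h' t = - 1 * ((h t)^-1 * (h t)^-1) * h' t by [].
  by rewrite mulN1r expr2 invfM.
Qed.

Lemma smooth1_affine h (a b : R) : smooth1 h -> smooth1 (fun t => h (a * t + b)).
Proof.
move=> sh; exists (fun k => exists c k0, smooth1 k0 /\ k = fun t => c * k0 (a * t + b)).
  by exists 1, h; split => //; apply/funext => t; rewrite mul1r.
move=> _ [c [k [/smooth1_derive[k' sk' kk'] ->]]].
exists (fun t => c * a * k' (a * t + b)); first by exists (c * a), k'.
move=> t.
have dl : is_derive t (1 : R) (fun t => a * t + b) a.
  by apply: is_derive_eq; rewrite /GRing.scale/= mulr1 addr0.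
have dk : is_derive t (1 : R) (k \o (fun t => a * t + b)) (k' (a * t + b) * a).
  exact: is_derive1_comp.
by apply: is_derive_eq; rewrite /GRing.scale/=; ring.
Qed.

Lemma smooth1_coord h (i : bool) : smooth1 h -> smooth (fun x : R * R => h (coord i x)).
Proof.
move=> sh; have [s1 s2] := smooth1_fst (@smooth1_derive) sh.
by case: i; [exact: s2|exact: s1].
Qed.

(** The flat functions of the kind [p(1/t) exp(-1/t)]: a family stable under
    differentiation, since every derivative at 0 vanishes. *)
Definition flat (p : {poly R}) (t : R) : R :=
  if 0 < t then p.[t^-1] * expR (- t^-1) else 0.

(** Growth comparison that makes every function [flat p] vanish to second order
    at 0. *)
Lemma poly_expR_bound (p : {poly R}) :
  exists2 C : R, 0 <= C & forall s, 0 <= s -> `|p.[s]| <= C * expR s.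
Proof.
have mono n : exists2 C : R, 0 <= C & forall s, 0 <= s -> s ^+ n <= C * expR s.
  case: n => [|n].
    exists 1 => // s s0; rewrite expr0 mul1r -expR0.
    by rewrite ler_expR.
  exists (n.+1)`!%:R => // s s0.
  rewrite mulrC -ler_pdivrMr ?ltr0n ?fact_gt0//.
  by apply: le_trans (expR_ge1Dxn n s0); rewrite lerDr.
have [C C0 CP] : exists2 C : nat -> R, (forall n, 0 <= C n) &
    forall n s, 0 <= s -> s ^+ n <= C n * expR s.
  have {}mono n : exists C : R, 0 <= C /\ forall s, 0 <= s -> s ^+ n <= C * expR s.
    by have [C] := mono n; exists C.
  by exists (fun n => projT1 (cid (mono n))) => n; have [] := projT2 (cid (mono n)).
exists (\sum_(i < size p) `|p`_i| * C i).
  by apply: sumr_ge0 => i _; rewrite mulr_ge0.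
move=> s s0; rewrite horner_coef (le_trans (ler_norm_sum _ _ _))//.
rewrite mulr_suml; apply: ler_sum => i _.
by rewrite normrM -mulrA ler_wpM2l// ger0_norm ?exprn_ge0// CP.
Qed.

Lemma is_derive0_quadratic h (C : R) :
  (forall t, `|h t| <= C * t ^+ 2) -> is_derive (0 : R) (1 : R) h 0.
Proof.
move=> hC.
have h0 : h 0 = 0 by apply/eqP; rewrite -normr_le0 (le_trans (hC 0))// expr0n mulr0.
have cv : (fun t : R => t^-1 *: (h (t *: (1 : R) + 0) - h 0)) @ 0^' --> (0 : R).
  apply: (@cvg_trans _ ((fun t : R => t^-1 * h t) @ 0^')).
    by apply: near_eq_cvg; near=> t; rewrite h0 subr0 addr0 /GRing.scale/= mulr1.
  apply/cvgr0Pnorm_lt => e e0.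
  have C0 : 0 <= C.
    by have := hC 1; rewrite expr1n mulr1; apply: le_trans.
  near=> t.
  have t0 : t != 0 by near: t; exact: nbhs_dnbhs_neq.
  rewrite normrM normfV mulrC ltr_pdivrMr ?normr_gt0//.
  apply: (le_lt_trans (hC t)); rewrite -real_normK ?num_real// expr2 mulrA ltr_pM2r ?normr_gt0//.
  rewrite (@le_lt_trans _ _ ((C + 1) * `|t|))//.
    by rewrite ler_wpM2r// lerDl.
  rewrite mulrC -ltr_pdivlMr ?ltr_pwDr//.
  near: t; apply: dnbhs0_lt; rewrite divr_gt0// ltr_pwDr//.
apply: DeriveDef; first by apply/cvg_ex; exists 0.
exact/cvg_lim.
Unshelve. all: by end_near. Qed.

(** Away from 0 this is the chain rule; at 0 the exponential decay makes the
    function [O(t ^+ 2)]. *)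
Lemma is_derive_flat p t : is_derive (t : R) (1 : R) (flat p) (flat ('X^2 * (p - p^`())) t).
Proof.
have [t0|t0|->] := ltgtP t 0.
- rewrite {2}/flat ltNge (ltW t0)/=.
  apply: (@near_eq_is_derive _ _ _ (cst (0 : R) : R -> R)).
  by near=> s; rewrite /flat ltNge ltW//=; near: s; exact: lt_nbhsl.
- rewrite {2}/flat t0.
  apply: (@near_eq_is_derive _ _ _ ((fun s => p.[s^-1] * expR (- s^-1)) : R -> R)).
    by near=> s; rewrite /flat ifT//; near: s; exact: lt_nbhsr.
  have tn0 : t != 0 by rewrite gt_eqF.
  have dV : is_derive t (1 : R) (fun s => s^-1) (- t ^- 2).
    by have := @is_deriveV R id t 1 1 tn0 (is_derive_id _ _); rewrite /GRing.scale/= mulr1.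
  have dN : is_derive t (1 : R) (fun s => - s^-1) (t ^- 2).
    by have := is_deriveN dV; rewrite opprK.
  have d1 := is_derive1_comp (is_derive_poly p t^-1) dV.
  have d2 : is_derive t (1 : R) (expR \o (fun s => - s^-1)) (expR (- t^-1) * t ^- 2).
    exact: is_derive1_comp.
  apply: (is_derive_eq (is_deriveM d1 d2)).
  by rewrite /GRing.scale/= hornerM hornerXn hornerD hornerN -exprVn; ring.
- rewrite {2}/flat ltxx.
  have [C C0 CP] := poly_expR_bound ('X^2 * p).
  apply: (@is_derive0_quadratic _ C) => s; rewrite /flat; case: ifPn => s0; last first.
    by rewrite normr0 mulr_ge0// sqr_ge0.
  have := CP s^-1; rewrite invr_ge0 (ltW s0) => /(_ isT).
  rewrite hornerM hornerXn normrM normrX normfV (gtr0_norm s0) => sC.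
  rewrite normrM (gtr0_norm (expR_gt0 _)) expRN -ler_pdivlMr ?invr_gt0 ?expR_gt0//.
  rewrite invrK mulrAC -ler_pdivrMr ?exprn_gt0// mulrC -exprVn.
  exact: sC.
Unshelve. all: by end_near. Qed.

Definition bump : R -> R := flat 1.

Lemma smooth1_bump : smooth1 bump.
Proof.
exists (fun h => exists p, h = flat p); first by exists 1.
move=> _ [p ->]; exists (flat ('X^2 * (p - p^`()))); first by eexists.
exact: is_derive_flat.
Qed.

Lemma bump_gt0 t : 0 < t -> 0 < bump t.
Proof. by move=> t0; rewrite /bump /flat t0 hornerC mul1r expR_gt0. Qed.

Lemma bump_eq0 t : t <= 0 -> bump t = 0.
Proof. by rewrite /bump /flat leNgt => /negbTE ->. Qed.

Lemma bump_ge0 t : 0 <= bump t.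
Proof. by have [/bump_eq0 ->//|/bump_gt0/ltW] := leP t 0. Qed.

Lemma le_bump s t : s <= t -> bump s <= bump t.
Proof.
move=> st; have [/bump_eq0 ->|s0] := leP s 0; first exact: bump_ge0.
have t0 := lt_le_trans s0 st.
rewrite /bump /flat s0 t0 !hornerC !mul1r ler_expR lerN2.
by rewrite lef_pV2// posrE.
Qed.

(** The quotient is smooth since its denominator vanishes nowhere; it rises
    from 0 to 1 on the interval from 0 to 1/2. *)
Definition step (t : R) : R := bump t * (bump t + bump (2^-1 - t))^-1.

Lemma step_den_gt0 t : 0 < bump t + bump (2^-1 - t).
Proof.
have [t0|t0] := leP t 0; last by rewrite ltr_pwDl ?bump_gt0// bump_ge0.
by rewrite ltr_wpDl ?bump_ge0// bump_gt0//; lra.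
Qed.

Lemma step_eq0 t : t <= 0 -> step t = 0.
Proof. by move=> t0; rewrite /step bump_eq0// mul0r. Qed.

Lemma step_eq1 t : 2^-1 <= t -> step t = 1.
Proof.
move=> t0; rewrite /step (@bump_eq0 (2^-1 - t)) ?subr_le0// addr0 divff//.
by rewrite gt_eqF// bump_gt0// (lt_le_trans _ t0)//; lra.
Qed.

Lemma step_itv t : 0 <= step t <= 1.
Proof.
rewrite /step; apply/andP; split.
  by rewrite mulr_ge0 ?bump_ge0// invr_ge0 ltW// step_den_gt0.
by rewrite ler_pdivrMr ?step_den_gt0// mul1r lerDl bump_ge0.
Qed.

Lemma smooth1_step : smooth1 step.
Proof.
apply: smooth1_algP; apply: s1_mul; first exact/s1_smooth/smooth1_bump.
apply: s1_inv; last by move=> t; rewrite gt_eqF// step_den_gt0.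
apply: s1_add; first exact/s1_smooth/smooth1_bump.
apply: s1_smooth; have := smooth1_affine (- 1) 2^-1 smooth1_bump.
by congr smooth1; apply/funext => t; rewrite mulN1r addrC.
Qed.

(** The derivative vanishes off a segment, and is bounded there by compactness. *)
Lemma step_deriv_bounded :
  exists h' : R -> R, [/\ smooth1 h', forall t : R, is_derive t (1 : R) step (h' t) &
    exists2 K : R, 0 <= K & forall t, `|h' t| <= K].
Proof.
have [h' sh' hh'] := smooth1_derive smooth1_step.
exists h'; split => //.
have : compact (h' @` `[(- 1) : R, 1]).
  apply: continuous_compact; last exact: segment_compact.
  by apply: continuous_subspaceT; exact: smooth1_continuous.
move=> /compact_bounded[M [_ MP]].
exists (`|M| + 1) => [|t]; first by rewrite addr_ge0.
have [t0|t0] := ltP t 0.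
  have -> : h' t = 0; last by rewrite normr0 addr_ge0.
  have d0 : is_derive t (1 : R) step 0.
    apply: (@near_eq_is_derive _ _ _ (cst (0 : R) : R -> R)).
    by near=> s; rewrite step_eq0// ltW//; near: s; exact: lt_nbhsl.
  by rewrite -(@derive_val _ _ _ _ _ _ _ d0) -(@derive_val _ _ _ _ _ _ _ (hh' t)).
have [t1|t1] := leP t 1; last first.
  have -> : h' t = 0; last by rewrite normr0 addr_ge0.
  have d0 : is_derive t (1 : R) step 0.
    apply: (@near_eq_is_derive _ _ _ (cst (1 : R) : R -> R)).
    near=> s; rewrite step_eq1//; apply: (@le_trans _ _ 1); first lra.
    by apply: ltW; near: s; exact: lt_nbhsr.
  by rewrite -(@derive_val _ _ _ _ _ _ _ d0) -(@derive_val _ _ _ _ _ _ _ (hh' t)).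
apply: (MP (`|M| + 1)); first by rewrite (le_lt_trans (ler_norm M))// ltrDl.
by exists t => //=; rewrite in_itv/= t1 andbT; lra.
Unshelve. all: by end_near. Qed.

End Smooth1.

(** * Real-valued integrals over the plane *)

Section PlaneIntegral.
Context {R : realType}.
Local Notation plane := (measurableTypeR R * measurableTypeR R)%type.
Local Notation mu2 := (@lebesgue2 R).
Implicit Types (f g : R * R -> R) (x c : R * R).

Definition meas2 f : Prop := measurable_fun setT (f : plane -> R).
Definition intg f : Prop := mu2.-integrable setT (EFin \o f).
(** Real-valued integral over the plane. All functions on domains are extended
    by zero, so that no other domain of integration occurs. *)
Definition I2 f : R := \int[mu2]_x f x.

Lemma intg_meas f : intg f -> meas2 f.
Proof. by case/integrableP => /measurable_EFinP. Qed.

Lemma meas2_cst (k : R) : meas2 (fun=> k).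
Proof. exact: measurable_cst. Qed.

Lemma meas2D f g : meas2 f -> meas2 g -> meas2 (fun x => f x + g x).
Proof. by move=> mf mg; apply: measurable_funD. Qed.

Lemma meas2M f g : meas2 f -> meas2 g -> meas2 (fun x => f x * g x).
Proof. by move=> mf mg; apply: measurable_funM. Qed.

Lemma meas2B f g : meas2 f -> meas2 g -> meas2 (fun x => f x - g x).
Proof. by move=> mf mg; apply: measurable_funB. Qed.

Lemma meas2X f (n : nat) : meas2 f -> meas2 (fun x => f x ^+ n).
Proof. by move=> mf; apply: measurable_funX. Qed.

Lemma meas2_norm f : meas2 f -> meas2 (fun x => `|f x|).
Proof. by move=> mf; apply: measurableT_comp mf. Qed.

Lemma meas2_continuous f : continuous f -> meas2 f.
Proof. exact: continuous_measurable2. Qed.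

Lemma meas2_shift f c : meas2 f -> meas2 (f \o shift2 c).
Proof. by move=> mf; apply: measurableT_comp mf (measurable_shift2 c). Qed.

Lemma meas2_indic (A : set (R * R)) : measurable (A : set plane) -> meas2 (\1_A : R * R -> R).
Proof. by move=> mA; apply: measurable_indic. Qed.

Lemma intg_ext f g : (forall x, f x = g x) -> intg f -> intg g.
Proof. by move=> /funext ->. Qed.

Lemma intgD f g : intg f -> intg g -> intg (fun x => f x + g x).
Proof.
by move=> hf hg; have := integrableD measurableT hf hg; congr integrable.
Qed.

Lemma intgZ (k : R) f : intg f -> intg (fun x => k * f x).
Proof. by move=> hf; have := integrableZl measurableT k hf. Qed.

Lemma intgN f : intg f -> intg (fun x => - f x).
Proof. by move=> /(intgZ (- 1)); apply: intg_ext => x; rewrite mulN1r. Qed.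

Lemma intgB f g : intg f -> intg g -> intg (fun x => f x - g x).
Proof. by move=> hf hg; apply: intgD hf (intgN hg). Qed.

Lemma intg0 : intg (fun=> 0).
Proof. exact: integrable0. Qed.

Lemma intg_norm f : intg f -> intg (fun x => `|f x|).
Proof. exact: integrable_norm. Qed.

Lemma intg_le f g : meas2 f -> intg g -> (forall x, `|f x| <= g x) -> intg f.
Proof.
move=> mf hg fg; apply: le_integrable hg => //; first exact/measurable_EFinP.
by move=> x _ /=; rewrite lee_fin (le_trans (fg x))// ler_norm.
Qed.

Lemma intg_mulb f g (M : R) : intg f -> meas2 g -> (forall x, `|g x| <= M) ->
  intg (fun x => f x * g x).
Proof.
move=> hf mg gM; apply: (@intg_le _ (fun x => M * `|f x|)).
- exact: meas2M (intg_meas hf) mg.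
- exact/intgZ/intg_norm.
- by move=> x; rewrite normrM mulrC ler_wpM2r.
Qed.

Lemma intg_shift f c : intg f -> intg (f \o shift2 c).
Proof.
move=> hf; have mf := intg_meas hf; apply/integrableP; split.
  by apply/measurable_EFinP; exact: (meas2_shift c mf).
have := @integral_shift2 R c (fun x => `|(f x)%:E|%E).
move=> /= ->; first by case/integrableP: hf.
by apply/measurable_EFinP; exact: (meas2_norm mf).
Qed.

Lemma I2_ext f g : (forall x, f x = g x) -> I2 f = I2 g.
Proof. by move=> /funext ->. Qed.

Lemma I2D f g : intg f -> intg g -> I2 (fun x => f x + g x) = I2 f + I2 g.
Proof. by move=> hf hg; apply: RintegralD. Qed.

Lemma I2Z (k : R) f : intg f -> I2 (fun x => k * f x) = k * I2 f.
Proof. by move=> hf; apply: RintegralZl. Qed.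

Lemma I2N f : intg f -> I2 (fun x => - f x) = - I2 f.
Proof. by move=> hf; rewrite -mulN1r -I2Z//; apply: I2_ext => x; rewrite mulN1r. Qed.

Lemma I2B f g : intg f -> intg g -> I2 (fun x => f x - g x) = I2 f - I2 g.
Proof. by move=> hf hg; rewrite I2D ?I2N//; exact: intgN. Qed.

Lemma le_I2 f g : intg f -> intg g -> (forall x, f x <= g x) -> I2 f <= I2 g.
Proof. by move=> hf hg fg; apply: le_Rintegral. Qed.

Lemma I2_ge0 f : (forall x, 0 <= f x) -> 0 <= I2 f.
Proof. by move=> f0; apply: Rintegral_ge0. Qed.

Lemma le_norm_I2 f : intg f -> `|I2 f| <= I2 (fun x => `|f x|).
Proof. by move=> hf; apply: le_normr_Rintegral. Qed.

Lemma I2_shift f c : meas2 f -> I2 (f \o shift2 c) = I2 f.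
Proof.
move=> mf; congr fine; apply: (@integral_shift2 R c (EFin \o f)).
exact/measurable_EFinP.
Qed.

Lemma I2_EFin f : intg f -> (\int[mu2]_x (f x)%:E)%E = (I2 f)%:E.
Proof. by move=> hf; rewrite /I2 /Rintegral fineK//; exact: integrable_fin_num. Qed.

Lemma I2_0 : I2 (fun=> 0) = 0.
Proof. by rewrite /I2 Rintegral_cst// mul0r. Qed.

Lemma square_rect (r : R) x : square r x <->
  [/\ - (r / 2) < x.1, x.1 < r / 2, - (r / 2) < x.2 & x.2 < r / 2].
Proof.
rewrite /square /=; split; first by case; rewrite !in_itv/= => /andP[-> ->] /andP[-> ->].
by case=> a b c d; rewrite !in_itv/= a b c d.
Qed.

Lemma squareP (r : R) x : square r x <-> `|x.1| < r / 2 /\ `|x.2| < r / 2.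
Proof.
rewrite square_rect !ltr_norml; split.
  by case=> -> -> -> ->.
by case=> /andP[-> ->] /andP[-> ->].
Qed.

Lemma square_le (r s : R) : r <= s -> square r `<=` square s.
Proof.
move=> rs x /squareP[x1 x2]; apply/squareP.
by split; [apply: lt_le_trans x1 _|apply: lt_le_trans x2 _]; lra.
Qed.

Lemma measurable_square (r : R) : measurable (square r : set plane).
Proof. exact: (measurable_rect `] _, _[ `] _, _[). Qed.

Lemma lebesgue2_square (r : R) : 0 <= r -> mu2 (square r) = (r ^+ 2)%:E.
Proof.
move=> r0; rewrite /square lebesgue2_setX; try exact: measurable_itv.
rewrite lebesgue_measure_itv/= lte_fin.
have [->|rp] := eqVneq r 0; first by rewrite mul0r oppr0 ltxx mule0 expr0n.
have {}rp : 0 < r by rewrite lt_neqAle eq_sym rp.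
rewrite ifT; last lra.
by rewrite -EFinB -EFinM; congr EFin; field.
Qed.

Lemma lebesgue2_square_lty (r : R) : (mu2 (square r) < +oo)%E.
Proof.
apply: (@le_lt_trans _ _ (mu2 (square `|r|))).
  by apply: le_measure; rewrite ?inE; try exact: measurable_square; exact/square_le/ler_norm.
by rewrite lebesgue2_square// ltry.
Qed.

Lemma intg_supp (r M : R) f : meas2 f -> (forall x, `|f x| <= M) ->
  (forall x, ~ square r x -> f x = 0) -> intg f.
Proof.
move=> mf fM f0.
have : mu2.-integrable (square r) (EFin \o f).
  apply: measurable_bounded_integrable => //.
  - exact: measurable_square.
  - exact: lebesgue2_square_lty.
  - exact: measurable_funTS.
  - exists M; split; rewrite ?num_real// => y My x _ /=.
    exact: le_trans (fM x) (ltW My).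
move/(integrable_mkcond _ (measurable_square r)).
congr integrable; apply/funext => x; rewrite patchE; case: ifPn => //.
by rewrite notin_setE => /f0 /= ->.
Qed.

Lemma intg_indic_square (r : R) : intg (\1_(square r) : R * R -> R).
Proof.
apply: (@intg_supp r 1); first by apply: meas2_indic; exact: measurable_square.
- by move=> x; rewrite indicE; case: (_ \in _); rewrite ?normr0 ?normr1.
- by move=> x nx; rewrite indicE memNset.
Qed.

Lemma I2_indic_square (r : R) : 0 <= r -> I2 (\1_(square r) : R * R -> R) = r ^+ 2.
Proof.
move=> r0; rewrite /I2 /Rintegral.
rewrite integral_indic//; last exact: measurable_square.
by rewrite setIT; exact: (congr1 fine (lebesgue2_square r0)).
Qed.

(** On a bounded set, [`|f|] is at most [f ^+ 2 + 1]. *)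
Lemma intg_of_sqr f (r : R) : meas2 f -> intg (fun x => f x ^+ 2) ->
  (forall x, ~ square r x -> f x = 0) -> intg f.
Proof.
move=> mf hf f0; apply: (intg_le mf (intgD hf (intg_indic_square r))) => x.
rewrite indicE; have [_|nx] := boolP (x \in square r).
  have := sqr_ge0 (`|f x| - 1); rewrite sqrrB mulr1 expr1n real_normK ?num_real//.
  by have := normr_ge0 (f x); rewrite (_ : true%:R = 1)//; lra.
by rewrite f0 ?normr0 ?expr0n ?addr0//; move/negP : nx => nx sx; apply: nx; exact/mem_set.
Qed.

End PlaneIntegral.

(** * Test functions *)

Section TestFunctions.
Context {R : realType}.
Local Notation plane := (measurableTypeR R * measurableTypeR R)%type.
Implicit Types (f g phi psi : R * R -> R) (x c : R * R) (K Om : set (R * R)).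

Lemma test_fun_intro Om K phi : smooth phi -> compact K -> K `<=` Om ->
  (forall x, ~ K x -> phi x = 0) -> test_fun Om phi.
Proof.
move=> sphi cK KOm phi0.
have sK : closure [set x | phi x != 0] `<=` K.
  rewrite [X in _ `<=` X](closure_id K).1; last exact: compact_closed (@norm_hausdorff _ _) cK.
  apply: closure_subset => x /= px; apply: contrapT => /phi0 px0.
  by rewrite px0 eqxx in px.
split=> //; last exact: subset_trans sK KOm.
apply: subclosed_compact cK sK; exact: closed_closure.
Qed.

Lemma test_fun_supp Om phi : test_fun Om phi ->
  exists K, [/\ compact K, K `<=` Om & forall x, ~ K x -> phi x = 0].
Proof.
case=> sphi cK KOm; exists (closure [set x | phi x != 0]); split => // x nx.
apply/eqP; apply: contrapT => /negP px; apply: nx; exact: subset_closure.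
Qed.

Lemma test_fun_smooth Om phi : test_fun Om phi -> smooth phi.
Proof. by case. Qed.

Lemma test_funS Om Om' phi : Om `<=` Om' -> test_fun Om phi -> test_fun Om' phi.
Proof. by move=> OO [? ? ?]; split => //; exact: subset_trans OO. Qed.

Lemma test_fun_out Om phi x : test_fun Om phi -> ~ Om x -> phi x = 0.
Proof. by move=> /test_fun_supp[K [_ KO p0]] nx; apply: p0 => /KO. Qed.

(** The complement of a closed set is open, so the function vanishes on a
    neighbourhood of the point along the slice. *)
Lemma pd_out K f j x : closed K -> (forall y, ~ K y -> f y = 0) -> ~ K x -> pd j f x 0.
Proof.
move=> cK f0 Kx.
have oK : open (~` K) by exact: closed_openC.
pose ins t : R * R := if j then (x.1, t) else (t, x.2).
have cins : continuous ins.
  move=> t; rewrite /ins; case: (j).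
    by apply: (@cvg_pair _ _ _ (nbhs t) (nbhs x.1) (nbhs t)); [exact: cvg_cst|exact: cvg_id].
  by apply: (@cvg_pair _ _ _ (nbhs t) (nbhs t) (nbhs x.2)); [exact: cvg_id|exact: cvg_cst].
rewrite /pd; apply: (@near_eq_is_derive _ _ _ (cst (0 : R) : R -> R)).
have insx : ins (coord j x) = x by rewrite /ins; case: (j) => //=; case: (x).
have Kx' : (~` K) (ins (coord j x)) by rewrite insx.
have H : \forall t \near coord j x, (~` K) (ins t).
  exact: cins (coord j x) _ (open_nbhs_nbhs (conj oK Kx')).
near=> t; have nK : (~` K) (ins t) by near: t; exact: H.
by rewrite /slice -(f0 _ nK) /ins; case: (j).
Unshelve. all: by end_near. Qed.

Lemma test_fun_partial Om phi j : test_fun Om phi -> test_fun Om (partial j phi).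
Proof.
move=> tphi; have [K [cK KO p0]] := test_fun_supp tphi.
apply: (test_fun_intro (smooth_partial j (test_fun_smooth tphi)) cK KO) => x nx.
apply: pd_partial (pd_out _ (compact_closed (@norm_hausdorff _ _) cK) p0 nx).
Qed.

Lemma test_funMl Om phi g : test_fun Om phi -> smooth g -> test_fun Om (fun x => g x * phi x).
Proof.
move=> tphi sg; have [K [cK KO p0]] := test_fun_supp tphi.
apply: (test_fun_intro (smoothM sg (test_fun_smooth tphi)) cK KO) => x /p0 ->.
by rewrite mulr0.
Qed.

Lemma test_funZ Om phi (k : R) : test_fun Om phi -> test_fun Om (fun x => k * phi x).
Proof. by move=> tphi; apply: test_funMl tphi (smooth_cst k). Qed.

Definition opp2 c : R * R := (- c.1, - c.2).

Lemma shift2K c : cancel (shift2 c) (shift2 (opp2 c)).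
Proof. by case=> a b; rewrite /shift2 /= !addrK. Qed.

Lemma test_fun_shift phi c : test_fun setT phi -> test_fun setT (phi \o shift2 c).
Proof.
move=> tphi; have [K [cK _ p0]] := test_fun_supp tphi.
apply: (@test_fun_intro _ (shift2 (opp2 c) @` K)) => //.
- exact: smooth_shift2 (test_fun_smooth tphi).
- apply: continuous_compact cK; apply: continuous_subspaceT; exact: continuous_shift2.
- by move=> x nx; apply: p0 => Kx; apply: nx; exists (shift2 c x) => //; rewrite shift2K.
Qed.

Lemma compact_coord_bounded K (i : bool) : compact K ->
  exists M : R, forall x, K x -> `|coord i x| <= M.
Proof.
move=> cK; have cc : continuous (coord i : R * R -> R).
  by move=> x; case: i; [exact: cvg_snd|exact: cvg_fst].
have := continuous_compact (continuous_subspaceT cc) cK.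
move=> /compact_bounded[M [_ MP]]; exists (`|M| + 1) => x Kx.
apply: (MP (`|M| + 1)); last by exists x.
by rewrite (le_lt_trans (ler_norm M))// ltrDl.
Qed.

Lemma compact_sub_square K : compact K -> exists2 r : R, 0 < r & K `<=` square r.
Proof.
move=> cK; have [M MP] := compact_coord_bounded false cK.
have [N NP] := compact_coord_bounded true cK.
exists (2 * (`|M| + `|N| + 1)); first by rewrite mulr_gt0// ltr_wpDl// addr_ge0.
move=> x Kx; apply/squareP; split.
  apply: le_lt_trans (MP _ Kx) _; have := ler_norm M; have := normr_ge0 N; lra.
apply: le_lt_trans (NP _ Kx) _; have := ler_norm N; have := normr_ge0 M; lra.
Qed.

Lemma test_fun_square Om phi : test_fun Om phi ->
  exists2 r : R, 0 < r & forall x, ~ square r x -> phi x = 0.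
Proof.
move=> /test_fun_supp[K [cK _ p0]]; have [r r0 Kr] := compact_sub_square cK.
by exists r => // x nx; apply: p0 => /Kr.
Qed.

Lemma test_fun_bounded Om phi : test_fun Om phi ->
  exists2 M : R, 0 <= M & forall x, `|phi x| <= M.
Proof.
move=> tphi; have [K [cK _ p0]] := test_fun_supp tphi.
have cphi := smooth_continuous (test_fun_smooth tphi).
have := continuous_compact (continuous_subspaceT cphi) cK.
move=> /compact_bounded[M [_ MP]]; exists (`|M| + 1); first by rewrite addr_ge0.
move=> x; have [Kx|/p0 ->] := pselect (K x); last by rewrite normr0 addr_ge0.
apply: (MP (`|M| + 1)); last by exists x.
by rewrite (le_lt_trans (ler_norm M))// ltrDl.
Qed.

Lemma test_fun_meas Om phi : test_fun Om phi -> meas2 phi.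
Proof. by move=> /test_fun_smooth/smooth_continuous/meas2_continuous. Qed.

Lemma test_fun_intg Om phi : test_fun Om phi -> intg phi.
Proof.
move=> tphi; have [M _ MP] := test_fun_bounded tphi.
have [r _ rP] := test_fun_square tphi.
exact: intg_supp (test_fun_meas tphi) MP rP.
Qed.

Lemma intg_test Om f phi : intg f -> test_fun Om phi -> intg (fun x => f x * phi x).
Proof.
move=> hf tphi; have [M _ MP] := test_fun_bounded tphi.
exact: intg_mulb hf (test_fun_meas tphi) MP.
Qed.

Lemma slice_lipschitz phi j x (M a b : R) : smooth phi ->
  (forall y, `|partial j phi y| <= M) ->
  `|slice j phi x a - slice j phi x b| <= M * `|a - b|.
Proof.
move=> sphi phiM.
wlog ab : a b / b <= a.
  by move=> H; have [/H//|/ltW/H] := leP b a; rewrite distrC [X in _ * X]distrC.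
pose ins t : R * R := if j then (x.1, t) else (t, x.2).
have di t : is_derive (t : R) (1 : R) (slice j phi x) (partial j phi (ins t)).
  have := smooth_pd j (ins t) sphi; rewrite /pd.
  by congr is_derive; rewrite /ins; case: j {phiM ins}.
have [|t _ ->] := @MVT_segment R (slice j phi x) (fun t => partial j phi (ins t)) b a ab.
  by apply: derivable_within_continuous => t _; case: (di t).
by rewrite normrM ler_wpM2r.
Qed.

Lemma test_fun_lipschitz Om phi : test_fun Om phi ->
  exists2 M : R, 0 <= M & forall x y,
    `|phi x - phi y| <= M * (`|x.1 - y.1| + `|x.2 - y.2|).
Proof.
move=> tphi.
have [M1 M10 MP1] := test_fun_bounded (test_fun_partial false tphi).
have [M2 M20 MP2] := test_fun_bounded (test_fun_partial true tphi).
have sphi := test_fun_smooth tphi.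
exists (M1 + M2); first exact: addr_ge0.
move=> x y.
have e1 := slice_lipschitz x (x.1) (y.1) sphi MP1.
have e2 := slice_lipschitz y (x.2) (y.2) sphi MP2.
have -> : phi x - phi y = (phi x - phi (y.1, x.2)) + (phi (y.1, x.2) - phi y) by ring.
rewrite (le_trans (ler_normD _ _))//.
move: e1 e2; rewrite /slice /= -!surjective_pairing => e1 e2.
apply: le_trans (lerD e1 e2) _.
rewrite mulrDr lerD// ler_wpM2r//; lra.
Qed.

Lemma lipschitz_continuous2 f (C : R) :
  (forall x y, `|f x - f y| <= C * (`|x.1 - y.1| + `|x.2 - y.2|)) -> continuous f.
Proof.
move=> fC x; apply/cvgrPdist_lt => e e0.
have cv : (fun y : R * R => C * (`|x.1 - y.1| + `|x.2 - y.2|)) @ x --> C * (`|x.1 - x.1| + `|x.2 - x.2|).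
  apply: cvgMr; apply: cvgD; apply: cvg_norm; apply: cvgB;
    [exact: cvg_cst|exact: cvg_fst|exact: cvg_cst|exact: cvg_snd].
move: cv; rewrite !subrr normr0 addr0 mulr0 => /cvgr0_norm_lt/(_ e e0).
apply: filterS => y /=; apply: le_lt_trans.
by rewrite (le_trans (fC x y))// ler_norm.
Qed.

End TestFunctions.

(** * Correlation with a test function, and integration by parts *)

Section Correlation.
Context {R : realType}.
Local Notation plane := (measurableTypeR R * measurableTypeR R)%type.
Local Notation mu2 := (@lebesgue2 R).
Implicit Types (f g phi psi : R * R -> R) (x c : R * R).

(** Correlation rather than convolution, so that derivatives and weak
    derivatives match with translates of [psi] and no reflection is needed. *)
Definition corr f psi x : R := I2 (fun y => f y * psi (shift2 (opp2 x) y)).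

Lemma intg_corr f psi x : intg f -> test_fun setT psi ->
  intg (fun y => f y * psi (shift2 (opp2 x) y)).
Proof. by move=> hf tpsi; apply: intg_test hf (test_fun_shift (opp2 x) tpsi). Qed.

(** A test function is Lipschitz, which bounds the difference of two values. *)
Lemma corr_continuous f psi : intg f -> test_fun setT psi -> continuous (corr f psi).
Proof.
move=> hf tpsi; have [M M0 ML] := test_fun_lipschitz tpsi.
apply: (@lipschitz_continuous2 _ _ (M * I2 (fun y => `|f y|))) => x y.
rewrite /corr -I2B; try exact: intg_corr.
apply: le_trans (le_norm_I2 _) _; first by apply: intgB; exact: intg_corr.
pose d := `|x.1 - y.1| + `|x.2 - y.2|.
rewrite -mulrA (mulrC _ d) mulrA -I2Z; last exact: intg_norm.
apply: le_I2; first by apply/intg_norm/intgB; exact: intg_corr.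
  exact/intgZ/intg_norm.
move=> z; rewrite -mulrBr normrM mulrC ler_wpM2r//.
apply: le_trans (ML _ _) _; rewrite ler_wpM2l// /shift2/= /d.
have -> : z.1 - x.1 - (z.1 - y.1) = y.1 - x.1 by ring.
have -> : z.2 - x.2 - (z.2 - y.2) = y.2 - x.2 by ring.
by rewrite distrC (distrC y.2).
Qed.

(** Differentiation under the integral sign, dominated by the bounded
    derivatives of the test function. *)
Lemma corr_pd f psi j x : intg f -> test_fun setT psi ->
  pd j (corr f psi) x (- corr f (partial j psi) x).
Proof.
move=> hf tpsi; have spsi := test_fun_smooth tpsi.
have tdpsi := test_fun_partial j tpsi.
have [M M0 MP] := test_fun_bounded tdpsi.
pose ins t : R * R := if j then (x.1, t) else (t, x.2).
pose F t y := f y * psi (shift2 (opp2 (ins t)) y).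
have dF t y : is_derive (t : R) (1 : R) (F ^~ y) (- (f y * partial j psi (shift2 (opp2 (ins t)) y))).
  have dp : is_derive (coord j (shift2 (opp2 (ins t)) y)) (1 : R)
      (slice j psi (shift2 (opp2 (ins t)) y)) (partial j psi (shift2 (opp2 (ins t)) y)).
    exact: smooth_pd.
  have dl : is_derive t (1 : R) (fun s => coord j y - s) (- 1).
    apply: (is_derive_eq (is_deriveD (is_derive_cst (coord j y) t (1 : R)) (is_deriveN (is_derive_id t (1 : R))))).
    by rewrite add0r.
  have ct : coord j (shift2 (opp2 (ins t)) y) = coord j y - t.
    by rewrite /ins /shift2 /opp2; case: (j).
  rewrite ct in dp.
  have dc : is_derive t (1 : R) (slice j psi (shift2 (opp2 (ins t)) y) \o (fun s => coord j y - s))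
      (partial j psi (shift2 (opp2 (ins t)) y) * -1).
    exact: is_derive1_comp.
  have -> : F ^~ y = (fun s => f y * (slice j psi (shift2 (opp2 (ins t)) y) \o (fun s => coord j y - s)) s).
    by apply/funext => s; rewrite /F /ins /slice /shift2 /opp2; case: (j).
  by apply: is_derive_eq; rewrite /GRing.scale/=; ring.
have d1 t y : partial1of2 F t y = - (f y * partial j psi (shift2 (opp2 (ins t)) y)).
  by rewrite partial1of2E; have [_ ->] := dF t y.
pose a := coord j x.
have aI : `]a - 1, a + 1[%classic a by rewrite /= in_itv/=; apply/andP; split; lra.
have iF t : `]a - 1, a + 1[%classic t -> mu2.-integrable setT (EFin \o F t).
  by move=> _; exact: intg_corr.
have dF' t y : `]a - 1, a + 1[%classic t -> setT y -> derivable (F ^~ y) t 1.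
  by move=> _ _; case: (dF t y).
have G0 y : 0 <= M * `|f y| by rewrite mulr_ge0.
have iG : mu2.-integrable setT (EFin \o (fun y => M * `|f y|)) by exact/intgZ/intg_norm.
have bG t y : `]a - 1, a + 1[%classic t -> setT y -> `|partial1of2 F t y| <= M * `|f y|.
  by move=> _ _; rewrite d1 normrN normrM mulrC ler_wpM2r.
have der := derivable_under_integral measurableT aI iF dF' G0 iG bG.
have val := differentiation_under_integral measurableT aI iF dF' G0 iG bG.
rewrite /pd; have -> : slice j (corr f psi) x = (fun t => I2 (F t)).
  by apply/funext => t; rewrite /slice /corr /F /ins; case: (j).
apply: DeriveDef; first exact: der.
rewrite -derive1E val /corr -I2N; last exact: intg_corr.
apply: I2_ext => y; rewrite d1; congr (- (_ * partial j psi _)).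
by rewrite /ins /a; case: (j) => /=; rewrite -surjective_pairing.
Qed.

Lemma corr_smooth f psi : intg f -> test_fun setT psi -> smooth (corr f psi).
Proof.
move=> hf tpsi.
apply: (@smooth_coind _ (fun h => exists2 phi, test_fun setT phi & h = corr f phi)); last by exists psi.
move=> _ [phi tphi ->]; split; first exact: corr_continuous.
move=> j; exists (corr f (fun x => - 1 * partial j phi x)).
  by exists (fun x => - 1 * partial j phi x) => //; exact/test_funZ/test_fun_partial.
move=> x; have := corr_pd j x hf tphi; rewrite /corr -I2N.
  by congr pd; apply: I2_ext => y; ring.
exact/intg_corr/test_fun_partial.
Qed.

Lemma corr_partial f psi j x : intg f -> test_fun setT psi ->
  partial j (corr f psi) x = - corr f (partial j psi) x.
Proof. by move=> hf tpsi; apply/pd_partial/corr_pd. Qed.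

Lemma corr_supp f psi (r d : R) x : (forall y, ~ square r y -> f y = 0) ->
  (forall y, ~ square d y -> psi y = 0) -> ~ square (r + d) x -> corr f psi x = 0.
Proof.
move=> f0 psi0 nx; rewrite /corr -[RHS]I2_0; apply: I2_ext => y.
have [fy|/f0 ->] := pselect (square r y); last by rewrite mul0r.
rewrite psi0 ?mulr0// => py; apply: nx.
move: fy py => /square_rect[a1 a2 a3 a4] /square_rect.
rewrite /shift2 /opp2/= => -[b1 b2 b3 b4]; apply/square_rect; split; lra.
Qed.

Lemma test_fun_rect Om phi (r s : R) : smooth phi -> r < s -> square s `<=` Om ->
  (forall x, ~ square r x -> phi x = 0) -> test_fun Om phi.
Proof.
move=> sphi rs sO phi0.
apply: (@test_fun_intro _ _ (`[- (r / 2), r / 2] `*` `[- (r / 2), r / 2])) => //.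
- by apply: compact_setX; exact: segment_compact.
- move=> x [/= ]; rewrite !in_itv/= => /andP[a1 a2] /andP[a3 a4].
  by apply: sO; apply/square_rect; split; lra.
- move=> x nx; apply: phi0 => /square_rect[a1 a2 a3 a4]; apply: nx.
  by split; rewrite /= in_itv/=; apply/andP; split; lra.
Qed.

(** Where the translated support stays inside the square, the correlation with
    an indicator function is constant: this computes the integral of a derivative
    without iterated integrals. *)
Lemma corr_indic psi (r : R) x : meas2 psi -> (forall y, ~ square r y -> psi y = 0) ->
  `|x.1| <= 1 -> `|x.2| <= 1 -> corr \1_(square (r + 4)) psi x = I2 psi.
Proof.
rewrite !ler_norml => mpsi psi0 /andP[x1 x1'] /andP[x2 x2'].
rewrite -(I2_shift (opp2 x) mpsi) /corr; apply: I2_ext => y /=.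
have [/square_rect|/psi0 ->] := pselect (square r (shift2 (opp2 x) y)); last by rewrite mulr0.
rewrite /shift2/= => -[a1 a2 a3 a4]; rewrite indicE mem_set ?mul1r//.
by apply/square_rect; split; lra.
Qed.

(** Near the origin the correlation with the indicator of a large square is
    constant, and its derivative there is minus the integral of the derivative. *)
Lemma I2_partial0 Om phi j : test_fun Om phi -> I2 (partial j phi) = 0.
Proof.
move=> /(test_funS (@subsetT _ _)) tphi; have tdphi := test_fun_partial j tphi.
have [r1 _ r1P] := test_fun_square tphi; have [r2 _ r2P] := test_fun_square tdphi.
pose r := Num.max r1 r2.
have phi0 y : ~ square r y -> phi y = 0.
  by move=> ny; apply: r1P => /(square_le _)ry; apply: ny; apply: ry; rewrite le_max lexx.
have dphi0 y : ~ square r y -> partial j phi y = 0.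
  by move=> ny; apply: r2P => /(square_le _)ry; apply: ny; apply: ry; rewrite le_max lexx orbT.
pose f : R * R -> R := \1_(square (r + 4)).
have hf : intg f by exact: intg_indic_square.
rewrite -(@corr_indic _ r (0, 0)) ?normr0//; last exact: test_fun_meas tdphi.
apply: oppr_inj; rewrite oppr0 -(corr_partial j _ hf tphi).
apply: pd_partial; rewrite /pd.
apply: (@near_eq_is_derive _ _ _ (cst (I2 phi) : R -> R)).
near=> t.
have t1 : `|t| <= 1.
  apply: ltW; near: t; have -> : coord j ((0, 0) : R * R) = 0 by case: (j).
  by apply: (@nbhs0_lt R R 1).
rewrite /slice /f; case: (j); rewrite corr_indic ?normr0//; exact: test_fun_meas tphi.
Unshelve. all: by end_near. Qed.

(** The integral of the derivative of the product is zero. *)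
Lemma I2_parts Om phi psi j : test_fun Om phi -> smooth psi ->
  I2 (fun x => phi x * partial j psi x) = - I2 (fun x => partial j phi x * psi x).
Proof.
move=> tphi spsi.
have i1 : intg (fun x => phi x * partial j psi x).
  apply: (@test_fun_intg _ Om); have := test_funMl tphi (smooth_partial j spsi).
  by congr test_fun; apply/funext => x; rewrite mulrC.
have i2 : intg (fun x => partial j phi x * psi x).
  apply: (@test_fun_intg _ Om); have := test_funMl (test_fun_partial j tphi) spsi.
  by congr test_fun; apply/funext => x; rewrite mulrC.
apply/eqP; rewrite -addr_eq0 -I2D//; apply/eqP.
rewrite -(I2_partial0 j (test_funMl tphi spsi)); apply: I2_ext => x.
by rewrite (partialM j x spsi (test_fun_smooth tphi)); ring.
Qed.

(** A normalized product of bump functions of one variable. *)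
Lemma mollifier_exists (d : R) : 0 < d -> exists rho : R * R -> R,
  [/\ test_fun setT rho, forall x, 0 <= rho x, forall x, ~ square d x -> rho x = 0 & I2 rho = 1].
Proof.
move=> d0; pose q := d / 4; have q0 : 0 < q by rewrite divr_gt0.
pose k (t : R) := bump (q + t) * bump (q - t).
have sk : smooth1 k.
  apply: smooth1_algP; apply: s1_mul; apply: s1_smooth.
    have := smooth1_affine 1 q (@smooth1_bump R); congr smooth1.
    by apply/funext => t; rewrite mul1r addrC.
  have := smooth1_affine (- 1) q (@smooth1_bump R); congr smooth1.
  by apply/funext => t; rewrite mulN1r addrC.
pose m (x : R * R) := k x.1 * k x.2.
have sm : smooth m := smoothM (smooth1_coord false sk) (smooth1_coord true sk).
have k0 t : 0 <= k t by rewrite mulr_ge0// bump_ge0.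
have kout t : ~~ (`|t| < q) -> k t = 0.
  move=> nt; rewrite /k; have [t0|t0] := leP 0 t.
    rewrite ger0_norm// in nt; rewrite (@bump_eq0 _ (q - t)) ?mulr0//; lra.
  rewrite ltr0_norm// in nt; rewrite bump_eq0 ?mul0r//; lra.
have mout x : ~ square (2 * q) x -> m x = 0.
  move=> nx; rewrite /m; have [x1|/kout ->] := boolP (`|x.1| < q); last by rewrite mul0r.
  have [x2|/kout ->] := boolP (`|x.2| < q); last by rewrite mulr0.
  by exfalso; apply: nx; apply/squareP; split; lra.
have tm : test_fun setT m.
  by apply: (@test_fun_rect _ _ (2 * q) (2 * q + 1)) => //; rewrite ltrDl.
have m0 x : 0 <= m x by rewrite mulr_ge0.
have Im : 0 < I2 m.
  pose b := bump (q / 2); have b0 : 0 < b by rewrite bump_gt0 ?divr_gt0.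
  have klow t : `|t| < q / 2 -> b ^+ 2 <= k t.
    rewrite ltr_norml => /andP[t1 t2]; rewrite expr2 ler_pM ?bump_ge0// le_bump//; lra.
  apply: (@lt_le_trans _ _ (b ^+ 4 * q ^+ 2)); first by rewrite mulr_gt0 ?exprn_gt0.
  rewrite -(I2_indic_square (ltW q0)) -I2Z; last exact: intg_indic_square.
  apply: le_I2; [exact/intgZ/intg_indic_square|exact: test_fun_intg tm|move=> x].
  rewrite indicE; have [/set_mem/squareP[x1 x2]|_] := boolP (x \in _); last by rewrite mulr0.
  rewrite mulr1; have -> : b ^+ 4 = b ^+ 2 * b ^+ 2 by ring.
  by rewrite ler_pM ?sqr_ge0 ?klow.
exists (fun x => (I2 m)^-1 * m x); split.
- exact: test_funZ.
- by move=> x; rewrite mulr_ge0// invr_ge0 ltW.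
- move=> x nx; rewrite mout ?mulr0// => /(square_le _) mx; apply: nx; apply: mx.
  by rewrite /q; lra.
- by rewrite I2Z ?mulVf ?gt_eqF//; exact: test_fun_intg tm.
Qed.

End Correlation.

(** * Continuity of translations in mean on the line *)

Section TranslationContinuity.
Context {R : realType}.
Local Notation RM := (measurableTypeR R).
Local Notation plane := (measurableTypeR R * measurableTypeR R)%type.
Local Notation mu := (@lebesgue_measure R).
Local Notation mu2 := (@lebesgue2 R).
Implicit Types (x z : R * R).

Lemma ge0_cvge0 (a : nat -> \bar R) : (forall n, (0 <= a n)%E) ->
  (forall e : R, 0 < e -> \forall n \near \oo, (a n <= e%:E)%E) -> a @ \oo --> 0%E.
Proof.
move=> a0 ae; apply/fine_cvgP; split.
  near=> n; rewrite ge0_fin_numE//; apply: (@le_lt_trans _ _ 1%:E); last exact: ltry.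
  by near: n; exact: ae.
apply/cvgrPdist_le => e e0; near=> n; rewrite sub0r normrN /=.
have an : (a n <= e%:E)%E by near: n; exact: ae.
have fa : a n \is a fin_num by rewrite ge0_fin_numE// (le_lt_trans an)// ltry.
by rewrite ger0_norm ?fine_ge0// -lee_fin fineK.
Unshelve. all: by end_near. Qed.

Lemma cvge0_le (a : nat -> \bar R) (e : R) : a @ \oo --> 0%E -> 0 < e ->
  \forall n \near \oo, (a n <= e%:E)%E.
Proof.
move=> /fine_cvgP[fa /cvgr0Pnorm_le H] e0.
near=> n; have fan : a n \is a fin_num by near: n.
rewrite -[leLHS]fineK// lee_fin (le_trans (ler_norm _))//.
by near: n; exact: H.
Unshelve. all: by end_near. Qed.

Lemma ge0_integral_addc (s : R) (f : RM -> \bar R) : measurable_fun setT f ->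
  (forall t, 0 <= f t)%E -> (\int[mu]_t f (t + s)%R = \int[mu]_t f t)%E.
Proof.
move=> mf f0; transitivity (\int[pushforward mu (addc_mfun s)]_t f t)%E.
  by rewrite ge0_integral_pushforward// preimage_setT.
by apply: eq_measure_integral => A mA _; exact: lebesgue_measure_addc.
Qed.

Lemma cvg_norm_shift_seq (G : R -> R) (t : R) (s : nat -> R) :
  {for t, continuous G} -> s @ \oo --> (0 : R) ->
  (fun n => `|G (t + s n) - G t|) @ \oo --> (0 : R).
Proof.
move=> cG s0; have ts : (fun n => t + s n) @ \oo --> t.
  by rewrite -[X in _ --> X]addr0; apply: cvgD; [exact: cvg_cst|exact: s0].
have Gs : (fun n => G (t + s n)) @ \oo --> G t by apply: continuous_cvg.
have : (fun n => `|G (t + s n) - G t|) @ \oo --> `|G t - G t|.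
  by apply: cvg_norm; apply: cvgB => //; exact: cvg_cst.
by rewrite subrr normr0.
Qed.

(** By density of continuous functions: for a continuous function restricted to
    a segment the translates converge off the end points, and dominated convergence
    applies. *)
Lemma L1_shift_cvg1 (h : RM -> R) (N : R) (s : nat -> R) :
  mu.-integrable setT (EFin \o h) -> (forall t, ~ `[- N, N]%classic t -> h t = 0) ->
  s @ \oo --> (0 : R) -> (forall n, `|s n| <= 1) ->
  (fun n => \int[mu]_t `|h (t + s n) - h t|%:E)%E @ \oo --> 0%E.
Proof.
move=> ih h0 s0 s1; pose E : set RM := `[- N, N]%classic.
have mE : measurable E by exact: measurable_itv.
have mh : measurable_fun setT h by case/integrableP : ih => /measurable_EFinP.
have Efin : (mu E < +oo)%E.
  by rewrite lebesgue_measure_itv/=; case: ifP => // _; rewrite -EFinB ltry.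
have ihE : mu.-integrable E (EFin \o h) by exact: integrableS ih.
have [g_ [cg ig hg]] := approximation_continuous_integrable mE Efin ihE.
apply: ge0_cvge0 => [n|e e0]; first by apply: integral_ge0 => t _; rewrite lee_fin.
have e40 : 0 < e / 4 by rewrite divr_gt0.
have [m _ /(_ m (leqnn m))] := cvge0_le hg e40; set g := g_ m => hgm.
(* Cut off to the segment, [g] becomes bounded; it loses continuity at the end
   points only. *)
pose G t := g t * \1_E t.
have mg : measurable_fun setT g by apply: continuous_measurable_fun; exact: cg.
have mG : measurable_fun setT (G : RM -> R).
  by apply: measurable_funM => //; exact: measurable_indic.
have mGs n : measurable_fun setT (fun t : RM => G (t + s n)).
  exact: measurableT_comp mG (measurable_addc (s n)).
have mhs n : measurable_fun setT (fun t : RM => h (t + s n)).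
  exact: measurableT_comp mh (measurable_addc (s n)).
have hG : (\int[mu]_t `|h t - G t|%:E <= (e / 4)%:E)%E.
  apply: le_trans hgm; rewrite [leRHS]integral_mkcond le_eqVlt; apply/orP; left; apply/eqP.
  apply: eq_integral => t _; rewrite patchE; case: ifPn => tE; rewrite /G indicE.
    by rewrite tE mulr1.
  have ht : h t = 0 by apply: h0 => tE'; move/negP : tE; apply; exact/mem_set.
  by rewrite ht (negbTE tE) mulr0 subr0 normr0.
have GG : (fun n => \int[mu]_t `|G (t + s n) - G t|%:E)%E @ \oo --> 0%E.
  have [M M0 GM] : exists2 M : R, 0 <= M & forall t, `|G t| <= M.
    have : compact (g @` E).
      by apply: continuous_compact; [exact/continuous_subspaceT/cg|exact: segment_compact].
    move=> /compact_bounded[M [_ MP]]; exists (`|M| + 1); first by rewrite addr_ge0.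
    move=> t; rewrite /G indicE; have [/set_mem tE|_] := boolP (t \in E); last first.
      by rewrite mulr0 normr0 addr_ge0.
    rewrite mulr1; apply: (MP (`|M| + 1)); last by exists t.
    by rewrite (le_lt_trans (ler_norm M))// ltrDl.
  pose D := `[- (`|N| + 1), `|N| + 1]%classic : set RM.
  have mD : measurable D by exact: measurable_itv.
  have Dfin : (mu D < +oo)%E.
    by rewrite lebesgue_measure_itv/=; case: ifP => // _; rewrite -EFinB ltry.
  have := @dominated_convergence _ _ _ mu setT measurableT
    (fun n t => `|G (t + s n) - G t|%:E) (cst 0%E)
    (fun t => (2 * M * \1_D t)%:E).
  case => //.
  - move=> n; apply/measurable_EFinP; apply: measurableT_comp => //; exact: measurable_funB.
  - have negl : mu.-negligible ([set N] `|` [set - N]).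
      have n1 (a : R) : mu.-negligible [set a].
        by exists [set a]; split; [exact: measurable_set1|exact: lebesgue_measure_set1|].
      exact: negligibleU.
    apply: negligibleS negl => t /=; apply: contra_notP => tN _.
    have tN1 : t != N by apply/eqP => tN1; apply: tN; left.
    have tN2 : t != - N by apply/eqP => tN2; apply: tN; right.
    have cG : {for t, continuous (G : R -> R)}.
      have [tE|tE] := boolP (t \in `]- N, N[).
        apply: (@cvg_trans _ (g @ t)); last first.
          rewrite /G indicE mem_set ?mulr1; first exact: cg.
          by move: tE; rewrite /E/= !in_itv/= => /andP[a b]; rewrite !ltW.
        apply: near_eq_cvg; near=> u; rewrite /G indicE mem_set ?mulr1//.
        have : u \in `]- N, N[ by near: u; exact: near_in_itvoo.
        by rewrite /E/= !in_itv/= => /andP[a b]; rewrite !ltW.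
      have Gt : \forall u \near t, G u = 0.
        move: tE; rewrite in_itv/= negb_and -!leNgt => /orP[tE|tE].
          have tlt : t < - N by rewrite lt_neqAle tN2.
          near=> u; rewrite /G indicE memNset ?mulr0// /E/= in_itv/= => /andP[+ _].
          by rewrite leNgt => /negP; apply; near: u; exact: lt_nbhsl.
        have tgt : N < t by rewrite lt_neqAle eq_sym tN1.
        near=> u; rewrite /G indicE memNset ?mulr0// /E/= in_itv/= => /andP[_].
        by rewrite leNgt => /negP; apply; near: u; exact: lt_nbhsr.
      apply/cvgrPdist_lt => d d0; near=> u.
      have Gu : G u = 0 by near: u; exact: Gt.
      by rewrite (nbhs_singleton Gt) Gu subrr normr0.
    apply: cvg_EFin; first by near=> n.
    exact: cvg_norm_shift_seq cG s0.
  - apply/integrableP; split.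
      by apply/measurable_EFinP; apply: measurable_funM => //; exact: measurable_indic.
    under eq_integral do rewrite /= ger0_norm ?mulr_ge0//.
    under eq_integral do rewrite EFinM.
    rewrite ge0_integralZl//; [|exact/measurable_EFinP/measurable_indic|by rewrite lee_fin mulr_ge0].
    rewrite integral_indic// setIT; apply: lte_mul_pinfty => //.
    by rewrite lee_fin mulr_ge0.
  - apply: aeW => t n _ /=; rewrite normr_id lee_fin indicE.
    have [tD|tD] := boolP (t \in D).
      rewrite mulr1 (le_trans (ler_normB _ _))//; have := GM t; have := GM (t + s n); lra.
    have out u : `|t - u| <= 1 -> G u = 0.
      move=> tu; rewrite /G indicE memNset ?mulr0// => uE; move/negP: tD; apply; apply/mem_set.
      move: uE tu; rewrite /E /D/= !in_itv/= ler_norml => /andP[u1 u2] /andP[u3 u4].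
      by have := ler_norm N; have := ler_norm (- N); rewrite normrN => a b; apply/andP; split; lra.
    by rewrite !out ?subrr ?normr0 ?mulr0// opprD addNKr normrN.
  move=> _ _; congr (_ @ _ --> _); last by rewrite integral0.
near=> n.
have GGn : (\int[mu]_t `|G (t + s n) - G t|%:E <= (e / 4)%:E)%E.
  by near: n; exact: cvge0_le GG e40.
have hGs : (\int[mu]_t `|h (t + s n) - G (t + s n)|%:E <= (e / 4)%:E)%E.
  apply: le_trans hG.
  rewrite (@ge0_integral_addc (s n) (fun t => `|h t - G t|%:E))//.
  by apply/measurable_EFinP; apply: measurableT_comp => //; exact: measurable_funB.
apply: (@le_trans _ _ (\int[mu]_t (`|h (t + s n) - G (t + s n)|%:E +
    (`|G (t + s n) - G t|%:E + `|h t - G t|%:E)))%E).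
  apply: ge0_le_integral => //.
  - by apply/measurable_EFinP; apply: measurableT_comp => //; exact: measurable_funB.
  - by apply: emeasurable_funD; [|apply: emeasurable_funD]; apply/measurable_EFinP;
      apply: measurableT_comp => //; exact: measurable_funB.
  - move=> t _; rewrite -!EFinD lee_fin.
    have -> : h (t + s n) - h t = (h (t + s n) - G (t + s n)) + ((G (t + s n) - G t) - (h t - G t)) by ring.
    by rewrite (le_trans (ler_normD _ _))// lerD2l (le_trans (ler_normB _ _)).
rewrite ge0_integralD//; last 3 first.
- by apply/measurable_EFinP; apply: measurableT_comp => //; exact: measurable_funB.
- by move=> t _; rewrite -EFinD lee_fin addr_ge0.
- by apply: emeasurable_funD; apply/measurable_EFinP; apply: measurableT_comp => //; exact: measurable_funB.
rewrite ge0_integralD//; last 2 first.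
- by apply/measurable_EFinP; apply: measurableT_comp => //; exact: measurable_funB.
- by apply/measurable_EFinP; apply: measurableT_comp => //; exact: measurable_funB.
apply: (@le_trans _ _ ((e / 4)%:E + ((e / 4)%:E + (e / 4)%:E))%E).
  by apply: leeD => //; exact: leeD.
by rewrite -!EFinD lee_fin; lra.
Unshelve. all: by end_near. Qed.

End TranslationContinuity.

(** * Continuity of translations in mean on the plane *)

Section TranslationContinuity2.
Context {R : realType}.
Local Notation RM := (measurableTypeR R).
Local Notation plane := (measurableTypeR R * measurableTypeR R)%type.
Local Notation mu := (@lebesgue_measure R).
Local Notation mu2 := (@lebesgue2 R).
Implicit Types (f F rho : R * R -> R) (x z : R * R).

Lemma mu2_tonelli1 (f : plane -> \bar R) : measurable_fun setT f -> (forall x, 0 <= f x)%E ->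
  (\int[mu2]_x f x = \int[mu]_x1 \int[mu]_x2 f (x1, x2))%E.
Proof. by move=> mf f0; exact: (@fubini_tonelli1 _ _ _ _ _ mu mu f mf f0). Qed.

Lemma mu2_tonelli2 (f : plane -> \bar R) : measurable_fun setT f -> (forall x, 0 <= f x)%E ->
  (\int[mu2]_x f x = \int[mu]_x2 \int[mu]_x1 f (x1, x2))%E.
Proof. by move=> mf f0; exact: (@fubini_tonelli2 _ _ _ _ _ mu mu f mf f0). Qed.

Definition swap2 x : R * R := (x.2, x.1).

Lemma measurable_swap2 : measurable_fun setT (swap2 : plane -> plane).
Proof. by apply/measurable_fun_pairP; split; [exact: measurable_snd|exact: measurable_fst]. Qed.

Lemma ge0_integral_swap2 (f : plane -> \bar R) : measurable_fun setT f -> (forall x, 0 <= f x)%E ->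
  (\int[mu2]_x f (swap2 x) = \int[mu2]_x f x)%E.
Proof.
move=> mf f0; rewrite mu2_tonelli1//; last exact: measurableT_comp mf measurable_swap2.
by rewrite mu2_tonelli2.
Qed.

(** Dominated convergence for the inner integrals: on almost every line the
    inner integral tends to zero, and it is at most twice the norm of the slice. *)
Lemma L1_shift_cvg_fst f (r : R) (s : nat -> R) :
  intg f -> (forall x, ~ square r x -> f x = 0) ->
  s @ \oo --> (0 : R) -> (forall n, `|s n| <= 1) ->
  (fun n => \int[mu2]_x `|f (shift2 (s n, 0%R) x) - f x|%:E)%E @ \oo --> 0%E.
Proof.
move=> hf f0 s0 s1; have mf := intg_meas hf.
have md n : meas2 (fun x => `|f (shift2 (s n, 0) x) - f x|).
  by apply: meas2_norm; apply: meas2B => //; exact: (meas2_shift _ mf).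
have mdE n : measurable_fun setT (fun x : plane => `|f (shift2 (s n, 0) x) - f x|%:E).
  by apply/measurable_EFinP; exact: md.
have mn : measurable_fun setT (fun x : plane => `|f x|%:E).
  by apply/measurable_EFinP; exact: meas2_norm.
have d0 n (x : plane) : (0 <= `|f (shift2 (s n, 0) x) - f x|%:E)%E by rewrite lee_fin.
have n0 (x : plane) : (0 <= `|f x|%:E)%E by rewrite lee_fin.
pose G n (y : RM) : \bar R := (\int[mu]_t `|f (shift2 (s n, 0%R) (t, y)) - f (t, y)|%:E)%E.
pose H (y : RM) : \bar R := (\int[mu]_t `|f (t, y)|%:E)%E.
have -> : (fun n => \int[mu2]_x `|f (shift2 (s n, 0%R) x) - f x|%:E)%E =
    (fun n => \int[mu]_y G n y)%E.
  by apply/funext => n; rewrite mu2_tonelli2.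
have mG n : measurable_fun setT (G n).
  exact: (@measurable_fun_fubini_tonelli_G _ _ _ _ _ mu _ (mdE n) (d0 n)).
have mH : measurable_fun setT H by exact: (@measurable_fun_fubini_tonelli_G _ _ _ _ _ mu _ mn n0).
have IH : (\int[mu]_y H y < +oo)%E.
  rewrite (_ : (\int[mu]_y H y = \int[mu2]_x `|f x|%:E)%E); last by rewrite mu2_tonelli2.
  by case/integrableP : hf.
have sec (y : RM) : measurable_fun setT (fun t : RM => f (t, y)).
  exact: (@measurable_fun_pair1 _ _ _ _ _ _ (f : plane -> R) y mf).
have := @dominated_convergence _ _ _ mu setT measurableT G (cst 0%E) (fun y => 2%:E * H y)%E.
case.
- exact: mG.
- exact: measurable_cst.
- have := @ae_integrable2 _ _ _ _ _ mu mu (EFin \o f) hf.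
  apply: filterS => y iy _.
  have := @L1_shift_cvg1 R (fun t => f (t, y)) (r / 2) s iy _ s0 s1.
  have -> : (fun n => \int[mu]_t `|f (t + s n, y) - f (t, y)|%:E)%E = G ^~ y.
    by apply/funext => n; apply: eq_integral => t _; rewrite /shift2/= addr0.
  apply => t nt; apply: f0 => /square_rect[/= a b _ _]; apply: nt.
  by rewrite /= in_itv/= !ltW.
- apply/integrableP; split.
    by apply: measurable_funeM.
  under eq_integral do rewrite gee0_abs ?mule_ge0 ?integral_ge0//.
  rewrite ge0_integralZl//; last by move=> y _; exact: integral_ge0.
  by apply: lte_mul_pinfty.
- apply: aeW => y n _; rewrite gee0_abs; last exact: integral_ge0.
  apply: (@le_trans _ _ (\int[mu]_t (`|f (shift2 (s n, 0%R) (t, y))|%:E + `|f (t, y)|%:E))%E).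
    apply: ge0_le_integral => //.
    + exact: (@measurable_fun_pair1 _ _ _ _ _ _ _ y (mdE n)).
    + apply: emeasurable_funD; apply/measurable_EFinP.
        apply: measurableT_comp => //.
        exact: (@measurable_fun_pair1 _ _ _ _ _ _ ((f \o shift2 (s n, 0)) : plane -> R) y (meas2_shift _ mf)).
      exact: measurableT_comp (sec y).
    + by move=> t _; rewrite -EFinD lee_fin ler_normB.
  rewrite ge0_integralD//; last 2 first.
  + apply/measurable_EFinP; apply: measurableT_comp => //.
    exact: (@measurable_fun_pair1 _ _ _ _ _ _ ((f \o shift2 (s n, 0)) : plane -> R) y (meas2_shift _ mf)).
  + by apply/measurable_EFinP; exact: measurableT_comp (sec y).
  rewrite -/(H y).
  have -> : (\int[mu]_t `|f (shift2 (s n, 0%R) (t, y))|%:E = H y)%E.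
    rewrite /H -(@ge0_integral_addc R (s n) (fun t => `|f (t, y)|%:E))//.
      by apply: eq_integral => t _; rewrite /shift2/= addr0.
    by apply/measurable_EFinP; exact: measurableT_comp (sec y).
  by rewrite mule_natl mule2n.
by move=> _ _; rewrite integral0.
Qed.

(** Exchange of the coordinates. *)
Lemma L1_shift_cvg_snd f (r : R) (s : nat -> R) :
  intg f -> (forall x, ~ square r x -> f x = 0) ->
  s @ \oo --> (0 : R) -> (forall n, `|s n| <= 1) ->
  (fun n => \int[mu2]_x `|f (shift2 (0%R, s n) x) - f x|%:E)%E @ \oo --> 0%E.
Proof.
move=> hf f0 s0 s1; have mf := intg_meas hf.
have hg : intg (f \o swap2).
  apply/integrableP; split.
    by apply/measurable_EFinP; exact: measurableT_comp mf measurable_swap2.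
  have /= -> := @ge0_integral_swap2 (fun x => `|(f x)%:E|)%E.
  - by case/integrableP : hf.
  - by apply/measurable_EFinP; exact: meas2_norm mf.
  - by move=> x; rewrite lee_fin.
have g0 x : ~ square r x -> (f \o swap2) x = 0.
  move=> nx; apply: f0 => /squareP[a b]; apply: nx; exact/squareP.
have -> : (fun n => \int[mu2]_x `|f (shift2 (0%R, s n) x) - f x|%:E)%E =
    (fun n => \int[mu2]_x `|(f \o swap2) (shift2 (s n, 0%R) x) - (f \o swap2) x|%:E)%E; last first.
  exact: L1_shift_cvg_fst hg g0 s0 s1.
apply/funext => n; rewrite -[LHS]ge0_integral_swap2//.
by apply/measurable_EFinP; apply: meas2_norm; apply: meas2B => //; exact: (meas2_shift _ mf).
Qed.

(** A translation is a composite of translations along both axes; a sequence of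
    counterexamples shrinking to 0 would contradict the sequential statements. *)
Lemma L1_shift_continuous f (r e : R) : intg f -> (forall x, ~ square r x -> f x = 0) -> 0 < e ->
  exists2 d : R, 0 < d & forall z, square d z -> I2 (fun x => `|f (shift2 z x) - f x|) <= e.
Proof.
move=> hf f0 e0; have mf := intg_meas hf; apply: contrapT => nd.
have bad n : exists z, square (n.+1%:R^-1) z /\ e < I2 (fun x => `|f (shift2 z x) - f x|).
  apply: contrapT => nz; apply: nd; exists n.+1%:R^-1 => // z sz.
  by rewrite leNgt; apply/negP => ez; apply: nz; exists z.
have [zz zP] : {zz : nat -> R * R & forall n, square (n.+1%:R^-1) (zz n) /\ e < I2 (fun x => `|f (shift2 (zz n) x) - f x|)}.
  by exists (fun n => projT1 (cid (bad n))) => n; exact: projT2 (cid (bad n)).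
have small (i : bool) n : `|coord i (zz n)| <= n.+1%:R^-1.
  have [/squareP[a b] _] := zP n; have p : (0 : R) < n.+1%:R^-1 by [].
  by move: a b p; set q := n.+1%:R^-1 => a b p; case: i => /=; lra.
have c0 (i : bool) : (fun n => coord i (zz n)) @ \oo --> (0 : R).
  apply/cvgr0Pnorm_le => d d0; near=> n; rewrite (le_trans (small i n))// ltW//.
  near: n; exact: near_infty_natSinv_lt (PosNum d0).
have c1 (i : bool) n : `|coord i (zz n)| <= 1.
  by rewrite (le_trans (small i n))// invf_le1// ler1n.
have e20 : 0 < e / 4 by rewrite divr_gt0.
have c1n := cvge0_le (L1_shift_cvg_fst hf f0 (c0 false) (c1 false)) e20.
have c2n := cvge0_le (L1_shift_cvg_snd hf f0 (c0 true) (c1 true)) e20.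
near \oo => n.
have [_] := zP n; rewrite ltNge => /negP; apply.
have h1 : (\int[mu2]_x `|f (shift2 (coord false (zz n), 0%R) x) - f x|%:E <= (e / 4)%:E)%E.
  near: n; exact: c1n.
have h2 : (\int[mu2]_x `|f (shift2 (0%R, coord true (zz n)) x) - f x|%:E <= (e / 4)%:E)%E.
  near: n; exact: c2n.
have ig c : intg (fun x => `|f (shift2 c x) - f x|) by apply/intg_norm/intgB => //; exact: intg_shift.
rewrite I2_EFin// lee_fin in h1; rewrite I2_EFin// lee_fin in h2.
move: h1 h2; set z1 := (_, 0); set z2 := (0, _) => h1 h2.
apply: (@le_trans _ _ (I2 (fun x => `|f (shift2 z1 (shift2 z2 x)) - f (shift2 z2 x)| + `|f (shift2 z2 x) - f x|))).
  apply: le_I2 => //.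
    apply: intgD => //; exact: (intg_shift z2 (ig z1)).
  move=> x; rewrite (_ : shift2 z1 (shift2 z2 x) = shift2 (zz n) x).
    by rewrite -[X in `|X| <= _](subrKA (f (shift2 z2 x))) ler_normD.
  by rewrite /shift2/= addr0 addr0.
rewrite I2D//; last exact: (intg_shift z2 (ig z1)).
rewrite (I2_shift z2 (f := fun x => `|f (shift2 z1 x) - f x|)); last exact: intg_meas (ig z1).
by lra.
Unshelve. all: by end_near. Qed.

End TranslationContinuity2.

(** * Mollification in mean and in quadratic mean *)

Section Mollification.
Context {R : realType}.
Local Notation plane := (measurableTypeR R * measurableTypeR R)%type.
Local Notation mu2 := (@lebesgue2 R).
Implicit Types (f g F rho : R * R -> R) (x y z : R * R).

Definition unit_mollifier (d : R) rho : Prop :=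
  [/\ test_fun setT rho, forall x, 0 <= rho x, forall x, ~ square d x -> rho x = 0 & I2 rho = 1].

Lemma shift2C x y : shift2 x y = shift2 y x.
Proof. by rewrite /shift2 addrC [X in (_, X)]addrC. Qed.

Lemma meas2_pair_shift F : meas2 F ->
  measurable_fun setT (fun p : plane * plane => F (shift2 p.2 p.1)).
Proof.
move=> mF; apply: measurableT_comp mF _.
have m1 : measurable_fun setT (fst \o (fst : plane * plane -> plane)).
  exact: measurableT_comp.
have m2 : measurable_fun setT (snd \o (fst : plane * plane -> plane)).
  exact: measurableT_comp.
have m3 : measurable_fun setT (fst \o (snd : plane * plane -> plane)).
  exact: measurableT_comp.
have m4 : measurable_fun setT (snd \o (snd : plane * plane -> plane)).
  exact: measurableT_comp.
by apply/measurable_fun_pairP; split; apply: measurable_funD.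
Qed.

Definition moll_kernel F rho (p : plane * plane) : \bar R :=
  (rho p.2 * `|F (shift2 p.2 p.1) - F p.1|)%:E.

Lemma meas_moll_kernel F rho : meas2 F -> meas2 rho -> measurable_fun setT (moll_kernel F rho).
Proof.
move=> mF mrho; apply/measurable_EFinP; apply: measurable_funM.
  by apply: measurableT_comp mrho _.
apply: measurableT_comp => //; apply: measurable_funB; first exact: meas2_pair_shift.
by apply: measurableT_comp mF _.
Qed.

Lemma meas_moll_modulus F rho : meas2 F -> meas2 rho -> (forall z, 0 <= rho z) ->
  (forall x, intg (fun z => rho z * `|F (shift2 z x) - F x|)) ->
  measurable_fun setT (fun x : plane => (I2 (fun z => rho z * `|F (shift2 z x) - F x|))%:E).
Proof.
move=> mF mrho rho0 ir; have mK := meas_moll_kernel mF mrho.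
have K0 p : (0 <= moll_kernel F rho p)%E by rewrite lee_fin mulr_ge0.
apply: (@eq_measurable_fun _ _ _ _ _ (fun x => \int[mu2]_z (rho z * `|F (shift2 z x) - F x|)%:E)%E).
  by move=> x _; rewrite I2_EFin.
exact: (@measurable_fun_fubini_tonelli_F _ _ _ _ _ mu2 _ mK K0).
Qed.

(** By Tonelli the integral is an average, over small translations, of distances
    in mean that are at most [e]. *)
Lemma moll_modulus F (r e : R) : intg F -> (forall x, ~ square r x -> F x = 0) -> 0 < e ->
  exists2 d : R, 0 < d & forall d' rho, d' <= d -> unit_mollifier d' rho ->
    (\int[mu2]_x (I2 (fun z => rho z * `|F (shift2 z x) - F x|))%:E <= e%:E)%E.
Proof.
move=> hF F0 e0; have [d d0 dP] := L1_shift_continuous hF F0 e0.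
exists d => // d' rho d'd [trho rho0 rhoS rho1].
have mF := intg_meas hF; have mrho := test_fun_meas trho.
have iz z : intg (fun x => `|F (shift2 z x) - F x|).
  by apply/intg_norm/intgB => //; exact: intg_shift.
have [M M0 MP] := test_fun_bounded trho.
have irho x : intg (fun z => rho z * `|F (shift2 z x) - F x|).
  have i1 : intg (fun z => F (shift2 z x) * rho z).
    apply: (@intg_ext _ (fun z => (F \o shift2 x) z * rho z)).
      by move=> z /=; rewrite shift2C.
    exact: intg_mulb (intg_shift x hF) mrho MP.
  have i2 := intg_norm (intgB i1 (intgZ (F x) (test_fun_intg trho))).
  apply: intg_ext i2 => z; rewrite -mulrBl normrM mulrC ger0_norm//.
pose K := moll_kernel F rho; have mK : measurable_fun setT K := meas_moll_kernel mF mrho.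
have K0 p : (0 <= K p)%E by rewrite lee_fin mulr_ge0.
have t1 := @fubini_tonelli1 _ _ _ _ _ mu2 mu2 K mK K0.
have t2 := @fubini_tonelli2 _ _ _ _ _ mu2 mu2 K mK K0.
have -> : (\int[mu2]_x (I2 (fun z => rho z * `|F (shift2 z x) - F x|))%:E =
    \int[mu2]_x fubini_F mu2 K x)%E.
  by apply: eq_integral => x _; rewrite -I2_EFin.
rewrite -t1 t2.
have -> : (\int[mu2]_z fubini_G mu2 K z = \int[mu2]_z (rho z * I2 (fun x => `|F (shift2 z x) - F x|))%:E)%E.
  apply: eq_integral => z _; rewrite -I2Z// -I2_EFin; last exact: intgZ.
  by [].
have le1 z : rho z * I2 (fun x => `|F (shift2 z x) - F x|) <= e * rho z.
  have [sz|/rhoS ->] := pselect (square d' z); last by rewrite mul0r mulr0.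
  by rewrite mulrC ler_wpM2r//; apply: dP; exact: square_le sz.
have -> : e%:E = (\int[mu2]_z (e * rho z)%:E)%E.
  by rewrite I2_EFin; [rewrite I2Z ?rho1 ?mulr1//; exact: test_fun_intg trho|exact/intgZ/test_fun_intg/trho].
apply: ge0_le_integral => //.
- by move=> z _; rewrite lee_fin mulr_ge0// I2_ge0.
- have := @measurable_fun_fubini_tonelli_G _ _ _ _ _ mu2 K mK K0.
  congr measurable_fun; apply/funext => z.
  by rewrite /fubini_G /K/= -I2Z// -I2_EFin//; exact: intgZ.
- by apply/measurable_EFinP; apply: measurable_funM.
- by move=> z _; rewrite lee_fin.
Qed.

Lemma corr_shiftE f rho x : meas2 f -> test_fun setT rho ->
  corr f rho x = I2 (fun z => f (shift2 z x) * rho z).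
Proof.
move=> mf trho.
rewrite /corr -(I2_shift x (f := fun y => f y * rho (shift2 (opp2 x) y))); last first.
  by apply: meas2M => //; exact: (meas2_shift _ (test_fun_meas trho)).
by apply: I2_ext => z /=; rewrite shift2K shift2C.
Qed.

Lemma intg_shift_moll f rho x : intg f -> test_fun setT rho ->
  intg (fun z => f (shift2 z x) * rho z).
Proof.
move=> hf trho; have [M M0 MP] := test_fun_bounded trho.
apply: (@intg_ext _ (fun z => (f \o shift2 x) z * rho z)).
  by move=> z /=; rewrite shift2C.
exact: intg_mulb (intg_shift x hf) (test_fun_meas trho) MP.
Qed.

Lemma corr_subE f d rho x : intg f -> unit_mollifier d rho ->
  corr f rho x - f x = I2 (fun z => (f (shift2 z x) - f x) * rho z).
Proof.
move=> hf [trho rho0 rhoS rho1].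
rewrite corr_shiftE//; last exact: intg_meas.
rewrite -[X in _ - X]mulr1 -rho1 -I2Z; last exact: test_fun_intg trho.
rewrite -I2B; [|exact: intg_shift_moll|exact/intgZ/test_fun_intg/trho].
by apply: I2_ext => z; rewrite mulrBl.
Qed.

Lemma corr_meas f rho : intg f -> test_fun setT rho -> meas2 (corr f rho).
Proof. by move=> hf trho; apply: meas2_continuous; exact: corr_continuous. Qed.

Lemma moll_L1 f (r e : R) : intg f -> (forall x, ~ square r x -> f x = 0) -> 0 < e ->
  exists2 d : R, 0 < d & forall d' rho, d' <= d -> unit_mollifier d' rho ->
    (\int[mu2]_x `|corr f rho x - f x|%:E <= e%:E)%E.
Proof.
move=> hf f0 e0; have [d d0 dP] := moll_modulus hf f0 e0.
exists d => // d' rho d'd um; apply: le_trans (dP _ _ d'd um).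
have [trho rho0 rhoS rho1] := um; have mf := intg_meas hf.
have i1 x : intg (fun z => (f (shift2 z x) - f x) * rho z).
  apply: intg_ext (intgB (intg_shift_moll x hf trho) (intgZ (f x) (test_fun_intg trho))).
  by move=> z; rewrite mulrBl.
have ie x z : `|(f (shift2 z x) - f x) * rho z| = rho z * `|f (shift2 z x) - f x|.
  by rewrite normrM mulrC ger0_norm.
apply: ge0_le_integral => //.
- by apply/measurable_EFinP; apply: meas2_norm; apply: meas2B => //; exact: corr_meas.
- apply: meas_moll_modulus => //; first exact: test_fun_meas trho.
  by move=> x; apply: intg_ext (intg_norm (i1 x)) => z; exact: ie.
- move=> x _; rewrite lee_fin (corr_subE x hf um) (le_trans (le_norm_I2 (i1 x)))//.
  by rewrite le_eqVlt; apply/orP; left; apply/eqP/I2_ext => z; exact: ie.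
Qed.

(** The variance of [h] with respect to the density [rho] is nonnegative. *)
Lemma I2_jensen rho h : (forall z, 0 <= rho z) -> intg rho -> I2 rho = 1 ->
  intg (fun z => h z * rho z) -> intg (fun z => h z ^+ 2 * rho z) ->
  (I2 (fun z => h z * rho z)) ^+ 2 <= I2 (fun z => h z ^+ 2 * rho z).
Proof.
move=> rho0 irho rho1 i1 i2; set m := I2 _.
have : 0 <= I2 (fun z => (h z ^+ 2 * rho z + (- 2 * m) * (h z * rho z)) + m ^+ 2 * rho z).
  apply: I2_ge0 => z; rewrite (_ : _ + _ = (h z - m) ^+ 2 * rho z); last by ring.
  by rewrite mulr_ge0 ?sqr_ge0.
rewrite I2D; [|by apply: intgD => //; exact: intgZ|exact: intgZ].
rewrite I2D//; last exact: intgZ.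
rewrite !I2Z// rho1 -/m; lra.
Qed.

(** The map from [a] to [a * `|a|] turns square-integrable functions into
    integrable ones, and this inequality bounds squared differences by differences
    of the images: convergence in mean implies convergence in quadratic mean. *)
Lemma sqr_sub_le (a b : R) : (a - b) ^+ 2 <= 2 * `|a * `|a| - b * `|b| |.
Proof.
wlog ab : a b / b <= a.
  by move=> H; have [/H//|/ltW/H] := leP b a; rewrite distrC -sqrrN opprB.
have [b0|b0] := leP 0 b.
  have a0 := le_trans b0 ab; rewrite (ger0_norm a0) (ger0_norm b0).
  rewrite ger0_norm; last by rewrite subr_ge0 ler_pM.
  nra.
have [a0|a0] := leP 0 a.
  rewrite (ger0_norm a0) (ltr0_norm b0) ger0_norm; last nra.
  by have := sqr_ge0 (a + b); lra.
rewrite (ltr0_norm a0) (ltr0_norm b0) ger0_norm; last nra.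
have : 0 <= (a - b) * (- a) by rewrite mulr_ge0 ?subr_ge0// oppr_ge0 ltW.
have := sqr_ge0 (a - b); lra.
Qed.

(** Jensen's inequality followed by [sqr_sub_le] bounds the squared error by
    the modulus of continuity in mean of [f * `|f|]. *)
Lemma moll_L2 f (r e : R) : meas2 f -> intg (fun x => f x ^+ 2) ->
  (forall x, ~ square r x -> f x = 0) -> 0 < e ->
  exists2 d : R, 0 < d & forall d' rho, d' <= d -> unit_mollifier d' rho ->
    (\int[mu2]_x ((corr f rho x - f x) ^+ 2)%:E <= e%:E)%E.
Proof.
move=> mf hf2 f0 e0.
have hf := intg_of_sqr mf hf2 f0.
(* By [sqr_sub_le], squared differences of [f] are controlled by differences of [F]. *)
pose F x := f x * `|f x|.
have hF : intg F.
  apply: intg_le hf2 _; first by apply: meas2M => //; exact: meas2_norm.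
  by move=> x; rewrite /F normrM normr_id -expr2 real_normK// num_real.
have F0 x : ~ square r x -> F x = 0 by move=> nx; rewrite /F f0// mul0r.
have e20 : 0 < e / 2 by rewrite divr_gt0.
have [d d0 dP] := moll_modulus hF F0 e20.
exists d => // d' rho d'd um; have {}dP := dP _ _ d'd um.
have [trho rho0 rhoS rho1] := um.
have [M M0 MP] := test_fun_bounded trho.
have i1 x : intg (fun z => (f (shift2 z x) - f x) * rho z).
  apply: intg_ext (intgB (intg_shift_moll x hf trho) (intgZ (f x) (test_fun_intg trho))).
  by move=> z; rewrite mulrBl.
have iF x : intg (fun z => rho z * `|F (shift2 z x) - F x|).
  have := intg_norm (intgB (intg_shift_moll x hF trho) (intgZ (F x) (test_fun_intg trho))).
  by apply: intg_ext => z; rewrite -mulrBl normrM mulrC ger0_norm.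
have i2 x : intg (fun z => (f (shift2 z x) - f x) ^+ 2 * rho z).
  apply: intg_le (intgZ 2 (iF x)) _.
    apply: meas2M; last exact: test_fun_meas trho.
    apply: meas2X; apply: meas2B; last exact: meas2_cst.
    have := meas2_shift x mf; congr meas2; apply/funext => z /=; by rewrite shift2C.
  move=> z; rewrite normrM (ger0_norm (rho0 z)) ger0_norm ?sqr_ge0//.
  by rewrite (mulrC (_ ^+ 2)) [leRHS]mulrCA ler_wpM2l// sqr_sub_le.
apply: (@le_trans _ _ (2%:E * \int[mu2]_x (I2 (fun z => rho z * `|F (shift2 z x) - F x|))%:E)%E); last first.
  apply: (@le_trans _ _ (2%:E * (e / 2)%:E)%E); first by rewrite lee_pmul2l.
  by rewrite -EFinM lee_fin; lra.
have mF := intg_meas hF.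
have mI := meas_moll_modulus mF (test_fun_meas trho) rho0 iF.
rewrite -ge0_integralZl//; last first.
  by move=> x _; rewrite lee_fin; apply: I2_ge0 => z; rewrite mulr_ge0.
apply: ge0_le_integral => //.
- by move=> x _; rewrite lee_fin sqr_ge0.
- by apply/measurable_EFinP; apply: meas2X; apply: meas2B => //; exact: corr_meas.
- exact: measurable_funeM.
- move=> x _; rewrite -EFinM lee_fin (corr_subE x hf um).
  apply: le_trans (I2_jensen rho0 (test_fun_intg trho) rho1 (i1 x) (i2 x)) _.
  rewrite -I2Z//; apply: le_I2 => //; first exact: intgZ.
  by move=> z; rewrite (mulrC (_ ^+ 2)) [leRHS]mulrCA ler_wpM2l// sqr_sub_le.
Qed.

End Mollification.

(** * Weak derivatives *)

Section WeakDerivatives.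
Context {R : realType}.
Local Notation plane := (measurableTypeR R * measurableTypeR R)%type.
Local Notation mu2 := (@lebesgue2 R).
Implicit Types (f g p phi psi : R * R -> R) (x : R * R) (Om : set (R * R)).

Definition zx Om f x : R := if x \in Om then f x else 0.

Lemma zx_in Om f x : Om x -> zx Om f x = f x.
Proof. by move=> Ox; rewrite /zx mem_set. Qed.

Lemma zx_out Om f x : ~ Om x -> zx Om f x = 0.
Proof. by move=> Ox; rewrite /zx memNset. Qed.

Lemma zx_patch Om f : f \_ Om = zx Om f.
Proof. by apply/funext => x; rewrite patchE. Qed.

Lemma meas2_zx Om f : measurable (Om : set plane) ->
  measurable_plane Om f <-> meas2 (zx Om f).
Proof. by move=> mO; rewrite /meas2 -zx_patch; exact: measurable_restrictT. Qed.

Lemma int_zx Om f : (\int[mu2]_(x in Om) (f x)%:E = \int[mu2]_x (zx Om f x)%:E)%E.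
Proof.
rewrite integral_mkcond; apply: eq_integral => x _; rewrite patchE /zx.
by case: ifP.
Qed.

Lemma intg_zx Om f : measurable (Om : set plane) ->
  mu2.-integrable Om (EFin \o f) <-> intg (zx Om f).
Proof.
move=> mO; rewrite /intg (_ : EFin \o zx Om f = (EFin \o f) \_ Om); last first.
  by apply/funext => x; rewrite patchE /zx /=; case: ifP.
exact: integrable_mkcond.
Qed.

Definition sqi f : Prop := meas2 f /\ intg (fun x => f x ^+ 2).

Lemma sqiD f g : sqi f -> sqi g -> sqi (fun x => f x + g x).
Proof.
move=> [mf hf] [mg hg]; split; first exact: meas2D.
apply: intg_le (intgD (intgZ 2 hf) (intgZ 2 hg)) _; first by apply: meas2X; exact: meas2D.
by move=> x; rewrite ger0_norm ?sqr_ge0//; have := sqr_ge0 (f x - g x); lra.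
Qed.

Lemma sqi_mulb f g (M : R) : sqi f -> meas2 g -> (forall x, `|g x| <= M) ->
  sqi (fun x => g x * f x).
Proof.
move=> [mf hf] mg gM; split; first exact: meas2M.
apply: intg_le (intgZ (M ^+ 2) hf) _; first by apply: meas2X; exact: meas2M.
move=> x; rewrite ger0_norm ?sqr_ge0// exprMn ler_wpM2r ?sqr_ge0//.
by rewrite -(real_normK (num_real (g x))) lerXn2r ?nnegrE// (le_trans _ (gM x)).
Qed.

Lemma sqiZ (k : R) f : sqi f -> sqi (fun x => k * f x).
Proof. by move=> hf; apply: (@sqi_mulb _ _ `|k|) => //; exact: meas2_cst. Qed.

Lemma sqi_ext f g : (forall x, f x = g x) -> sqi f -> sqi g.
Proof. by move=> /funext ->. Qed.

Lemma sqiB f g : sqi f -> sqi g -> sqi (fun x => f x - g x).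
Proof.
move=> hf hg; apply: sqi_ext (sqiD hf (sqiZ (- 1) hg)) => x.
by rewrite mulN1r.
Qed.

Lemma sqi_shift f c : sqi f -> sqi (f \o shift2 c).
Proof.
move=> [mf hf]; split; first exact: meas2_shift.
exact: (intg_shift c hf).
Qed.

Lemma sqi_intgM f g : sqi f -> sqi g -> intg (fun x => f x * g x).
Proof.
move=> [mf hf] [mg hg]; apply: intg_le (intgD hf hg) _; first exact: meas2M.
move=> x; rewrite normrM.
have := sqr_ge0 (`|f x| - `|g x|); rewrite sqrrB !real_normK ?num_real//.
by have := normr_ge0 (f x); have := normr_ge0 (g x) => a b; rewrite -mulr_natl; nra.
Qed.

Lemma test_fun_sqi Om phi : test_fun Om phi -> sqi phi.
Proof.
move=> tphi; split; first exact: test_fun_meas tphi.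
by have := intg_test (test_fun_intg tphi) tphi.
Qed.

Lemma sqi_test Om f phi : sqi f -> test_fun Om phi -> intg (fun x => f x * phi x).
Proof. by move=> hf /test_fun_sqi; exact: sqi_intgM. Qed.

Lemma intg_indic_le Om (r : R) : measurable (Om : set plane) -> Om `<=` square r ->
  intg (\1_Om : R * R -> R).
Proof.
move=> mO Or; apply: intg_le (intg_indic_square r) _; first exact: meas2_indic.
move=> x; rewrite !indicE normr_nat ler_nat.
by have [/set_mem/Or/mem_set ->|] := boolP (x \in Om).
Qed.

Lemma sqi_L1loc Om f : measurable (Om : set plane) -> sqi (zx Om f) -> L1loc Om f.
Proof.
move=> mO [mf hf]; split; first exact/meas2_zx.
move=> K cK KO; have mK := compact_measurable2 cK.
have [r r0 Kr] := compact_sub_square cK.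
apply/intg_zx => //; apply: intg_le (intgD hf (intg_indic_le mK Kr)) _.
  by apply/(meas2_zx f mK); apply: (measurable_funS mO KO); exact: ((meas2_zx f mO).2 mf).
move=> x; rewrite indicE /zx; have [/set_mem Kx|Kx] := boolP (x \in K).
  rewrite mem_set; last exact: KO.
  have := sqr_ge0 (`|f x| - 1); rewrite sqrrB mulr1 expr1n real_normK ?num_real//.
  by have := normr_ge0 (f x); rewrite (_ : true%:R = 1)//; lra.
by rewrite normr0 addr_ge0// sqr_ge0.
Qed.

Lemma L1loc_test Om f phi : measurable (Om : set plane) -> L1loc Om f -> test_fun Om phi ->
  intg (fun x => zx Om f x * phi x).
Proof.
move=> mO [mf hf] tphi; have [K [cK KO p0]] := test_fun_supp tphi.
have mK := compact_measurable2 cK.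
have /(intg_zx _ mK) hK := hf K cK KO.
have [M M0 MP] := test_fun_bounded tphi.
apply: intg_ext (intg_mulb hK (test_fun_meas tphi) MP) => x.
have [Kx|nK] := pselect (K x); last by rewrite p0 ?mulr0.
by rewrite zx_in// zx_in//; exact: KO.
Qed.

Lemma int_test Om f phi : measurable (Om : set plane) -> L1loc Om f -> test_fun Om phi ->
  (\int[mu2]_(x in Om) (f x * phi x)%:E = (I2 (fun x => zx Om f x * phi x))%:E)%E.
Proof.
move=> mO lf tphi; rewrite -(I2_EFin (L1loc_test mO lf tphi)) [LHS]int_zx.
apply: eq_integral => x _; rewrite /zx; case: ifP => //; by rewrite mul0r.
Qed.

(** Multiplication by a test function makes both sides integrable, so the
    identity between extended reals is one between real integrals over the plane. *)
Lemma is_weak_partialP Om j f g : measurable (Om : set plane) -> L1loc Om f -> L1loc Om g ->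
  is_weak_partial Om j f g <->
  forall phi, test_fun Om phi ->
    I2 (fun x => zx Om f x * partial j phi x) = - I2 (fun x => zx Om g x * phi x).
Proof.
move=> mO lf lg; split.
  move=> [_ _ h] phi tphi; have := h phi tphi.
  rewrite (int_test mO lf (test_fun_partial j tphi)) (int_test mO lg tphi).
  by case.
move=> h; split => // phi tphi.
rewrite (int_test mO lf (test_fun_partial j tphi)) (int_test mO lg tphi).
by rewrite h.
Qed.

Lemma closed_rect_compact (r : R) :
  compact (`[- (r / 2), r / 2] `*` `[- (r / 2), r / 2] : set (R * R)).
Proof. by apply: compact_setX; exact: segment_compact. Qed.

(** On a smaller square, translates of mollifiers are admissible test
    functions, so the mollified function vanishes; it also converges in mean. The
    smaller squares exhaust the square. *)
Lemma fundamental_lemma (r : R) g : L1loc (square r) g ->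
  (forall phi, test_fun (square r) phi -> I2 (fun x => zx (square r) g x * phi x) = 0) ->
  {ae mu2, forall x, square r x -> g x = 0}.
Proof.
move=> lg g0; have mg := lg.1.
suff ind n : {ae mu2, forall x, square (r - 3 / n.+1%:R) x -> g x = 0}.
  have := ae_foralln ind; apply: filterS => x H sx.
  have /squareP[x1 x2] := sx.
  pose m := Num.min (r / 2 - `|x.1|) (r / 2 - `|x.2|).
  have m0 : 0 < m by rewrite lt_min !subr_gt0 x1 x2.
  have [k _ /(_ k (leqnn k)) /= km] := near_infty_natSinv_lt (PosNum m0).
  rewrite /= in km.
  have [m1 m2] : m <= r / 2 - `|x.1| /\ m <= r / 2 - `|x.2| by rewrite /m !ge_min !lexx orbT.
  have k0 : (0 : R) < k.+1%:R^-1 by [].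
  pose n := (2 * k.+1).-1; have nk : 3 / n.+1%:R < 2 * k.+1%:R^-1 :> R.
    rewrite /n prednK ?muln_gt0// natrM invfM.
    by set q := k.+1%:R^-1 in k0 *; lra.
  apply: (H n); apply/squareP; move: nk km m1 m2.
  by set q := k.+1%:R^-1; set q' := 3 / _ => *; split; lra.
pose de : R := n.+1%:R^-1; have de0 : 0 < de by rewrite /de invr_gt0 ltr0n.
have -> : 3 / n.+1%:R = 3 * de by [].
pose f := zx (square (r - de)) g.
have sub1 : square (r - de) `<=` square r by apply: square_le; lra.
pose K : set (R * R) := `[- ((r - de) / 2), (r - de) / 2] `*` `[- ((r - de) / 2), (r - de) / 2].
have KO : K `<=` square r.
  move=> x [/= ]; rewrite !in_itv/= => /andP[a1 a2] /andP[a3 a4].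
  by apply/square_rect; split; lra.
have hf : intg f.
  apply/(intg_zx g (measurable_square (r - de))).
  apply: (@integrableS _ _ _ mu2 K).
  - by apply: compact_measurable2; exact: closed_rect_compact.
  - exact: measurable_square.
  - move=> x /square_rect[a1 a2 a3 a4].
    by split; rewrite /= in_itv/=; apply/andP; split; lra.
  - by apply: lg.2 => //; exact: closed_rect_compact.
have f0 x : ~ square (r - de) x -> f x = 0 by exact: zx_out.
(* The translate of [rho] by [x] is a test function on the square, on which [f]
   agrees with [g]. *)
have corr0 d rho x : d <= de -> unit_mollifier d rho -> square (r - 3 * de) x -> corr f rho x = 0.
  move=> dde [trho _ rhoS _] sx.
  have sx2 := sx; move: sx2 => /square_rect[x1 x2 x3 x4].
  have rout y : ~ square (r - 2 * de) y -> rho (shift2 (opp2 x) y) = 0.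
    move=> ny; apply: rhoS => /square_rect; rewrite /shift2/= => -[b1 b2 b3 b4]; apply: ny.
    by apply/square_rect; split; lra.
  have trx : test_fun (square r) (rho \o shift2 (opp2 x)).
    apply: (@test_fun_rect _ _ _ (r - 2 * de) r) => //; last lra.
    exact: smooth_shift2 (test_fun_smooth trho).
  rewrite -[RHS](g0 _ trx) /corr; apply: I2_ext => y /=.
  have [sy|/rout ->] := pselect (square (r - 2 * de) y); last by rewrite !mulr0.
  congr (_ * _); rewrite /f zx_in; last by apply: square_le sy; lra.
  by rewrite zx_in//; apply: square_le sy; lra.
pose S : set plane := square (r - 3 * de).
have mS : measurable S by exact: measurable_square.
have mf := intg_meas hf.
have le_e e : 0 < e -> (\int[mu2]_(x in S) `|(f x)%:E| <= e%:E)%E.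
  move=> e0; have [d d0 dP] := moll_L1 hf f0 e0.
  pose d' := Num.min d de; have d'0 : 0 < d' by rewrite lt_min d0.
  have [rho um] := mollifier_exists d'0.
  have d'd : d' <= d by rewrite /d' ge_min lexx.
  have d'de : d' <= de by rewrite /d' ge_min lexx orbT.
  apply: le_trans (dP _ _ d'd um); rewrite integral_mkcond; apply: ge0_le_integral => //.
  - by move=> x _; apply: erestrict_ge0.
  - apply/(measurable_restrictT _ mS)/measurable_funTS.
    by apply: measurableT_comp => //; apply/measurable_EFinP.
  - apply/measurable_EFinP; apply: meas2_norm; apply: meas2B => //; apply: corr_meas => //.
    by case: um.
  - move=> x _; rewrite patchE; case: ifPn => [/set_mem sx|_]; last by rewrite lee_fin.
    by rewrite (corr0 _ _ _ d'de um)// sub0r normrN.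
have int0 : (\int[mu2]_(x in S) `|(f x)%:E| = 0)%E.
  apply/eqP; rewrite eq_le integral_ge0// andbT.
  by apply/lee_addgt0Pr => e e0; rewrite add0e; exact: le_e.
have mfE : measurable_fun S (EFin \o f) by apply/measurable_EFinP/measurable_funTS.
have := (ae_eq_integral_abs mu2 mS mfE).1 int0.
apply: filterS => x H sx; have /= := H sx => -[].
by rewrite /f zx_in//; apply: square_le sx; lra.
Qed.

Lemma L1locB Om f g : measurable (Om : set plane) -> L1loc Om f -> L1loc Om g ->
  L1loc Om (fun x => f x - g x).
Proof.
move=> mO [mf hf] [mg hg]; split; first exact: measurable_funB.
move=> K cK KO; have mK := compact_measurable2 cK.
have := integrableB mK (hf K cK KO) (hg K cK KO).
by congr integrable.
Qed.

Lemma weak_partial_unique (r : R) j f g1 g2 :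
  is_weak_partial (square r) j f g1 -> is_weak_partial (square r) j f g2 ->
  {ae mu2, forall x, square r x -> g1 x = g2 x}.
Proof.
move=> h1 h2; have [lf l1 _] := h1; have [_ l2 _] := h2.
have mS := measurable_square r.
have H : forall phi, test_fun (square r) phi ->
    I2 (fun x => zx (square r) (fun x => g1 x - g2 x) x * phi x) = 0.
  move=> phi tphi.
  have e1 := (is_weak_partialP j mS lf l1).1 h1 phi tphi.
  have e2 := (is_weak_partialP j mS lf l2).1 h2 phi tphi.
  have i1 := L1loc_test mS l1 tphi; have i2 := L1loc_test mS l2 tphi.
  have : I2 (fun x => zx (square r) g1 x * phi x) - I2 (fun x => zx (square r) g2 x * phi x) = 0.
    by lra.
  rewrite -I2B// => <-; apply: I2_ext => x; rewrite /zx; case: ifP => _; ring.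
have := fundamental_lemma (L1locB mS l1 l2) H.
by apply: (@filterS _ (almost_everywhere mu2)) => x h /h /eqP; rewrite subr_eq0 => /eqP.
Qed.

Lemma weak_partialS Om Om' j f g : Om `<=` Om' ->
  measurable (Om : set plane) -> measurable (Om' : set plane) ->
  is_weak_partial Om' j f g -> is_weak_partial Om j f g.
Proof.
move=> OO mO mO' h; have [lf lg _] := h.
have LS u : L1loc Om' u -> L1loc Om u.
  move=> [mu hu]; split; first exact: measurable_funS mu.
  by move=> K cK KO; apply: hu => //; exact: subset_trans OO.
apply/is_weak_partialP => //; [exact: LS|exact: LS|move=> phi tphi].
have tphi' := test_funS OO tphi.
have E u psi : test_fun Om psi -> I2 (fun x => zx Om u x * psi x) = I2 (fun x => zx Om' u x * psi x).
  move=> tpsi; apply: I2_ext => x; have [Ox|nO] := pselect (Om x).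
    by rewrite !zx_in//; exact: OO.
  by rewrite (test_fun_out tpsi nO) !mulr0.
rewrite (E _ _ (test_fun_partial j tphi)) (E _ _ tphi).
exact: (is_weak_partialP j mO' lf lg).1.
Qed.

End WeakDerivatives.

(** * Square-integrable functions with weak derivatives, and magnetic translations *)

Section MagneticClass.
Context {R : realType}.
Local Notation plane := (measurableTypeR R * measurableTypeR R)%type.
Implicit Types (f g m phi psi : R * R -> R) (x c : R * R) (Om S : set (R * R)).
Implicit Types (u : bool -> R * R -> R) (d : bool -> bool -> R * R -> R).

Definition wd Om j f g : Prop := forall phi, test_fun Om phi ->
  I2 (fun x => f x * partial j phi x) = - I2 (fun x => g x * phi x).

Lemma wdD Om j f g f' g' : sqi f -> sqi g -> sqi f' -> sqi g' ->
  wd Om j f g -> wd Om j f' g' -> wd Om j (fun x => f x + f' x) (fun x => g x + g' x).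
Proof.
move=> hf hg hf' hg' w w' phi tphi; have tdphi := test_fun_partial j tphi.
transitivity (I2 (fun x => f x * partial j phi x + f' x * partial j phi x)).
  by apply: I2_ext => x; rewrite mulrDl.
rewrite I2D; [|exact: sqi_test tdphi|exact: sqi_test tdphi].
rewrite w// w'// -opprD -I2D; [|exact: sqi_test tphi|exact: sqi_test tphi].
by congr (- _); apply: I2_ext => x; rewrite mulrDl.
Qed.

(** The Leibniz rule, by testing against [m * psi]. *)
Lemma wd_mul Om Om' j m f g (M M' : R) : sqi f -> sqi g -> smooth m ->
  (forall x, `|m x| <= M) -> (forall x, `|partial j m x| <= M') ->
  (forall psi, test_fun Om' psi -> test_fun Om (fun x => m x * psi x)) ->
  wd Om j f g -> wd Om' j (fun x => m x * f x) (fun x => m x * g x + partial j m x * f x).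
Proof.
move=> hf hg sm mM dmM mOm w psi tpsi; have tm := mOm _ tpsi.
have tdpsi := test_fun_partial j tpsi; have spsi := test_fun_smooth tpsi.
have mm := meas2_continuous (smooth_continuous sm).
have mdm := meas2_continuous (smooth_continuous (smooth_partial j sm)).
have i1 : intg (fun x => f x * partial j (fun x => m x * psi x) x).
  exact: sqi_test hf (test_fun_partial j tm).
have i2 : intg (fun x => (partial j m x * f x) * psi x).
  exact: sqi_test (sqi_mulb hf mdm dmM) tpsi.
have i3 : intg (fun x => (m x * g x) * psi x).
  exact: sqi_test (sqi_mulb hg mm mM) tpsi.
transitivity (I2 (fun x => f x * partial j (fun x => m x * psi x) x - (partial j m x * f x) * psi x)).
  by apply: I2_ext => x; rewrite partialM//; ring.
rewrite I2B// w// -opprD; congr (- _).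
rewrite (I2_ext (g := fun x => (m x * g x) * psi x)); last by move=> x; ring.
by rewrite -I2D//; apply: I2_ext => x; ring.
Qed.

Lemma wd_shift j f g c : meas2 f -> meas2 g -> wd setT j f g ->
  wd setT j (f \o shift2 c) (g \o shift2 c).
Proof.
move=> mf mg w psi tpsi; have tdpsi := test_fun_partial j tpsi.
have tps := test_fun_shift (opp2 c) tpsi.
transitivity (I2 (fun x => f x * partial j (psi \o shift2 (opp2 c)) x)).
  rewrite -(I2_shift c (f := fun x => f x * partial j (psi \o shift2 (opp2 c)) x)); last first.
    by apply: meas2M => //; exact: test_fun_meas (test_fun_partial j tps).
  apply: I2_ext => x /=; rewrite partial_shift2; last exact: test_fun_smooth tpsi.
  by rewrite shift2K.
rewrite w// -(I2_shift c (f := fun x => g x * _ x)); last first.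
  by apply: meas2M => //; exact: test_fun_meas tps.
by congr (- _); apply: I2_ext => x /=; rewrite shift2K.
Qed.

(** Pairs of real functions (real and imaginary parts, indexed by [false] and
    [true]) vanishing off [S], with their weak derivatives tested on [Om]. *)
Definition W Om S u d : Prop :=
  [/\ forall i, sqi (u i), forall i j, sqi (d i j),
      forall i x, ~ S x -> u i x = 0, forall i j x, ~ S x -> d i j x = 0 &
      forall i j, wd Om j (u i) (d i j)].

Definition mgr u d j x : R := d false j x + A0 j x * u true x.
Definition mgi u d j x : R := d true j x - A0 j x * u false x.
(** The squared modulus of the magnetic gradient, [mgr] and [mgi] being the
    real and imaginary parts of its components. *)
Definition gsq u d x : R :=
  mgr u d false x ^+ 2 + mgi u d false x ^+ 2 + (mgr u d true x ^+ 2 + mgi u d true x ^+ 2).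
Definition dens u x : R := u false x ^+ 2 + u true x ^+ 2.
Definition elin b u d x : R := b * gsq u d x - dens u x.
Definition eblkd b u d x : R := elin b u d x + 2^-1 * dens u x ^+ 2.

Lemma WS Om Om' S S' u d : Om' `<=` Om -> S `<=` S' -> W Om S u d -> W Om' S' u d.
Proof.
move=> OO SS [h1 h2 h3 h4 h5]; split => //.
- by move=> i x nx; apply: h3 => /SS.
- by move=> i j x nx; apply: h4 => /SS.
- by move=> i j phi tphi; apply: h5; exact: test_funS tphi.
Qed.

Lemma W0 Om S : W Om S (fun _ _ => 0) (fun _ _ _ => 0).
Proof.
have s0 : sqi (fun _ : R * R => 0 : R).
  by split; [exact: meas2_cst|apply: intg_ext intg0 => x; rewrite expr0n].
have z f : I2 (fun x => 0 * f x) = 0.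
  by rewrite -[RHS]I2_0; apply: I2_ext => x; rewrite mul0r.
by split => // i j phi _; rewrite !z oppr0.
Qed.

Lemma WD Om S u d u' d' : W Om S u d -> W Om S u' d' ->
  W Om S (fun i x => u i x + u' i x) (fun i j x => d i j x + d' i j x).
Proof.
move=> [a1 a2 a3 a4 a5] [b1 b2 b3 b4 b5]; split.
- by move=> i; exact: sqiD.
- by move=> i j; exact: sqiD.
- by move=> i x nx; rewrite a3// b3// addr0.
- by move=> i j x nx; rewrite a4// b4// addr0.
- by move=> i j; exact: wdD.
Qed.

Lemma WZ Om S (k : R) u d : W Om S u d ->
  W Om S (fun i x => k * u i x) (fun i j x => k * d i j x).
Proof.
move=> [a1 a2 a3 a4 a5]; split.
- by move=> i; exact: sqiZ.
- by move=> i j; exact: sqiZ.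
- by move=> i x nx; rewrite a3// mulr0.
- by move=> i j x nx; rewrite a4// mulr0.
move=> i j phi tphi; have tdphi := test_fun_partial j tphi.
rewrite (I2_ext (g := fun x => k * (u i x * partial j phi x))); last by move=> x; ring.
rewrite I2Z; last exact: sqi_test tdphi.
rewrite a5// mulrN -I2Z; last exact: sqi_test tphi.
by congr (- _); apply: I2_ext => x; ring.
Qed.

Lemma W_sum (I : eqType) (s : seq I) Om S (u : I -> bool -> R * R -> R) (d : I -> bool -> bool -> R * R -> R) :
  (forall k, k \in s -> W Om S (u k) (d k)) ->
  W Om S (fun i x => \sum_(k <- s) u k i x) (fun i j x => \sum_(k <- s) d k i j x).
Proof.
elim: s => [|k s IH] H.
  have := W0 Om S; congr W; apply/funext => i.
    by apply/funext => x; rewrite big_nil.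
  by apply/funext => j; apply/funext => x; rewrite big_nil.
have {}IH : W Om S (fun i x => \sum_(k <- s) u k i x) (fun i j x => \sum_(k <- s) d k i j x).
  by apply: IH => k' k's; apply: H; rewrite in_cons k's orbT.
have := WD (H k (mem_head _ _)) IH.
congr W; apply/funext => i.
  by apply/funext => x; rewrite big_cons.
by apply/funext => j; apply/funext => x; rewrite big_cons.
Qed.

(** The vector potential is bounded on bounded sets. *)
Lemma A0_sqi (N : R) S f j : S `<=` square N -> sqi f -> (forall x, ~ S x -> f x = 0) ->
  sqi (fun x => A0 j x * f x).
Proof.
move=> SN hf f0.
have mA : meas2 (A0 j : R * R -> R).
  apply: meas2_continuous => x; rewrite /A0; case: j.
    by apply: cvgMl; exact: cvg_fst.
  by apply: cvgMl; apply: cvgN; exact: cvg_snd.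
have mI : meas2 (\1_(square N) : R * R -> R) by apply: meas2_indic; exact: measurable_square.
have : sqi (fun x => (A0 j x * \1_(square N) x) * f x).
  apply: (@sqi_mulb _ _ _ `|N|) => //; first exact: meas2M.
  move=> x; rewrite indicE; have [/set_mem/squareP[x1 x2]|_] := boolP (x \in _); last first.
    by rewrite mulr0 normr0.
  rewrite mulr1 /A0; case: (j); rewrite normrM ?normrN (@ger0_norm _ 2^-1)//.
    by have := ler_norm N; have := normr_ge0 x.1; lra.
  by have := ler_norm N; have := normr_ge0 x.2; lra.
apply: sqi_ext => x; have [Sx|/f0 ->] := pselect (S x); last by rewrite !mulr0.
by rewrite indicE mem_set ?mulr1//; exact: SN.
Qed.

Lemma W_sqi_mg Om S u d (N : R) j : S `<=` square N -> W Om S u d ->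
  sqi (mgr u d j) /\ sqi (mgi u d j).
Proof.
move=> SN [a1 a2 a3 a4 _]; split.
  by apply: sqiD => //; apply: A0_sqi SN (a1 _) _ => x; exact: a3.
by apply: sqiB => //; apply: A0_sqi SN (a1 _) _ => x; exact: a3.
Qed.

Lemma W_intg_gsq Om S u d (N : R) : S `<=` square N -> W Om S u d -> intg (gsq u d).
Proof.
move=> SN w; have [[_ r0] [_ i0]] := W_sqi_mg false SN w.
have [[_ r1] [_ i1]] := W_sqi_mg true SN w.
by apply: intgD; exact: intgD.
Qed.

Lemma W_intg_dens Om S u d : W Om S u d -> intg (dens u).
Proof. by move=> [a1 _ _ _ _]; apply: intgD; [exact: (a1 false).2|exact: (a1 true).2]. Qed.

Lemma W_intg_elin Om S u d (N b : R) : S `<=` square N -> W Om S u d -> intg (elin b u d).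
Proof.
move=> SN w; apply: intgB; last exact: W_intg_dens w.
exact/intgZ/(W_intg_gsq SN w).
Qed.

Lemma dens_ge0 u x : 0 <= dens u x.
Proof. by rewrite addr_ge0 ?sqr_ge0. Qed.

Lemma gsq_ge0 u d x : 0 <= gsq u d x.
Proof. by rewrite !addr_ge0 ?sqr_ge0. Qed.

(** Completion of the square in the density of [u]: [- X + X ^+ 2 / 2] is at least
    [- 1 / 2]. *)
Lemma eblkd_lb b u d x : 0 <= b -> - 2^-1 <= eblkd b u d x.
Proof.
move=> b0; rewrite /eblkd /elin; have := mulr_ge0 b0 (gsq_ge0 u d x).
by have := sqr_ge0 (dens u x - 1); lra.
Qed.

(** Magnetic translation by [c]: translation followed by the phase [th] whose
    gradient compensates the change of the vector potential. *)
Definition th c (ka : R) x : R := - c.2 / 2 * x.1 + c.1 / 2 * x.2 + ka.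

Definition mtu c ka u (i : bool) x : R :=
  let y := shift2 (opp2 c) x in
  if i then sin (th c ka x) * u false y + cos (th c ka x) * u true y
  else cos (th c ka x) * u false y - sin (th c ka x) * u true y.

Definition mtd c ka u d (i j : bool) x : R :=
  let y := shift2 (opp2 c) x in
  if i then sin (th c ka x) * d false j y + cos (th c ka x) * d true j y + A0 j c * mtu c ka u false x
  else cos (th c ka x) * d false j y - sin (th c ka x) * d true j y - A0 j c * mtu c ka u true x.

Lemma smooth_trig_th c ka (p q : R) : smooth (fun x => p * cos (th c ka x) + q * sin (th c ka x)).
Proof. exact: (smooth_lin_trig p q (- c.2 / 2) (c.1 / 2) ka). Qed.

Lemma pd_trig_th c ka (p q : R) j x :
  pd j (fun x => p * cos (th c ka x) + q * sin (th c ka x)) x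
    (A0 j c * (q * cos (th c ka x) - p * sin (th c ka x))).
Proof.
pose l := fun t : R => A0 j c * t + ((if j then - c.2 / 2 * x.1 else c.1 / 2 * x.2) + ka).
rewrite /pd.
have -> : slice j (fun x => p * cos (th c ka x) + q * sin (th c ka x)) x =
    (fun t => p * (cos \o l) t + q * (sin \o l) t).
  by apply/funext => t; rewrite /slice /l /th /A0; case: (j) => /=;
    congr (_ * cos _ + _ * sin _); ring.
have lx : l (coord j x) = th c ka x by rewrite /l /th /A0; case: (j) => /=; ring.
have dl : is_derive (coord j x) 1 l (A0 j c).
  rewrite /l; apply: is_derive_eq.
  by rewrite /GRing.scale /=; ring.
have dcl := is_derive1_comp (is_derive_cos (l (coord j x))) dl.
have dsl := is_derive1_comp (is_derive_sin (l (coord j x))) dl.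
apply: is_derive_eq.
by rewrite /GRing.scale/= lx; ring.
Qed.

Lemma trig_bound c ka (p q : R) x : `|p * cos (th c ka x) + q * sin (th c ka x)| <= `|p| + `|q|.
Proof.
apply: le_trans (ler_normD _ _) _; rewrite !normrM lerD//.
  by rewrite ler_piMr// ler_norml cos_geN1 cos_le1.
by rewrite ler_piMr// ler_norml sin_geN1 sin_le1.
Qed.

Lemma wd_trig c ka (p q : R) j f g : sqi f -> sqi g -> wd setT j f g ->
  let m := fun x => p * cos (th c ka x) + q * sin (th c ka x) in
  let m' := fun x => A0 j c * (q * cos (th c ka x) - p * sin (th c ka x)) in
  [/\ sqi (fun x => m x * f x), sqi (fun x => m x * g x + m' x * f x) &
      wd setT j (fun x => m x * f x) (fun x => m x * g x + m' x * f x)].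
Proof.
move=> hf hg w m m'.
have sm : smooth m by exact: smooth_trig_th.
have mm := meas2_continuous (smooth_continuous sm).
have em' x : partial j m x = m' x by exact/pd_partial/pd_trig_th.
have bm' x : `|m' x| <= `|A0 j c| * (`|q| + `|p|).
  rewrite /m' normrM ler_wpM2l//.
  by have := trig_bound c ka q (- p) x; rewrite mulNr normrN.
have mm' : meas2 m'.
  have := meas2_continuous (smooth_continuous (smooth_partial j sm)).
  by congr meas2; apply/funext.
split.
- by apply: sqi_mulb hf mm _ => x; exact: trig_bound.
- apply: sqiD; first by apply: sqi_mulb hg mm _ => x; exact: trig_bound.
  exact: sqi_mulb hf mm' bm'.
- have := @wd_mul setT setT j m f g (`|p| + `|q|) (`|A0 j c| * (`|q| + `|p|)) hf hg sm.
  have -> : partial j m = m' by apply/funext.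
  apply; [by move=> x; exact: trig_bound|exact: bm'| |exact: w].
  by move=> psi tpsi; exact: test_funMl tpsi sm.
Qed.

(** The phase has gradient [A0 c], which accounts for the extra terms in the
    derivatives. *)
Lemma W_mt S c ka u d : W setT S u d ->
  W setT [set x | S (shift2 (opp2 c) x)] (mtu c ka u) (mtd c ka u d).
Proof.
move=> [a1 a2 a3 a4 a5].
have s1 i := sqi_shift (opp2 c) (a1 i); have s2 i j := sqi_shift (opp2 c) (a2 i j).
have s5 i j := wd_shift (opp2 c) (a1 i).1 (a2 i j).1 (a5 i j).
have T p q i j := wd_trig c ka p q (s1 i) (s2 i j) (s5 i j).
have H i j : [/\ sqi (mtu c ka u i), sqi (mtd c ka u d i j) & wd setT j (mtu c ka u i) (mtd c ka u d i j)].
  case: i.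
    have [b1 b2 b3] := T 0 1 false j; have [c1 c2 c3] := T 1 0 true j.
    have e1 : mtu c ka u true = fun x => (0 * cos (th c ka x) + 1 * sin (th c ka x)) * (u false \o shift2 (opp2 c)) x
        + (1 * cos (th c ka x) + 0 * sin (th c ka x)) * (u true \o shift2 (opp2 c)) x.
      by apply/funext => x; rewrite /mtu /=; ring.
    have e2 : mtd c ka u d true j = fun x => ((0 * cos (th c ka x) + 1 * sin (th c ka x)) * (d false j \o shift2 (opp2 c)) x
        + A0 j c * (1 * cos (th c ka x) - 0 * sin (th c ka x)) * (u false \o shift2 (opp2 c)) x) +
        ((1 * cos (th c ka x) + 0 * sin (th c ka x)) * (d true j \o shift2 (opp2 c)) x
        + A0 j c * (0 * cos (th c ka x) - 1 * sin (th c ka x)) * (u true \o shift2 (opp2 c)) x).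
      by apply/funext => x; rewrite /mtd /mtu /=; ring.
    by rewrite e1 e2; split; [exact: sqiD|exact: sqiD|exact: wdD].
  have [b1 b2 b3] := T 1 0 false j; have [c1 c2 c3] := T 0 (- 1) true j.
  have e1 : mtu c ka u false = fun x => (1 * cos (th c ka x) + 0 * sin (th c ka x)) * (u false \o shift2 (opp2 c)) x
      + (0 * cos (th c ka x) + - 1 * sin (th c ka x)) * (u true \o shift2 (opp2 c)) x.
    by apply/funext => x; rewrite /mtu /=; ring.
  have e2 : mtd c ka u d false j = fun x => ((1 * cos (th c ka x) + 0 * sin (th c ka x)) * (d false j \o shift2 (opp2 c)) x
      + A0 j c * (0 * cos (th c ka x) - 1 * sin (th c ka x)) * (u false \o shift2 (opp2 c)) x) +
      ((0 * cos (th c ka x) + - 1 * sin (th c ka x)) * (d true j \o shift2 (opp2 c)) x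
      + A0 j c * (- 1 * cos (th c ka x) - 0 * sin (th c ka x)) * (u true \o shift2 (opp2 c)) x).
    by apply/funext => x; rewrite /mtd /mtu /=; ring.
  by rewrite e1 e2; split; [exact: sqiD|exact: sqiD|exact: wdD].
split.
- by move=> i; case: (H i false).
- by move=> i j; case: (H i j).
- by move=> i x /= nx; rewrite /mtu; case: i; rewrite !a3// !mulr0 ?addr0 ?subr0.
- move=> i j x /= nx; rewrite /mtd /mtu; case: i; by rewrite !a3// !a4// !mulr0 ?addr0 ?subr0 ?mulr0 ?addr0 ?subr0.
- by move=> i j; case: (H i j).
Qed.

Lemma dens_mt c ka u x : dens (mtu c ka u) x = dens u (shift2 (opp2 c) x).
Proof.
rewrite /dens /mtu; set y := shift2 _ _; have := cos2Dsin2 (th c ka x).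
set C := cos _; set Sn := sin _ => CS.
rewrite -[RHS]mul1r -CS; ring.
Qed.

(** The potential at [x] is the one at [x - c] plus [A0 c], and the latter cancels
    the derivative of the phase; the remaining rotation preserves moduli. *)
Lemma gsq_mt c ka u d x : gsq (mtu c ka u) (mtd c ka u d) x = gsq u d (shift2 (opp2 c) x).
Proof.
have A j : A0 j x = A0 j (shift2 (opp2 c) x) + A0 j c.
  by rewrite /A0 /shift2 /opp2; case: j => /=; ring.
rewrite /gsq /mgr /mgi !A /mtd /mtu; set y := shift2 _ _; have := cos2Dsin2 (th c ka x).
set C := cos _; set Sn := sin _ => CS.
rewrite -[RHS]mul1r -CS; ring.
Qed.

Lemma elin_mt b c ka u d x : elin b (mtu c ka u) (mtd c ka u d) x = elin b u d (shift2 (opp2 c) x).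
Proof. by rewrite /elin gsq_mt dens_mt. Qed.

Lemma eblkd_mt b c ka u d x : eblkd b (mtu c ka u) (mtd c ka u d) x = eblkd b u d (shift2 (opp2 c) x).
Proof. by rewrite /eblkd elin_mt dens_mt. Qed.

(** The cutoff has compact support in [Om], so its product with a test function of
    the plane is a test function on [Om]. *)
Lemma W_cut Om S S' u d m : W Om S u d -> test_fun Om m ->
  (forall x, ~ S' x -> m x = 0) -> (forall j x, ~ S' x -> partial j m x = 0) ->
  W setT S' (fun i x => m x * u i x) (fun i j x => m x * d i j x + partial j m x * u i x).
Proof.
move=> [a1 a2 a3 a4 a5] tm m0 dm0.
have [M _ MP] := test_fun_bounded tm; have mm := test_fun_meas tm.
have dM j : exists M', forall x, `|partial j m x| <= M'.
  by have [M' _ MP'] := test_fun_bounded (test_fun_partial j tm); exists M'.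
split.
- by move=> i; exact: sqi_mulb (a1 i) mm MP.
- move=> i j; have [M' MP'] := dM j.
  apply: sqiD; first exact: sqi_mulb (a2 i j) mm MP.
  exact: sqi_mulb (a1 i) (test_fun_meas (test_fun_partial j tm)) MP'.
- by move=> i x nx; rewrite m0// mul0r.
- by move=> i j x nx; rewrite m0// dm0// !mul0r addr0.
- move=> i j; have [M' MP'] := dM j.
  apply: (wd_mul (a1 i) (a2 i j) (test_fun_smooth tm) MP MP') => // psi tpsi.
  have := test_funMl tm (test_fun_smooth tpsi).
  by congr test_fun; apply/funext => x; rewrite mulrC.
Qed.

End MagneticClass.

(** * Sobolev functions on a square *)

Section SobolevInterface.
Context {R : realType}.
Local Notation plane := (measurableTypeR R * measurableTypeR R)%type.
Local Notation mu2 := (@lebesgue2 R).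
Implicit Types (f g phi psi : R * R -> R) (x c : R * R) (Om S : set (R * R)).
Implicit Types (u : bool -> R * R -> R) (d : bool -> bool -> R * R -> R) (U V : R * R -> R[i]).

Definition uof U (i : bool) : R * R -> R := if i then Im_fun U else Re_fun U.
Definition dof (r : R) U (i j : bool) : R * R -> R := weak_partial (square r) j (uof U i).
Definition zu (r : R) U i : R * R -> R := zx (square r) (uof U i).
Definition zd (r : R) U i j : R * R -> R := zx (square r) (dof r U i j).
Definition cof u x : R[i] := Complex (u false x) (u true x).

Lemma normC_sq (z : R[i]) : normC z ^+ 2 = complex.Re z ^+ 2 + complex.Im z ^+ 2.
Proof. by case: z => a b; rewrite /normC /= sqr_sqrtr// addr_ge0 ?sqr_ge0. Qed.

Lemma normC_dens U x : normC (U x) ^+ 2 = dens (uof U) x.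
Proof. by rewrite normC_sq. Qed.

Lemma normC4 U x : normC (U x) ^+ 4 = dens (uof U) x ^+ 2.
Proof. by rewrite -normC_dens -exprM. Qed.

Lemma mag_partialE (r : R) U j x : mag_partial (square r) j U x =
    Complex (mgr (uof U) (dof r U) j x) (mgi (uof U) (dof r U) j x).
Proof.
rewrite /mag_partial /weak_partialC.
have e1 : weak_partial (square r) j (Re_fun U) x = dof r U false j x by [].
have e2 : weak_partial (square r) j (Im_fun U) x = dof r U true j x by [].
rewrite e1 e2 /mgr /mgi.
have -> : U x = Complex (uof U false x) (uof U true x).
  by rewrite /uof /Re_fun /Im_fun; case: (U x).
by simpc.
Qed.

Lemma mag_grad_sqE (r : R) U x : mag_grad_sq (square r) U x = gsq (uof U) (dof r U) x.
Proof. by rewrite /mag_grad_sq !mag_partialE !normC_sq. Qed.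

Lemma zx_dens Om u x : dens (fun i => zx Om (u i)) x = zx Om (dens u) x.
Proof. by rewrite /dens /zx; case: ifP => // _; rewrite expr0n addr0. Qed.

Lemma zx_gsq Om u d x : gsq (fun i => zx Om (u i)) (fun i j => zx Om (d i j)) x = zx Om (gsq u d) x.
Proof.
rewrite /gsq /mgr /mgi /zx; case: ifP => // _.
by rewrite !mulr0 subr0 !addr0 expr0n !addr0.
Qed.

Lemma zx_elin Om b u d x : elin b (fun i => zx Om (u i)) (fun i j => zx Om (d i j)) x = zx Om (elin b u d) x.
Proof.
rewrite /elin zx_dens zx_gsq /zx; case: ifP => // _; ring.
Qed.

Lemma zx_eblkd Om b u d x : eblkd b (fun i => zx Om (u i)) (fun i j => zx Om (d i j)) x = zx Om (eblkd b u d) x.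
Proof.
rewrite /eblkd zx_dens zx_elin /zx; case: ifP => // _; ring.
Qed.

Lemma Elin_zE b r U : (Elin_fun U b r = \int[mu2]_x (elin b (zu r U) (zd r U) x)%:E)%E.
Proof.
rewrite /Elin_fun [LHS]int_zx; apply: eq_integral => x _; rewrite zx_elin /zx.
by case: ifP => // _; rewrite mag_grad_sqE normC_dens.
Qed.

Lemma Eblk_zE b r U : (Eblk_fun U b r = \int[mu2]_x (eblkd b (zu r U) (zd r U) x)%:E)%E.
Proof.
rewrite /Eblk_fun [LHS]int_zx; apply: eq_integral => x _; rewrite zx_eblkd /zx.
by case: ifP => // _; rewrite mag_grad_sqE normC_dens normC4.
Qed.

Lemma L4_zE r U : (\int[mu2]_(x in square r) (normC (U x) ^+ 4)%:E =
  \int[mu2]_x (dens (zu r U) x ^+ 2)%:E)%E.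
Proof.
rewrite [LHS]int_zx; apply: eq_integral => x _; rewrite zx_dens /zx.
by case: ifP => // _; rewrite ?normC4// expr0n.
Qed.

Lemma L2_sqi r V : L2 (square r) V <-> forall i, sqi (zu r V i).
Proof.
have mS := measurable_square r.
have E : (\int[mu2]_(x in square r) (normC (V x) ^+ 2)%:E = \int[mu2]_x (dens (zu r V) x)%:E)%E.
  by rewrite [LHS]int_zx; apply: eq_integral => x _; rewrite zx_dens /zx normC_dens.
split.
  move=> [[m1 m2] fin] i.
  have mz i' : meas2 (zu r V i') by apply/(meas2_zx _ mS); case: i'.
  have md : meas2 (dens (zu r V)) by apply: meas2D; exact: meas2X.
  have hd : intg (dens (zu r V)).
    apply/integrableP; split; first exact/measurable_EFinP.
    under eq_integral do rewrite /= ger0_norm ?dens_ge0//.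
    by rewrite -E.
  split => //; apply: intg_le hd _; first exact: meas2X.
  by move=> x; rewrite ger0_norm ?sqr_ge0// /dens; case: i; rewrite ?lerDl ?lerDr sqr_ge0.
move=> h; split.
  by split; [exact: ((meas2_zx _ mS).2 (h false).1)|exact: ((meas2_zx _ mS).2 (h true).1)].
rewrite E I2_EFin ?ltry//; apply: intgD; [exact: (h false).2|exact: (h true).2].
Qed.

Lemma weak_partial_spec Om j f g : is_weak_partial Om j f g ->
  is_weak_partial Om j f (weak_partial Om j f).
Proof. by move=> h; rewrite /weak_partial; apply: xgetPex; exists g. Qed.

Lemma H1_weak r U i j : H1 (square r) U -> is_weak_partial (square r) j (uof U i) (dof r U i j).
Proof.
by move=> [_ /(_ j)[[g1 h1] [g2 h2]] _]; case: i; [exact: weak_partial_spec h2|exact: weak_partial_spec h1].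
Qed.

Lemma H1_W r U : H1 (square r) U -> W (square r) (square r) (zu r U) (zd r U).
Proof.
move=> hU; have hw i j := H1_weak i j hU; have [l2 _ l2d] := hU.
have mS := measurable_square r.
split.
- exact/L2_sqi.
- move=> i j; have /L2_sqi/(_ i) := l2d j; by case: i.
- by move=> i x; exact: zx_out.
- by move=> i j x; exact: zx_out.
- move=> i j; have h := hw i j; have [lf lg _] := h.
  exact: (is_weak_partialP j mS lf lg).1.
Qed.

Section FromTuple.
Context (r : R) (u : bool -> R * R -> R) (d : bool -> bool -> R * R -> R) (U : R * R -> R[i]).
Context (w : W (square r) (square r) u d) (Uu : forall x i, square r x -> uof U i x = u i x).

Lemma zu_eq : zu r U = u.
Proof.
have [_ _ u0 _ _] := w; apply/funext => i; apply/funext => x.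
have [sx|nx] := pselect (square r x); first by rewrite /zu zx_in// Uu.
by rewrite /zu zx_out// u0.
Qed.

Lemma tuple_weak i j : is_weak_partial (square r) j (uof U i) (d i j).
Proof.
have [a1 a2 a3 a4 a5] := w; have mS := measurable_square r.
have ed : zx (square r) (d i j) = d i j.
  apply/funext => x; have [sx|nx] := pselect (square r x); first by rewrite zx_in.
  by rewrite zx_out// a4.
have eu : zx (square r) (uof U i) = u i by rewrite -zu_eq.
apply/is_weak_partialP => //.
- by apply: sqi_L1loc => //; rewrite eu.
- by apply: sqi_L1loc => //; rewrite ed.
- by rewrite ed eu; exact: a5.
Qed.

(** The chosen weak derivative agrees with the explicit one by uniqueness. *)
Lemma zd_ae i j : {ae mu2, forall x, zd r U i j x = d i j x}.
Proof.
have [_ _ _ d0 _] := w.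
have := weak_partial_unique (weak_partial_spec (tuple_weak i j)) (tuple_weak i j).
apply: (@filterS _ (almost_everywhere mu2)) => x H; have [sx|nx] := pselect (square r x).
  by rewrite /zd zx_in//; exact: H.
by rewrite /zd zx_out// d0.
Qed.

Lemma zd_ae_all : {ae mu2, forall x i j, zd r U i j x = d i j x}.
Proof.
have h1 := zd_ae false false; have h2 := zd_ae false true.
have h3 := zd_ae true false; have h4 := zd_ae true true.
apply: (@filterS2 _ (almost_everywhere mu2) _ _ _ _ _
  (@filterI _ (almost_everywhere mu2) _ _ _ h1 h2) (@filterI _ (almost_everywhere mu2) _ _ _ h3 h4)).
by move=> x [e1 e2] [e3 e4] [] [].
Qed.

Lemma meas2_zd i j : meas2 (zd r U i j).
Proof.
apply/(meas2_zx _ (measurable_square r)).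
by have [_ [m _] _] := weak_partial_spec (tuple_weak i j).
Qed.

Lemma sqi_zd i j : sqi (zd r U i j).
Proof.
have [_ /(_ i j)[md hd] _ _ _] := w; have mz := meas2_zd i j; split => //.
apply/integrableP; split; first by apply/measurable_EFinP; exact: meas2X.
pose F1 x : R := zd r U i j x ^+ 2; pose F2 x : R := d i j x ^+ 2.
apply: (@le_lt_trans _ _ (\int[mu2]_x `|(F2 x)%:E|)%E).
  rewrite le_eqVlt; apply/orP; left; apply/eqP; apply: ae_eq_integral => //.
  - by apply: measurableT_comp => //; apply/measurable_EFinP; exact: meas2X.
  - by apply: measurableT_comp => //; apply/measurable_EFinP; exact: meas2X.
  - by have := zd_ae i j; apply: (@filterS _ (almost_everywhere mu2)) => x e _ /=; rewrite e.
by case/integrableP : hd.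
Qed.

(** A function given on the square by a pair with explicit weak derivatives is
    a Sobolev function, and the lemmas that follow compute its energies from that
    pair. *)
Lemma tuple_H1 : H1 (square r) U.
Proof.
have [a1 a2 _ _ _] := w; split.
- by apply/L2_sqi; rewrite zu_eq.
- by move=> j; split; [exists (d false j); exact: (tuple_weak false j)|exists (d true j); exact: (tuple_weak true j)].
- by move=> j; apply/L2_sqi => i; have := sqi_zd i j; case: i.
Qed.

Lemma meas2_A0 j : meas2 (A0 j : R * R -> R).
Proof.
apply: meas2_continuous => x; rewrite /A0; case: j.
  by apply: cvgMl; exact: cvg_fst.
by apply: cvgMl; apply: cvgN; exact: cvg_snd.
Qed.

Lemma meas2_gsq (v : bool -> R * R -> R) (e : bool -> bool -> R * R -> R) :
  (forall i, meas2 (v i)) -> (forall i j, meas2 (e i j)) -> meas2 (gsq v e).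
Proof.
move=> mv me; have m1 j : meas2 (mgr v e j) by apply: meas2D => //; apply: meas2M => //; exact: meas2_A0.
have m2 j : meas2 (mgi v e j) by apply: meas2B => //; apply: meas2M => //; exact: meas2_A0.
by apply: meas2D; apply: meas2D; exact: meas2X.
Qed.

Lemma meas2_dens (v : bool -> R * R -> R) : (forall i, meas2 (v i)) -> meas2 (dens v).
Proof. by move=> mv; apply: meas2D; exact: meas2X. Qed.

Lemma tuple_Elin b : (Elin_fun U b r = (I2 (elin b u d))%:E)%E.
Proof.
have [a1 a2 _ _ _] := w.
rewrite Elin_zE -I2_EFin; last exact: (W_intg_elin b (@subset_refl _ _) w).
have mu_ i : meas2 (u i) by have [] := a1 i. 
have md_ i j : meas2 (d i j) by have [] := a2 i j.
rewrite zu_eq; apply: ae_eq_integral => //.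
- apply/measurable_EFinP; apply: meas2B; last exact: meas2_dens.
  by apply: meas2M; [exact: meas2_cst|apply: meas2_gsq => // i j; exact: meas2_zd].
- by apply/measurable_EFinP; apply: meas2B; [apply: meas2M; [exact: meas2_cst|exact: meas2_gsq]|exact: meas2_dens].
- have := zd_ae_all; apply: (@filterS _ (almost_everywhere mu2)) => x e _.
  by rewrite /elin /gsq /mgr /mgi !e.
Qed.

Lemma tuple_Eblk b : (Eblk_fun U b r = \int[mu2]_x (eblkd b u d x)%:E)%E.
Proof.
have [a1 a2 _ _ _] := w; rewrite Eblk_zE zu_eq.
have mu_ i : meas2 (u i) by have [] := a1 i.
have md_ i j : meas2 (d i j) by have [] := a2 i j.
have mD : meas2 (fun x => 2^-1 * dens u x ^+ 2).
  by apply: meas2M; [exact: meas2_cst|apply: meas2X; exact: meas2_dens].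
apply: ae_eq_integral => //.
- apply/measurable_EFinP; apply: meas2D => //; apply: meas2B; last exact: meas2_dens.
  by apply: meas2M; [exact: meas2_cst|apply: meas2_gsq => // i j; exact: meas2_zd].
- by apply/measurable_EFinP; apply: meas2D => //; apply: meas2B; [apply: meas2M; [exact: meas2_cst|exact: meas2_gsq]|exact: meas2_dens].
- have := zd_ae_all; apply: (@filterS _ (almost_everywhere mu2)) => x e _.
  by rewrite /eblkd /elin /gsq /mgr /mgi !e.
Qed.

Lemma tuple_L4 : (\int[mu2]_(x in square r) (normC (U x) ^+ 4)%:E = \int[mu2]_x (dens u x ^+ 2)%:E)%E.
Proof. by rewrite L4_zE zu_eq. Qed.

Definition h1d (v : bool -> R * R -> R) (e : bool -> bool -> R * R -> R) x : R :=
  dens v x + dens (fun i => e i false) x + dens (fun i => e i true) x.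

Lemma tuple_H1norm : (H1_norm_sq (square r) U = (I2 (h1d u d))%:E)%E.
Proof.
have [a1 a2 _ _ _] := w.
have hh : intg (h1d u d).
  apply: intgD; first apply: intgD.
  - exact: W_intg_dens w.
  - by apply: intgD; [exact: (a2 false false).2|exact: (a2 true false).2].
  - by apply: intgD; [exact: (a2 false true).2|exact: (a2 true true).2].
have mu_ i : meas2 (u i) by have [] := a1 i.
have md_ i j : meas2 (d i j) by have [] := a2 i j.
rewrite -I2_EFin// /H1_norm_sq [LHS]int_zx.
transitivity (\int[mu2]_x (h1d (zu r U) (zd r U) x)%:E)%E.
  apply: eq_integral => x _; congr EFin.
  have e0 : dens (zu r U) x = zx (square r) (dens (uof U)) x := zx_dens (square r) (uof U) x.
  have e1 j : dens (fun i => zd r U i j) x = zx (square r) (dens (fun i => dof r U i j)) x :=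
    zx_dens (square r) (fun i => dof r U i j) x.
  have E : h1d (zu r U) (zd r U) x = zx (square r) (dens (uof U)) x +
      zx (square r) (dens (fun i => dof r U i false)) x + zx (square r) (dens (fun i => dof r U i true)) x.
    exact: (congr2 +%R (congr2 +%R e0 (e1 false)) (e1 true)).
  rewrite E /zx; case: ifP => _; last by rewrite !addr0.
  by congr (_ + _ + _); exact: normC_sq.
rewrite zu_eq; apply: ae_eq_integral => //.
- apply/measurable_EFinP; apply: meas2D; first apply: meas2D.
  + exact: meas2_dens.
  + by apply: meas2_dens => i; exact: meas2_zd.
  + by apply: meas2_dens => i; exact: meas2_zd.
- by apply/measurable_EFinP; exact: intg_meas hh.
- have := zd_ae_all; apply: (@filterS _ (almost_everywhere mu2)) => x e _.
  by rewrite /h1d /dens !e.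
Qed.

End FromTuple.

Lemma W_test (r : R) (p : bool -> R * R -> R) : (forall i, test_fun (square r) (p i)) ->
  W setT (square r) p (fun i j => partial j (p i)).
Proof.
move=> tp; split.
- by move=> i; exact: test_fun_sqi (tp i).
- by move=> i j; exact: test_fun_sqi (test_fun_partial j (tp i)).
- by move=> i x; exact: test_fun_out (tp i).
- by move=> i j x; exact: test_fun_out (test_fun_partial j (tp i)).
- move=> i j psi tpsi; exact: I2_parts (tp i) (test_fun_smooth tpsi).
Qed.

Lemma I2_cauchy f g (s : R) : 0 < s -> sqi f -> sqi g -> I2 (fun x => f x ^+ 2) <= s ^+ 2 ->
  `|I2 (fun x => f x * g x)| <= s * (1 + I2 (fun x => g x ^+ 2)).
Proof.
move=> s0 hf hg fs; have hfg := sqi_intgM hf hg.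
apply: le_trans (le_norm_I2 hfg) _.
apply: (@le_trans _ _ (I2 (fun x => s^-1 * f x ^+ 2 + s * g x ^+ 2))).
  apply: le_I2; [exact: intg_norm|by apply: intgD; apply: intgZ; [exact: hf.2|exact: hg.2]|].
  move=> x; rewrite normrM -(real_normK (num_real (f x))) -(real_normK (num_real (g x))).
  have FG := mulr_ge0 (normr_ge0 (f x)) (normr_ge0 (g x)).
  move: FG; set F := `|f x|; set G := `|g x| => FG.
  have H : 0 <= s^-1 * (F - s * G) ^+ 2 by rewrite mulr_ge0 ?sqr_ge0// invr_ge0 ltW.
  have E : s^-1 * (F - s * G) ^+ 2 = s^-1 * F ^+ 2 + s * G ^+ 2 - 2 * (F * G).
    by field; rewrite gt_eqF.
  by rewrite E in H; lra.
rewrite I2D; [|exact/intgZ/hf.2|exact/intgZ/hg.2].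
rewrite !I2Z; [|exact: hf.2|exact: hg.2].
rewrite mulrDr mulr1 lerD2r -(ler_pM2l s0) mulrA mulfV ?gt_eqF// mul1r -expr2.
exact: fs.
Qed.

Lemma I2_le_comp (u : bool -> R * R -> R) (d : bool -> bool -> R * R -> R) (h : R * R -> R) :
  (forall i, sqi (u i)) -> (forall i j, sqi (d i j)) -> intg h -> (forall x, 0 <= h x <= h1d u d x) ->
  I2 h <= I2 (h1d u d).
Proof.
move=> hu hd hh hle; apply: le_I2 => //; last by move=> x; have /andP[] := hle x.
apply: intgD; first apply: intgD.
- by apply: intgD; [exact: (hu false).2|exact: (hu true).2].
- by apply: intgD; [exact: (hd false false).2|exact: (hd true false).2].
- by apply: intgD; [exact: (hd false true).2|exact: (hd true true).2].
Qed.

Lemma h1d_bounds u d x i j : u i x ^+ 2 <= h1d u d x /\ d i j x ^+ 2 <= h1d u d x.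
Proof.
rewrite /h1d /dens.
have := sqr_ge0 (u false x); have := sqr_ge0 (u true x).
have := sqr_ge0 (d false false x); have := sqr_ge0 (d true false x).
have := sqr_ge0 (d false true x); have := sqr_ge0 (d true true x).
by case: i; case: j => *; split; lra.
Qed.

(** Extension by zero of an [H10] function: the weak derivative identity passes
    to the limit along test functions. *)
Lemma H10_W r U : H10 (square r) U -> W setT (square r) (zu r U) (zd r U).
Proof.
move=> [hU app]; have wU := H1_W hU; have [a1 a2 a3 a4 a5] := wU.
split => // i j psi tpsi; have tdpsi := test_fun_partial j tpsi.
apply/eqP; rewrite -subr_eq0 opprK; apply/eqP.
set X := _ + _.
pose C := 2 + I2 (fun x => partial j psi x ^+ 2) + I2 (fun x => psi x ^+ 2).
have C0 : 0 < C.
  by rewrite /C -addrA ltr_pwDl// addr_ge0// I2_ge0// => x; rewrite sqr_ge0.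
suff XC s : 0 < s -> `|X| <= s * C.
  apply/eqP; rewrite -normr_le0; apply/ler_addgt0Pr => e e0; rewrite add0r.
  have := XC (e / C); rewrite divr_gt0// => /(_ isT).
  by rewrite mulfVK ?gt_eqF.
move=> s0; have [phi [[t0 t1] nphi]] := app (s ^+ 2) (exprn_gt0 _ s0).
have tp k : test_fun (square r) (uof phi k) by case: k.
have wphi : W (square r) (square r) (uof phi) (fun i j => partial j (uof phi i)).
  exact: WS (@subsetT _ _) (@subset_refl _ _) (W_test tp).
have wdiff := WD wU (WZ (- 1) wphi).
set u' := (fun _ _ => _ + _) in wdiff; set d' := (fun _ _ _ => _ + _) in wdiff.
have Udiff x k : square r x -> uof (fun x => U x - phi x) k x = u' k x.
  move=> sx; rewrite /u' /zu zx_in// mulN1r /uof /Re_fun /Im_fun.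
  by case: k; case: (U x) => a b; case: (phi x).
rewrite (tuple_H1norm wdiff Udiff) lte_fin in nphi.
have [b1 b2 _ _ _] := wdiff.
have le1 : I2 (fun x => u' i x ^+ 2) <= s ^+ 2.
  apply: le_trans (ltW nphi); apply: I2_le_comp => //; first exact: (b1 i).2.
  by move=> x; rewrite sqr_ge0; case: (h1d_bounds u' d' x i j).
have le2 : I2 (fun x => d' i j x ^+ 2) <= s ^+ 2.
  apply: le_trans (ltW nphi); apply: I2_le_comp => //; first exact: (b2 i j).2.
  by move=> x; rewrite sqr_ge0; case: (h1d_bounds u' d' x i j).
have c1 := I2_cauchy s0 (b1 i) (test_fun_sqi tdpsi) le1.
have c2 := I2_cauchy s0 (b2 i j) (test_fun_sqi tpsi) le2.
have XE : X = I2 (fun x => u' i x * partial j psi x) + I2 (fun x => d' i j x * psi x).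
  have p := I2_parts j (tp i) (test_fun_smooth tpsi).
  have e1 : I2 (fun x => u' i x * partial j psi x) =
      I2 (fun x => zu r U i x * partial j psi x) - I2 (fun x => uof phi i x * partial j psi x).
    rewrite -I2B; [|exact: sqi_test (a1 i) tdpsi|exact: sqi_test (test_fun_sqi (tp i)) tdpsi].
    by apply: I2_ext => x; rewrite /u'; ring.
  have e2 : I2 (fun x => d' i j x * psi x) =
      I2 (fun x => zd r U i j x * psi x) - I2 (fun x => partial j (uof phi i) x * psi x).
    rewrite -I2B; [|exact: sqi_test (a2 i j) tpsi|exact: sqi_test (test_fun_sqi (test_fun_partial j (tp i))) tpsi].
    by apply: I2_ext => x; rewrite /d'; ring.
  by rewrite e1 e2 p /X; ring.
rewrite XE (le_trans (ler_normD _ _))// (le_trans (lerD c1 c2))// /C.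
by rewrite -mulrDr le_eqVlt; apply/orP; left; apply/eqP; ring.
Qed.

(** The weak derivative passes through the correlation, since translates of a
    test function are test functions. *)
Lemma corr_wd Om f g j phi x : wd setT j f g -> intg f -> test_fun Om phi ->
  partial j (corr f phi) x = corr g phi x.
Proof.
move=> w hf trho; have {}trho := test_funS (@subsetT _ Om) trho.
rewrite corr_partial// /corr.
rewrite (I2_ext (g := fun y => f y * partial j (phi \o shift2 (opp2 x)) y)).
  by rewrite (w _ (test_fun_shift (opp2 x) trho)) opprK.
by move=> y; rewrite partial_shift2//; exact: test_fun_smooth trho.
Qed.

(** At a scale below half the difference of the sides, mollifications are test
    functions on the larger square, and they converge together with their
    derivatives. *)
Lemma W_H10 (q r : R) u d : W setT (square q) u d -> q < r -> H10 (square r) (cof u).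
Proof.
move=> w qr.
have wr : W (square r) (square r) u d.
  by apply: WS w; [exact: subsetT|exact/square_le/ltW].
have Uu x i : square r x -> uof (cof u) i x = u i x by case: i.
split; first exact: tuple_H1 wr Uu.
move=> e e0; have [a1 a2 a3 a4 a5] := w.
have e60 : 0 < e / 12 by rewrite divr_gt0.
have mo f : sqi f -> (forall x, ~ square q x -> f x = 0) ->
    exists2 de : R, 0 < de & forall (d' : R) (rho : R * R -> R), d' <= de -> unit_mollifier d' rho ->
    I2 (fun x => (corr f rho x - f x) ^+ 2) <= e / 12 /\ intg (fun x => (corr f rho x - f x) ^+ 2).
  move=> hf f0; have [de de0 H] := moll_L2 hf.1 hf.2 f0 e60; exists de => // d' rho dd um.
  have := H _ _ dd um.
  have mc : meas2 (fun x => (corr f rho x - f x) ^+ 2).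
    apply: meas2X; apply: meas2B; last exact: hf.1.
    by apply: corr_meas; [exact: intg_of_sqr hf.1 hf.2 f0|case: um].
  move=> le1.
  have hi : intg (fun x => (corr f rho x - f x) ^+ 2).
    apply/integrableP; split; first exact/measurable_EFinP.
    under eq_integral do rewrite /= ger0_norm ?sqr_ge0//.
    by rewrite (le_lt_trans le1)// ltry.
  by split; rewrite // -lee_fin -I2_EFin.
have [m1 m10 M1] := mo _ (a1 false) (a3 false).
have [m2 m20 M2] := mo _ (a1 true) (a3 true).
have [m3 m30 M3] := mo _ (a2 false false) (a4 false false).
have [m4 m40 M4] := mo _ (a2 false true) (a4 false true).
have [m5 m50 M5] := mo _ (a2 true false) (a4 true false).
have [m6 m60 M6] := mo _ (a2 true true) (a4 true true).
(* One scale for the six components, small enough to keep the support inside. *)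
pose de := \big[Num.min/((r - q) / 2)]_(m <- [:: m1; m2; m3; m4; m5; m6]) m.
have de0 : 0 < de.
  by rewrite /de !big_cons big_nil !lt_min m10 m20 m30 m40 m50 m60 divr_gt0 ?subr_gt0.
have [l1 l2 l3 l4] : [/\ de <= m1, de <= m2, de <= m3 & de <= m4].
  by rewrite /de !big_cons big_nil !ge_min !lexx !orbT.
have [l5 l6 l7] : [/\ de <= m5, de <= m6 & de <= (r - q) / 2].
  by rewrite /de !big_cons big_nil !ge_min !lexx !orbT.
have [rho um] := mollifier_exists de0; have [trho rho0 rhoS rho1] := um.
pose p i := corr (u i) rho.
have iu i : intg (u i) by exact: intg_of_sqr (a1 i).1 (a1 i).2 (a3 i).
have tp i : test_fun (square r) (p i).
  apply: (@test_fun_rect _ _ _ (q + de) r) => //; first exact: corr_smooth.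
  - by move: l7; lra.
  - by move=> x nx; apply: (corr_supp (r := q) (d := de)) => //; exact: a3.
have dp i j : partial j (p i) = corr (d i j) rho.
  by apply/funext => x; exact: corr_wd (a5 i j) (iu i) trho.
exists (cof p); split; first by split; [exact: (tp false)|exact: (tp true)].
have wp : W (square r) (square r) p (fun i j => partial j (p i)).
  exact: WS (@subsetT _ _) (@subset_refl _ _) (W_test tp).
have wdiff := WD wr (WZ (- 1) wp).
set u' := (fun _ _ => _ + _) in wdiff; set d' := (fun _ _ _ => _ + _) in wdiff.
have Udiff x k : square r x -> uof (fun x => cof u x - cof p x) k x = u' k x.
  by move=> sx; rewrite /u' mulN1r; case: k.
rewrite (tuple_H1norm wdiff Udiff) lte_fin.
have [N1 I1] := M1 _ _ l1 um; have [N2 I2'] := M2 _ _ l2 um.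
have [N3 I3] := M3 _ _ l3 um; have [N4 I4] := M4 _ _ l4 um.
have [N5 I5] := M5 _ _ l5 um; have [N6 I6] := M6 _ _ l6 um.
rewrite (I2_ext (g := fun x => ((corr (u false) rho x - u false x) ^+ 2 + (corr (u true) rho x - u true x) ^+ 2) +
   ((corr (d false false) rho x - d false false x) ^+ 2 + (corr (d true false) rho x - d true false x) ^+ 2) +
   ((corr (d false true) rho x - d false true x) ^+ 2 + (corr (d true true) rho x - d true true x) ^+ 2))); last first.
  by move=> x; rewrite /h1d /dens /u' /d' !dp /p; ring.
rewrite !I2D//; do ?[by apply: intgD].
  by move: N1 N2 N3 N4 N5 N6 e0; lra.
by apply: intgD; exact: intgD.
Qed.

End SobolevInterface.

(** * Cutoffs whose energy cost is absorbed by the quartic term *)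

Section Cutoff.
Context {R : realType}.
Local Notation plane := (measurableTypeR R * measurableTypeR R)%type.
Implicit Types (f g phi psi : R * R -> R) (x c : R * R) (Om S : set (R * R)).
Implicit Types (u : bool -> R * R -> R) (d : bool -> bool -> R * R -> R).

(** Equal to 1 for [`|t| <= r / 2 - 1] and to 0 for [`|t| >= r / 2 - 1 / 2], with a
    slope that does not depend on [r]. *)
Definition win (r t : R) : R := step (- 1 * t + (r / 2 - 2^-1)) * step (1 * t + (r / 2 - 2^-1)).

Lemma win_itv r t : 0 <= win r t <= 1.
Proof.
have /andP[a0 a1] := step_itv (- 1 * t + (r / 2 - 2^-1)).
have /andP[b0 b1] := step_itv (1 * t + (r / 2 - 2^-1)).
by rewrite mulr_ge0//= -[leRHS]mulr1 ler_pM.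
Qed.

Lemma win_eq1 r t : `|t| <= r / 2 - 1 -> win r t = 1.
Proof. by rewrite ler_norml => /andP[a1 a2]; rewrite /win !step_eq1 ?mulr1//; lra. Qed.

Lemma win_eq0 r t : r / 2 - 2^-1 <= `|t| -> win r t = 0.
Proof.
rewrite ler_normr => /orP[a|a]; rewrite /win.
  by rewrite (@step_eq0 _ (- 1 * t + _)) ?mul0r//; lra.
by rewrite (@step_eq0 _ (1 * t + _)) ?mulr0//; lra.
Qed.

Lemma win_deriv : exists2 K : R, 0 <= K & forall r, exists2 w' : R -> R,
  smooth1 (win r) /\ (forall t : R, is_derive t (1 : R) (win r) (w' t)) & forall t, `|w' t| <= K.
Proof.
have [h' [sh' hh' [K K0 KP]]] := @step_deriv_bounded R.
exists (2 * K); first by rewrite mulr_ge0.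
move=> r; pose a (s t : R) : R := s * t + (r / 2 - 2^-1).
have da s (t : R) : is_derive t (1 : R) (a s : R -> R) s.
  by rewrite /a; apply: is_derive_eq; rewrite /GRing.scale /=; ring.
exists (fun t => step (a (- 1) t) * h' (a 1 t) - h' (a (- 1) t) * step (a 1 t)); first split.
- apply: smooth1_algP; apply: s1_mul; apply: s1_smooth.
    by apply: (smooth1_affine (- 1) _ (@smooth1_step R)).
  by apply: (smooth1_affine 1 _ (@smooth1_step R)).
- move=> t; have d1 : is_derive t (1 : R) (step \o a (- 1)) _ := is_derive1_comp (hh' _) (da (- 1) t).
  have d2 : is_derive t (1 : R) (step \o a 1) _ := is_derive1_comp (hh' _) (da 1 t).
  have := is_deriveM d1 d2; congr is_derive.
  by rewrite /GRing.scale /=; ring.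
- move=> t; apply: le_trans (ler_normB _ _) _.
  rewrite (normrM (step _)) (normrM (h' _)) mulrDl !mul1r lerD//.
    have /andP[s0 s1] := step_itv (a (- 1) t).
    by rewrite (ger0_norm s0) -[leRHS]mul1r ler_pM.
  have /andP[s0 s1] := step_itv (a 1 t).
  by rewrite (ger0_norm s0) -[leRHS]mulr1 ler_pM.
Qed.

Lemma partial_coord (h h' : R -> R) i j x : (forall t : R, is_derive t (1 : R) h (h' t)) ->
  partial j (fun x => h (coord i x)) x = if i == j then h' (coord j x) else 0.
Proof.
move=> hh'; apply: pd_partial; rewrite /pd.
have [->|ij] := eqVneq i j.
  rewrite (_ : slice j _ x = h); last by apply/funext => t; rewrite /slice; case: (j).
  exact: hh'.
rewrite (_ : slice j _ x = cst (h (coord i x))); first exact: is_derive_cst.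
by apply/funext => t; rewrite /slice; case: i j ij => [] [].
Qed.

(** A cutoff of the square whose gradient is controlled by [eta ^+ 3], where
    [cutoff = 1 - eta ^+ 4]: with this vanishing order at the edge of the inner
    region, the energy created by the cutoff is absorbed by the quartic term. *)
Lemma cutoff_exists : exists2 K : R, 0 <= K & forall r : R, exists chi eta : R * R -> R,
  exists h : bool -> R * R -> R,
  [/\ smooth chi, forall x, 0 <= eta x <= 1, forall x, chi x = 1 - eta x ^+ 4 &
   [/\ forall j x, partial j chi x = eta x ^+ 3 * h j x, forall j x, `|h j x| <= K,
      forall x, ~ square (r - 1) x -> eta x = 1 & forall x, square (r - 2) x -> eta x = 0] ].
Proof.
have [K K0 KP] := win_deriv; exists (4 * K); first by rewrite mulr_ge0.
move=> r; have [w' [sw dw] wK] := KP r.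
pose p x : R := win r (coord false x) * win r (coord true x).
pose e x : R := 1 + - 1 * p x.
pose dp j x : R := if j then win r x.1 * w' x.2 else w' x.1 * win r x.2.
have sp : smooth p := smoothM (smooth1_coord false sw) (smooth1_coord true sw).
have s1 k : smooth (fun _ : R * R => k) := smooth_cst k.
have sm1 : smooth (fun x => - 1 * p x) := smoothM (s1 _) sp.
have se : smooth e := smoothD (s1 1) sm1.
have pc j (k : R) x : partial j (fun=> k) x = 0 := pd_partial (pd_cst j k x).
have epE j x : partial j e x = - dp j x.
  rewrite /e (partialD j x (s1 1) sm1) (partialM j x (s1 (- 1)) sp).
  rewrite !pc mul0r addr0 add0r mulN1r; congr (- _).
  rewrite /p (partialM j x (smooth1_coord false sw) (smooth1_coord true sw)).
  by rewrite !(partial_coord _ _ _ dw) /dp; case: j; rewrite /= ?mul0r ?mulr0 ?addr0 ?add0r.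
have s2 : smooth (fun x => e x * e x) := smoothM se se.
have s4 : smooth (fun x => (e x * e x) * (e x * e x)) := smoothM s2 s2.
have sm4 : smooth (fun x => - 1 * ((e x * e x) * (e x * e x))) := smoothM (s1 _) s4.
exists (fun x => 1 + - 1 * ((e x * e x) * (e x * e x))), e, (fun j x => 4 * dp j x).
have e01 x : 0 <= e x <= 1.
  have /andP[a0 a1] := win_itv r (coord false x); have /andP[b0 b1] := win_itv r (coord true x).
  have : 0 <= p x by exact: mulr_ge0.
  have : p x <= 1 by rewrite /p -[leRHS]mulr1 ler_pM.
  by rewrite /e; lra.
split; [exact: smoothD (s1 1) sm4|exact: e01|by move=> x; ring|].
split.
- move=> j x; rewrite (partialD j x (s1 1) sm4) (partialM j x (s1 (- 1)) s4).
  rewrite !pc mul0r addr0 add0r (partialM j x s2 s2) (partialM j x se se) epE; ring.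
- move=> j x; rewrite normrM (@ger0_norm _ 4)// ler_wpM2l//.
  have /andP[a0 a1] := win_itv r x.1; have /andP[b0 b1] := win_itv r x.2.
  rewrite /dp; case: j; rewrite normrM.
    by rewrite (ger0_norm a0) -[leRHS]mul1r ler_pM.
  by rewrite (ger0_norm b0) -[leRHS]mulr1 ler_pM.
- move=> x nx; suff -> : e x = 1 + - 1 * 0 by ring.
  congr (1 + - 1 * _); rewrite /p.
  have [x1|x1] := ltP `|x.1| ((r - 1) / 2); last first.
    by rewrite /= (win_eq0 (t := x.1)) ?mul0r//; move: x1; lra.
  have [x2|x2] := ltP `|x.2| ((r - 1) / 2); first by exfalso; apply: nx; exact/squareP.
  by rewrite /= (win_eq0 (t := x.2)) ?mulr0//; move: x2; lra.
- move=> x /squareP[x1 x2]; rewrite /e /p /= !win_eq1 ?mulr1 ?subrr//; by move: x1 x2; lra.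
Qed.

(** The pointwise form of the absorption: with [p] and [v] a component of the
    magnetic gradient and of the function. *)
Lemma sqr_cutoff (eta h p v K : R) : 0 <= eta <= 1 -> `|h| <= K ->
  ((1 - eta ^+ 4) * p + eta ^+ 3 * h * v) ^+ 2 <= p ^+ 2 + 2 * K ^+ 2 * eta ^+ 2 * v ^+ 2.
Proof.
move=> /andP[e0 e1] hK.
have t0 : 0 <= eta ^+ 2 by rewrite exprn_ge0.
have t1 : eta ^+ 2 <= 1 by rewrite exprn_ile1.
have hh : h ^+ 2 <= K ^+ 2.
  by rewrite -(real_normK (num_real h)) lerXn2r ?nnegrE// (le_trans _ hK).
set t := eta ^+ 2 in t0 t1 *.
have -> : eta ^+ 4 = t ^+ 2 by rewrite -exprM.
have -> : ((1 - t ^+ 2) * p + eta ^+ 3 * h * v) ^+ 2 =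
   (1 - t ^+ 2) ^+ 2 * p ^+ 2 + 2 * ((1 - t ^+ 2) * p) * (eta ^+ 3 * h * v) + t ^+ 3 * (h * v) ^+ 2.
  by rewrite /t; ring.
have c : 2 * ((1 - t ^+ 2) * p) * (eta ^+ 3 * h * v) <=
    (1 - t ^+ 2) ^+ 2 * t ^+ 2 * p ^+ 2 + t * (h * v) ^+ 2.
  rewrite -subr_ge0.
  have -> : (1 - t ^+ 2) ^+ 2 * t ^+ 2 * p ^+ 2 + t * (h * v) ^+ 2 - 2 * ((1 - t ^+ 2) * p) * (eta ^+ 3 * h * v)
     = (eta * (h * v) - (1 - t ^+ 2) * t * p) ^+ 2 by rewrite /t; ring.
  exact: sqr_ge0.
have a : (1 - t ^+ 2) ^+ 2 * (1 + t ^+ 2) <= 1.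
  have tt0 : 0 <= t ^+ 2 by rewrite exprn_ge0.
  have tt1 : t ^+ 2 <= 1 by rewrite exprn_ile1.
  by move: tt0 tt1; set s := t ^+ 2 => s0 s1; nra.
have a' : (1 - t ^+ 2) ^+ 2 * (1 + t ^+ 2) * p ^+ 2 <= 1 * p ^+ 2 by rewrite ler_wpM2r// sqr_ge0.
have t3 : t ^+ 3 <= t by rewrite exprS -[leRHS]mulr1 ler_wpM2l// exprn_ile1.
have b : (t ^+ 3 + t) * (h * v) ^+ 2 <= 2 * t * (K ^+ 2 * v ^+ 2).
  apply: ler_pM; rewrite ?sqr_ge0 ?addr_ge0 ?exprn_ge0//.
    by move: t3; lra.
  by rewrite exprMn ler_wpM2r// sqr_ge0.
by move: c a' b; rewrite (mulrDl (t ^+ 3)); lra.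
Qed.

(** The gradient term costs at most a multiple of [eta ^+ 2 * X], with [X] the
    density of [u]; the loss in the quadratic term is of the same form, while the
    quartic term gains [eta ^+ 4 * X ^+ 2 / 2]. The sum is bounded independently
    of [X]. *)
Lemma eblkd_cutoff (b K : R) u d v e (eta : R) (h : bool -> R) x : 0 <= b -> 0 <= eta <= 1 ->
  (forall j, `|h j| <= K) -> (forall i, v i x = (1 - eta ^+ 4) * u i x) ->
  (forall i j, e i j x = (1 - eta ^+ 4) * d i j x + eta ^+ 3 * h j * u i x) ->
  eblkd b v e x <= eblkd b u d x + 2 * (2 * b * K ^+ 2 + 1) ^+ 2.
Proof.
move=> b0 e01 hK hv he; have /andP[e0 e1] := e01.
have gs : gsq v e x <= gsq u d x + 4 * K ^+ 2 * eta ^+ 2 * dens u x.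
  have r j : mgr v e j x = (1 - eta ^+ 4) * mgr u d j x + eta ^+ 3 * h j * u false x.
    by rewrite /mgr hv he; ring.
  have i j : mgi v e j x = (1 - eta ^+ 4) * mgi u d j x + eta ^+ 3 * h j * u true x.
    by rewrite /mgi hv he; ring.
  rewrite /gsq /dens !r !i.
  have := sqr_cutoff (mgr u d false x) (u false x) e01 (hK false).
  have := sqr_cutoff (mgi u d false x) (u true x) e01 (hK false).
  have := sqr_cutoff (mgr u d true x) (u false x) e01 (hK true).
  have := sqr_cutoff (mgi u d true x) (u true x) e01 (hK true).
  by lra.
have -> : eblkd b v e x = b * gsq v e x - (1 - eta ^+ 4) ^+ 2 * dens u x
    + 2^-1 * (1 - eta ^+ 4) ^+ 4 * dens u x ^+ 2.
  by rewrite /eblkd /elin /dens !hv; ring.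
rewrite /eblkd /elin.
have bgs := ler_wpM2l b0 gs; have X0 := dens_ge0 u x.
move: bgs X0; set X := dens u x; set G := gsq u d x; set Gv := gsq v e x => bgs X0.
have t0 : 0 <= eta ^+ 2 by rewrite exprn_ge0.
have t1 : eta ^+ 2 <= 1 by rewrite exprn_ile1.
move: bgs; have -> : eta ^+ 4 = (eta ^+ 2) ^+ 2 by rewrite -exprM.
set t := eta ^+ 2 in t0 t1 * => bgs.
have c1 : (1 - (1 - t ^+ 2) ^+ 2) * X <= 2 * t * X.
  apply: ler_wpM2r => //.
  have : t ^+ 2 <= t by rewrite expr2 -[leRHS]mulr1 ler_wpM2l.
  by have := sqr_ge0 (t ^+ 2); rewrite sqrrB expr1n mul1r; lra.
have c2 : (1 - t ^+ 2) ^+ 4 * X ^+ 2 <= (1 - t ^+ 2) * X ^+ 2.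
  rewrite ler_wpM2r ?sqr_ge0// exprS -[leRHS]mulr1 ler_wpM2l ?subr_ge0 ?exprn_ile1//.
    by rewrite subr_ge0 exprn_ile1.
  by rewrite lerBlDr lerDl exprn_ge0.
have c3 := sqr_ge0 (t * X - 2 * (2 * b * K ^+ 2 + 1)).
move: bgs c1 c2 c3.
have -> : (t * X - 2 * (2 * b * K ^+ 2 + 1)) ^+ 2 = t ^+ 2 * X ^+ 2 - 4 * (2 * b * K ^+ 2 + 1) * (t * X)
  + 4 * (2 * b * K ^+ 2 + 1) ^+ 2 by ring.
set Q := (2 * b * K ^+ 2 + 1) ^+ 2.
have -> : 4 * (2 * b * K ^+ 2 + 1) * (t * X) = 8 * (b * (K ^+ 2 * t * X)) + 4 * (t * X) by ring.
rewrite (mulrDr b G).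
have -> : b * (4 * K ^+ 2 * t * X) = 4 * (b * (K ^+ 2 * t * X)) by ring.
lra.
Qed.

End Cutoff.

(** * The energy per unit area of compactly supported functions *)

Section BulkEnergy.
Context {R : realType}.
Local Notation plane := (measurableTypeR R * measurableTypeR R)%type.
Implicit Types (f g phi psi : R * R -> R) (x c : R * R) (Om S : set (R * R)).
Implicit Types (u : bool -> R * R -> R) (d : bool -> bool -> R * R -> R).

(** Functions of the whole plane that vanish off the square: a substitute for
    the Dirichlet space that is stable under translation and gluing. *)
Definition trial (r : R) u d : Prop := W setT (square r) u d /\ intg (fun x => dens u x ^+ 2).

Definition energy (b : R) u d : R := I2 (eblkd b u d).

Definition einf (b r : R) : R :=
  inf [set energy b p.1 p.2 | p in [set p | trial r p.1 p.2]].

Lemma eblkd_out b u d x : (forall i, u i x = 0) -> (forall i j, d i j x = 0) -> eblkd b u d x = 0.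
Proof.
move=> u0 d0; rewrite /eblkd /elin /gsq /mgr /mgi /dens !u0 !d0; ring.
Qed.

Lemma W_out Om S b u d x : W Om S u d -> ~ S x -> eblkd b u d x = 0.
Proof. by move=> [_ _ u0 d0 _] nx; apply: eblkd_out => *; [exact: u0|exact: d0]. Qed.

Lemma intg_eblkd Om S b u d (N : R) : S `<=` square N -> W Om S u d ->
  intg (fun x => dens u x ^+ 2) -> intg (eblkd b u d).
Proof. by move=> SN w h; apply: intgD; [exact: W_intg_elin SN w|exact: intgZ]. Qed.

Lemma intg_mul_indic (A : set (R * R)) f : measurable (A : set plane) -> intg f ->
  intg (fun x => \1_A x * f x).
Proof.
move=> mA hf; apply: intg_ext (intg_mulb (M := 1) hf (meas2_indic mA) _) => x; first exact: mulrC.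
by rewrite indicE; case: (_ \in _); rewrite ?normr0 ?normr1.
Qed.

Lemma energy_lb Om (b r : R) u d : 0 <= b -> 0 <= r -> W Om (square r) u d ->
  intg (fun x => dens u x ^+ 2) -> - (r ^+ 2 / 2) <= energy b u d.
Proof.
move=> b0 r0 w h.
have -> : - (r ^+ 2 / 2) = I2 (fun x => - 2^-1 * (\1_(square r) : R * R -> R) x).
  by rewrite I2Z ?I2_indic_square//; [ring|exact: intg_indic_square].
apply: le_I2; [exact/intgZ/intg_indic_square|exact: (intg_eblkd b (@subset_refl _ _) w h)|].
move=> x; rewrite indicE; have [_|/negP nx] := boolP (x \in square r).
  by rewrite mulr1 eblkd_lb.
by rewrite mulr0 (W_out _ w)// => sx; apply: nx; exact/mem_set.
Qed.

Lemma einf_has_lb b r : 0 <= b -> 0 <= r ->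
  has_lbound [set energy b p.1 p.2 | p in [set p | trial r p.1 p.2]].
Proof.
move=> b0 r0; exists (- (r ^+ 2 / 2)) => _ /= [[u d] /= [w h] <-].
exact: energy_lb w h.
Qed.

Lemma einf_le b r u d : 0 <= b -> 0 <= r -> trial r u d -> einf b r <= energy b u d.
Proof. by move=> b0 r0 t; apply: ge_inf; [exact: einf_has_lb|exists (u, d)]. Qed.

Lemma trial0 r : trial r (fun _ _ => 0) (fun _ _ _ => 0).
Proof.
by split; [exact: W0|apply: intg_ext (@intg0 R) => x; rewrite /dens !expr0n addr0 expr0n].
Qed.

Lemma le_einf b r a : (forall u d, trial r u d -> a <= energy b u d) -> a <= einf b r.
Proof.
move=> H; apply: lb_le_inf; first exists (energy b (fun _ _ => 0) (fun _ _ _ => 0)).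
  by exists (fun _ _ => 0, fun _ _ _ => 0); first exact: trial0.
by move=> _ [[u d] /= t <-]; exact: H.
Qed.

Lemma einf_lt b r a : 0 <= b -> 0 <= r -> einf b r < a -> exists u d, trial r u d /\ energy b u d < a.
Proof.
move=> b0 r0 lta; apply: contrapT => H; suff : a <= einf b r by rewrite leNgt lta.
apply: le_einf => u d t; rewrite leNgt; apply/negP => l; apply: H.
by exists u, d.
Qed.

Lemma einf_le0 b r : 0 <= b -> 0 <= r -> einf b r <= 0.
Proof.
move=> b0 r0; apply: le_trans (einf_le b0 r0 (trial0 r)) _.
rewrite /energy (I2_ext (g := fun=> 0)) ?I2_0// => x.
exact: eblkd_out.
Qed.

Lemma einf_ge b r : 0 <= b -> 0 <= r -> - (r ^+ 2 / 2) <= einf b r.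
Proof. by move=> b0 r0; apply: le_einf => u d [w h]; exact: energy_lb w h. Qed.

Lemma trial_le r s u d : r <= s -> trial r u d -> trial s u d.
Proof. by move=> rs [w h]; split => //; apply: WS w => //; exact: square_le. Qed.

Lemma einf_anti b r s : 0 <= b -> 0 <= r -> r <= s -> einf b s <= einf b r.
Proof.
move=> b0 r0 rs; apply: le_einf => u d t; apply: einf_le (trial_le rs t) => //.
exact: le_trans rs.
Qed.

Lemma opp2K : involutive (@opp2 R).
Proof. by case=> a b; rewrite /opp2 /= !opprK. Qed.

(** Cutting off at the boundary of a square costs an energy proportional to the
    area of the layer of width one along its sides. *)
Lemma einf_cut b : 0 <= b -> exists2 C : R, 0 <= C & forall r Om S N u d, 2 <= r ->
  W Om S u d -> S `<=` square N -> intg (fun x => dens u x ^+ 2) -> square r `<=` Om ->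
  einf b r <= I2 (fun x => \1_(square r) x * eblkd b u d x) + C * r.
Proof.
move=> b0; have [K K0 KP] := @cutoff_exists R.
pose K1 := 2 * (2 * b * K ^+ 2 + 1) ^+ 2.
have K10 : 0 <= K1 by rewrite mulr_ge0 ?sqr_ge0.
exists (4 * K1); first by rewrite mulr_ge0.
move=> r Om S N u d r2 w SN h rOm; have r0 : 0 <= r by lra.
have [chi [eta [hh [schi e01 chiE [dchi hK eta1 eta0]]]]] := KP r.
have chi0 x : ~ square (r - 1) x -> chi x = 0.
  by move=> nx; rewrite chiE eta1// expr1n subrr.
have tchi : test_fun (square r) chi.
  by apply: (test_fun_rect (r := r - 1) (s := r)) => //; lra.
have tchi' : test_fun Om chi := test_funS rOm tchi.
have chir x : ~ square r x -> chi x = 0 by exact: test_fun_out tchi.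
have dchir j x : ~ square r x -> partial j chi x = 0.
  exact: test_fun_out (test_fun_partial j tchi).
have wv := W_cut w tchi' chir dchir.
set v := (fun i x => chi x * u i x) in wv.
set e := (fun i j x => chi x * d i j x + partial j chi x * u i x) in wv.
have chi01 x : 0 <= chi x <= 1.
  have /andP[a0 a1] := e01 x; rewrite chiE subr_ge0 exprn_ile1//=.
  by rewrite lerBlDr lerDl exprn_ge0.
have hv : intg (fun x => dens v x ^+ 2).
  apply: intg_le h _.
    have [a1 _ _ _ _] := wv; apply: meas2X; apply: meas2D; apply: meas2X.
      exact: (a1 false).1.
    exact: (a1 true).1.
  move=> x; rewrite ger0_norm ?sqr_ge0// lerXn2r ?nnegrE ?dens_ge0//.
  have /andP[c0 c1] := chi01 x.
  have -> : dens v x = chi x ^+ 2 * dens u x by rewrite /dens /v; ring.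
  by rewrite -[leRHS]mul1r ler_wpM2r ?dens_ge0// exprn_ile1.
have ie := intg_eblkd b SN w h.
have mr := @measurable_square R r.
have i1 := intg_mul_indic mr ie.
have s1 := @intg_indic_square R r; have s2 := @intg_indic_square R (r - 2).
(* The cutoff only changes the density between the squares of sides [r - 2] and [r]. *)
pose F x : R := \1_(square r) x * eblkd b u d x + K1 * (\1_(square r) x - \1_(square (r - 2)) x).
have : einf b r <= I2 F.
  apply: le_trans (einf_le (d := e) b0 r0 (conj wv hv)) _.
  apply: le_I2; [exact: (intg_eblkd b (@subset_refl _ _) wv hv)|by apply: intgD => //; apply: intgZ; exact: intgB|].
  move=> x; rewrite /F !indicE; have [sx|nx] := pselect (square r x); last first.
    have nx2 : ~ square (r - 2) x by move=> /(square_le (s := r)) sx; apply: nx; apply: sx; lra.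
    by rewrite !memNset// mul0r subrr mulr0 addr0 (W_out _ wv).
  rewrite (mem_set sx) mul1r; have [sx2|nx2] := pselect (square (r - 2) x).
    rewrite (mem_set sx2) subrr mulr0 addr0 /eblkd /elin /gsq /mgr /mgi /dens /v /e.
    by rewrite !dchi !chiE eta0// !expr0n /= subr0 !mul1r !mul0r !addr0.
  rewrite (memNset nx2) subr0 mulr1 /K1.
  apply: (eblkd_cutoff (eta := eta x) (h := hh ^~ x)) => //.
  - by move=> i; rewrite /v chiE.
  - by move=> i j; rewrite /e chiE dchi.
rewrite /F I2D//; last by apply: intgZ; exact: intgB.
rewrite I2Z; last exact: intgB.
rewrite I2B// !I2_indic_square//; last by lra.
move/le_trans; apply; rewrite lerD2l.
have -> : 4 * K1 * r = K1 * (4 * r) by ring.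
rewrite ler_wpM2l//; lra.
Qed.

(** Centres of the cells of a subdivision of the square of side [n * r]. *)
Definition ctr (n : nat) (r : R) (k : 'I_n * 'I_n) : R * R :=
  (r * (k.1%:R - (n%:R - 1) / 2), r * (k.2%:R - (n%:R - 1) / 2)).

Definition cell n r (k : 'I_n * 'I_n) x : Prop := square r (shift2 (opp2 (ctr r k)) x).

Lemma cellP n r (k : 'I_n * 'I_n) x : cell r k x <->
  `|x.1 - (ctr r k).1| < r / 2 /\ `|x.2 - (ctr r k).2| < r / 2.
Proof. by rewrite /cell squareP. Qed.

Lemma ctr_inj n (r t : R) (i j : 'I_n) : 0 < r ->
  `|t - r * (i%:R - (n%:R - 1) / 2)| < r / 2 -> `|t - r * (j%:R - (n%:R - 1) / 2)| < r / 2 -> i = j.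
Proof.
move=> r0; rewrite !ltr_norml => /andP[a1 a2] /andP[b1 b2].
have H1 : r * i%:R < r * (j.+1)%:R by rewrite -natr1; lra.
have H2 : r * j%:R < r * (i.+1)%:R by rewrite -natr1; lra.
move: H1 H2; rewrite !ltr_pM2l// !ltr_nat !ltnS => H1 H2.
by apply/val_inj/eqP; rewrite eqn_leq H1 H2.
Qed.

Lemma cell_sub n r (k : 'I_n * 'I_n) x : 0 < r -> cell r k x -> square (n%:R * r) x.
Proof.
move=> r0 /cellP[]; rewrite /ctr/= => x1 x2.
have H (t : R) (i : 'I_n) : `|t - r * (i%:R - (n%:R - 1) / 2)| < r / 2 -> `|t| < n%:R * r / 2.
  rewrite !ltr_norml => /andP[a1 a2].
  have i0 : 0 <= r * i%:R by rewrite mulr_ge0// ltW.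
  have i1 : r * i%:R <= r * n%:R - r.
    have -> : r * n%:R - r = r * (n%:R - 1) by ring.
    by rewrite ler_pM2l// lerBrDr natr1 ler_nat.
  by apply/andP; split; lra.
by apply/squareP; split; [exact: H x1|exact: H x2].
Qed.

(** A point lies in at most one cell; when it lies in none, any index serves as
    [k0]. *)
Lemma cell_unique n r x : (0 < n)%N -> 0 < r ->
  exists k0 : 'I_n * 'I_n, forall k, k != k0 -> ~ cell r k x.
Proof.
move=> n0 r0; have [[k0 c0]|H] := pselect (exists k : 'I_n * 'I_n, cell r k x).
  exists k0 => k kk0 ck; move: kk0; apply/negP; rewrite negbK.
  move: c0 ck => /cellP[a1 a2] /cellP[b1 b2].
  case: k k0 a1 a2 b1 b2 => [i j] [i0 j0] /= a1 a2 b1 b2.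
  by rewrite (ctr_inj r0 b1 a1) (ctr_inj r0 b2 a2).
exists (Ordinal n0, Ordinal n0) => k _ ck; apply: H; by exists k.
Qed.

Lemma intg_sum (I : Type) (s : seq I) (F : I -> R * R -> R) :
  (forall k, intg (F k)) -> intg (fun x => \sum_(k <- s) F k x).
Proof.
move=> H; elim: s => [|k s IH]; first by apply: intg_ext (@intg0 R) => x; rewrite big_nil.
by apply: intg_ext (intgD (H k) IH) => x; rewrite big_cons.
Qed.

Lemma I2_sum (I : Type) (s : seq I) (F : I -> R * R -> R) :
  (forall k, intg (F k)) -> I2 (fun x => \sum_(k <- s) F k x) = \sum_(k <- s) I2 (F k).
Proof.
move=> H; elim: s => [|k s IH].
  by rewrite big_nil -[RHS]I2_0; apply: I2_ext => x; rewrite big_nil.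
rewrite big_cons -IH -I2D//; last exact: intg_sum.
by apply: I2_ext => x; rewrite big_cons.
Qed.

Lemma sum_cells n (a : R) : \sum_(k : 'I_n * 'I_n) a = n%:R ^+ 2 * a.
Proof. by rewrite sumr_const card_prod card_ord -[LHS]mulr_natl natrM expr2. Qed.

(** Magnetic translates of one function to all cells have disjoint supports, so
    their energies add up. *)
Lemma einf_glue b r n : 0 <= b -> 0 < r -> (0 < n)%N -> einf b (n%:R * r) <= n%:R ^+ 2 * einf b r.
Proof.
move=> b0 r0 n0.
have nn0 : 0 < n%:R :> R by rewrite ltr0n.
rewrite -ler_pdivrMl ?exprn_gt0//; apply: le_einf => u d [w h].
rewrite ler_pdivrMl ?exprn_gt0//.
pose uk (k : 'I_n * 'I_n) := mtu (ctr r k) 0 u; pose dk (k : 'I_n * 'I_n) := mtd (ctr r k) 0 u d.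
have wk k : W setT (square (n%:R * r)) (uk k) (dk k).
  by apply: WS (W_mt (ctr r k) 0 w) => // x; exact: cell_sub.
have ws := W_sum (s := index_enum ('I_n * 'I_n)%type) (fun k _ => wk k).
set v := (fun i x => _) in ws; set e := (fun i j x => _) in ws.
have [a1 a2 a3 a4 a5] := w.
have uk0 k i x : ~ cell r k x -> uk k i x = 0.
  by have [_ _ H _ _] := W_mt (ctr r k) 0 w; exact: H.
have dk0 k i j x : ~ cell r k x -> dk k i j x = 0.
  by have [_ _ _ H _] := W_mt (ctr r k) 0 w; exact: H.
have one x : exists k0, [/\ forall i, v i x = uk k0 i x, forall i j, e i j x = dk k0 i j x &
    forall k, k != k0 -> ~ cell r k x].
  have [k0 k0P] := cell_unique x n0 r0; exists k0; split => //.
    by move=> i; rewrite /v (bigD1 k0)//= big1 ?addr0// => k /k0P/uk0.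
  by move=> i j; rewrite /e (bigD1 k0)//= big1 ?addr0// => k /k0P/dk0.
have E1 x : eblkd b v e x = \sum_(k : 'I_n * 'I_n) eblkd b u d (shift2 (opp2 (ctr r k)) x).
  have [k0 [vk ek k0P]] := one x.
  rewrite (bigD1 k0)//= big1 ?addr0; last by move=> k /k0P nx; exact: W_out w nx.
  rewrite -(eblkd_mt b (ctr r k0) 0).
  by rewrite /eblkd /elin /gsq /mgr /mgi /dens !vk !ek.
have E2 x : dens v x ^+ 2 = \sum_(k : 'I_n * 'I_n) dens u (shift2 (opp2 (ctr r k)) x) ^+ 2.
  have [k0 [vk ek k0P]] := one x.
  rewrite (bigD1 k0)//= big1 ?addr0; last first.
    by move=> k /k0P nx; rewrite /dens !a3// expr0n addr0 expr0n.
  by rewrite -(dens_mt (ctr r k0) 0) /dens !vk.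
have ie := intg_eblkd b (@subset_refl _ _) w h.
have hv : intg (fun x => dens v x ^+ 2).
  apply: intg_ext (fun x => esym (E2 x)) _; apply: intg_sum => k.
  exact: (intg_shift (opp2 (ctr r k)) h).
apply: le_trans (einf_le (d := e) b0 _ (conj ws hv)) _; first by rewrite mulr_ge0// ltW.
rewrite /energy (I2_ext E1) I2_sum; last by move=> k; exact: (intg_shift (opp2 (ctr r k)) ie).
rewrite -sum_cells le_eqVlt; apply/orP; left; apply/eqP; apply: eq_bigr => k _.
exact: (I2_shift (opp2 (ctr r k)) (intg_meas ie)).
Qed.

(** Cut off a function of the large square in every cell. Adding 1/2 to the
    energy density makes it nonnegative, so that the sum over the disjoint cells is
    at most the integral over the large square. *)
Lemma einf_cells b : 0 <= b -> exists2 C : R, 0 <= C & forall r n, 2 <= r -> (0 < n)%N ->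
  n%:R ^+ 2 * (einf b r - C * r) <= einf b (n%:R * r).
Proof.
move=> b0; have [C C0 CP] := einf_cut b0; exists C => // r n r2 n0.
have r0 : 0 < r by lra.
apply: le_einf => u d [w h].
have ie := intg_eblkd b (@subset_refl _ _) w h.
pose one (k : 'I_n * 'I_n) y : R := \1_(square r) (shift2 (opp2 (ctr r k)) y).
have mone k : meas2 (one k).
  exact: (meas2_shift (opp2 (ctr r k)) (meas2_indic (@measurable_square R r))).
have one1 k y : `|one k y| <= 1.
  by rewrite /one indicE; case: (_ \in _); rewrite ?normr0 ?normr1.
have iF k : intg (fun y => eblkd b u d y * one k y) by exact: intg_mulb ie (mone k) (one1 k).
have Hk (k : 'I_n * 'I_n) : einf b r - C * r <= I2 (fun y => eblkd b u d y * one k y).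
  have wk := W_mt (opp2 (ctr r k)) 0 w.
  have hk : intg (fun x => dens (mtu (opp2 (ctr r k)) 0 u) x ^+ 2).
    apply: intg_ext (intg_shift (ctr r k) h) => x /=.
    by rewrite dens_mt opp2K.
  have SN : [set x | square (n%:R * r) (shift2 (opp2 (opp2 (ctr r k))) x)] `<=`
      square (n%:R * r + 2 * (`|(ctr r k).1| + `|(ctr r k).2|)).
    move=> x; rewrite opp2K /= => /squareP[]; rewrite /shift2/= => x1 x2.
    have t1 := ler_normB (x.1 + (ctr r k).1) (ctr r k).1.
    have t2 := ler_normB (x.2 + (ctr r k).2) (ctr r k).2.
    rewrite !addrK in t1 t2; have n1 := normr_ge0 (ctr r k).1; have n2 := normr_ge0 (ctr r k).2.
    by apply/squareP; split; lra.
  rewrite lerBlDr; apply: le_trans (CP r _ _ _ _ _ r2 wk SN hk (@subsetT _ _)) _.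
  rewrite lerD2r le_eqVlt; apply/orP; left; apply/eqP.
  rewrite -[RHS](I2_shift (ctr r k) (intg_meas (iF k))); apply: I2_ext => x /=.
  by rewrite eblkd_mt opp2K /one shift2K mulrC.
rewrite -sum_cells; apply: (@le_trans _ _ (\sum_k I2 (fun y => eblkd b u d y * one k y))).
  by apply: ler_sum => k _; exact: Hk.
have i1 k : intg (one k).
  exact: (intg_shift (opp2 (ctr r k)) (@intg_indic_square R r)).
have I1 k : I2 (one k) = r ^+ 2.
  rewrite -(I2_indic_square (ltW r0)).
  exact: (I2_shift (opp2 (ctr r k)) (intg_meas (@intg_indic_square R r))).
have : I2 (fun y => \sum_k (eblkd b u d y * one k y + 2^-1 * one k y)) <=
       I2 (fun y => eblkd b u d y + 2^-1 * (\1_(square (n%:R * r)) : R * R -> R) y).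
  apply: le_I2.
  - by apply: intg_sum => k; apply: intgD => //; exact: intgZ.
  - by apply: intgD => //; apply: intgZ; exact: intg_indic_square.
  move=> y; have [k0 k0P] := cell_unique y n0 r0.
  rewrite (bigD1 k0)//= big1 ?addr0; last first.
    by move=> k /k0P nk; rewrite /one indicE memNset// !mulr0 addr0.
  have e0 : 0 <= eblkd b u d y + 2^-1 by have := eblkd_lb u d y b0; lra.
  rewrite /one !indicE; have [sy|ny] := pselect (square (n%:R * r) y).
    rewrite (mem_set sy) mulr1; case: (_ \in _); rewrite ?mulr1// !mulr0 addr0.
    exact: e0.
  rewrite (memNset ny) memNset; last by move=> /(cell_sub r0).
  by rewrite !mulr0 (W_out _ w).
rewrite I2_sum; last by move=> k; apply: intgD => //; exact: intgZ.
rewrite I2D//; last by apply: intgZ; exact: intg_indic_square.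
rewrite I2Z; last exact: intg_indic_square.
rewrite I2_indic_square; last by rewrite mulr_ge0// ltW.
rewrite (eq_bigr (fun k => I2 (fun y => eblkd b u d y * one k y) + 2^-1 * r ^+ 2)); last first.
  by move=> k _; rewrite I2D//; [rewrite I2Z// I1|exact: intgZ].
rewrite big_split /= sum_cells /energy exprMn; lra.
Qed.

(** By subadditivity ([einf_glue]) the infimum is also the limit as the side
    tends to infinity; the infimum makes the bound [ebulk_le] immediate. *)
Definition ebulk (b : R) : R := inf [set einf b r / r ^+ 2 | r in [set r | 0 < r]].

Lemma ebulk_le b r : 0 <= b -> 0 < r -> ebulk b * r ^+ 2 <= einf b r.
Proof.
move=> b0 r0; rewrite -ler_pdivlMr ?exprn_gt0//; apply: ge_inf; last by exists r.
exists (- 2^-1) => _ [s /= s0 <-].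
by rewrite ler_pdivlMr ?exprn_gt0//; have := einf_ge b0 (ltW s0); lra.
Qed.

Lemma le_ebulk b a : (forall r, 0 < r -> a * r ^+ 2 <= einf b r) -> a <= ebulk b.
Proof.
move=> H; apply: lb_le_inf; first by exists (einf b 1 / 1 ^+ 2); exists 1; rewrite //= ltr01.
by move=> _ [r /= r0 <-]; rewrite ler_pdivlMr ?exprn_gt0//; exact: H.
Qed.

Lemma ebulk_ge b : 0 <= b -> - 2^-1 <= ebulk b.
Proof. by move=> b0; apply: le_ebulk => r r0; have := einf_ge b0 (ltW r0); lra. Qed.

Lemma ebulk_le0 b : 0 <= b -> ebulk b <= 0.
Proof.
move=> b0; have := ebulk_le b0 (@ltr01 R); rewrite expr1n mulr1 => /le_trans; apply.
exact: einf_le0.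
Qed.

(** Compare [einf b s] with [einf b r] through the large square of side [n * r]:
    it contains about [(n * r / s) ^ 2] cells of side [s]. The rounding error
    disappears as [n] tends to infinity, whereas the cutoff error per cell is
    [C * r] for every [n]. *)
Lemma einf_le_ebulk b : 0 <= b -> exists2 C : R, 0 <= C & forall r, 2 <= r ->
  einf b r <= ebulk b * r ^+ 2 + C * r.
Proof.
move=> b0; have [C C0 CP] := einf_cells b0; exists C => // r r2.
have r0 : 0 < r by lra.
rewrite -lerBlDr -ler_pdivrMr ?exprn_gt0//; apply: le_ebulk => s s0.
have eb0 := einf_le0 b0 (ltW s0).
set a := - einf b s; have a0 : 0 <= a by rewrite oppr_ge0.
have -> : einf b s = - a by rewrite opprK.
pose X := r / s; have X0 : 0 < X by rewrite divr_gt0.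
suff : einf b r - C * r <= - a * X ^+ 2.
  rewrite /X exprMn exprVn => H; rewrite mulrAC ler_pdivrMr ?exprn_gt0//.
  have := ler_wpM2r (ltW (exprn_gt0 2 s0)) H.
  by rewrite -!mulrA mulVf ?gt_eqF ?exprn_gt0// mulr1.
apply/ler_addgt0Pr => eps eps0.
(* The rounding error below is [2 * a * X / n], at most [eps] for this [n]. *)
pose n := (Num.truncn (2 * a * X / eps + X^-1)).+1.
have nN : 2 * a * X / eps + X^-1 < n%:R by exact: truncnS_gt.
have p0 : 0 <= 2 * a * X / eps by apply: divr_ge0; [apply: mulr_ge0; [exact: mulr_ge0|exact: ltW]|exact: ltW].
have nX : 1 <= n%:R * X.
  rewrite -ler_pdivrMr// mul1r; move: nN p0; lra.
have nn0 : 0 < n%:R :> R by rewrite ltr0n.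
pose m := Num.truncn (n%:R * X).
have /andP[m1 m2] : m%:R <= n%:R * X < m.+1%:R by apply: truncn_itv; lra.
have m0 : (0 < m)%N.
  by rewrite lt0n; apply/eqP => m00; rewrite m00 in m2; lra.
have ms : m%:R * s <= n%:R * r.
  by move: m1; rewrite /X mulrA ler_pdivlMr.
have H1 := CP r n r2 isT.
have H2 := einf_anti b0 (mulr_ge0 (ler0n _ m) (ltW s0)) ms.
have H3 := einf_glue b0 s0 m0.
have mm : (n%:R * X - 1) ^+ 2 <= m%:R ^+ 2.
  by rewrite lerXn2r ?nnegrE//; [lra|rewrite -natr1 in m2; lra].
have H4 : n%:R ^+ 2 * (einf b r - C * r) <= - a * (n%:R * X - 1) ^+ 2.
  apply: le_trans H1 _; apply: le_trans H2 _; apply: le_trans H3 _.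
  have -> : einf b s = - a by rewrite opprK.
  by have := ler_wpM2r a0 mm; lra.
rewrite -(ler_pM2l (exprn_gt0 2 nn0)); apply: le_trans H4 _.
have -> : - a * (n%:R * X - 1) ^+ 2 = n%:R ^+ 2 * (- a * X ^+ 2) + 2 * a * X * n%:R - a by ring.
have : 2 * a * X * n%:R <= n%:R ^+ 2 * eps.
  have -> : n%:R ^+ 2 * eps = (n%:R * eps) * n%:R by ring.
  rewrite ler_pM2r// -ler_pdivrMr//.
  have : 0 < X^-1 by rewrite invr_gt0.
  by move: nN; lra.
by rewrite mulrDr; lra.
Qed.

(** Lower bound without boundary condition: cut off near the boundary. *)
Lemma energy_ge b : 0 <= b -> exists2 C : R, 0 <= C & forall r u d, 2 <= r ->
  W (square r) (square r) u d -> intg (fun x => dens u x ^+ 2) ->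
  ebulk b * r ^+ 2 - C * r <= energy b u d.
Proof.
move=> b0; have [C C0 CP] := einf_cut b0; exists C => // r u d r2 w h.
have := CP r _ _ _ _ _ r2 w (@subset_refl _ _) h (@subset_refl _ _).
have r0 : 0 < r by lra.
have := ebulk_le b0 r0.
rewrite (I2_ext (g := eblkd b u d)); first by rewrite -/(energy b u d); lra.
move=> x; rewrite indicE; have [sx|nx] := pselect (square r x).
  by rewrite mem_set// mul1r.
by rewrite (W_out _ w)// mulr0.
Qed.

End BulkEnergy.

(** * The energy per unit area is negative for b < 1 *)

Section Negativity.
Context {R : realType}.
Local Notation plane := (measurableTypeR R * measurableTypeR R)%type.
Implicit Types (f g phi psi : R * R -> R) (x c : R * R) (Om S : set (R * R)).

Definition gauss1 (t : R) : R := expR (- (t ^+ 2 / 4)).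
Definition gauss x : R := gauss1 x.1 * gauss1 x.2.

Lemma is_derive_gauss1 (p : {poly R}) (t : R) :
  is_derive t (1 : R) (fun t => p.[t] * gauss1 t) ((p^`() - 2^-1 *: ('X * p)).[t] * gauss1 t).
Proof.
pose q : R -> R := fun t => - (t ^+ 2 / 4).
have dq : is_derive t (1 : R) q (- (t / 2)).
  by rewrite /q; apply: is_derive_eq; rewrite /GRing.scale/=; field.
have dg : is_derive t (1 : R) (expR \o q) (expR (q t) * - (t / 2)) := is_derive1_comp (is_derive_expR _) dq.
have := is_deriveM (is_derive_poly p t) dg.
suff -> : (p^`() - 2^-1 *: ('X * p)).[t] * gauss1 t =
  p.[t] *: (expR (q t) * - (t / 2)) + (expR \o q) t *: p^`().[t] by [].
rewrite hornerD hornerN hornerZ hornerM hornerX /GRing.scale /= /gauss1 -/(q t); ring.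
Qed.

(** Products of polynomials with the Gaussian are stable under differentiation. *)
Lemma smooth1_gauss1 : smooth1 gauss1.
Proof.
exists (fun h => exists p : {poly R}, h = fun t => p.[t] * gauss1 t).
  by exists 1; apply/funext => t; rewrite hornerC mul1r.
move=> _ [p ->]; eexists; first by exists (p^`() - 2^-1 *: ('X * p)).
exact: is_derive_gauss1.
Qed.

Lemma smooth1_id : smooth1 (fun t : R => t).
Proof.
exists (fun h => exists p : {poly R}, h = horner p).
  by exists 'X; apply/funext => t; rewrite hornerX.
move=> _ [p ->]; exists (horner p^`()); first by exists p^`().
exact: is_derive_poly.
Qed.

Lemma is_derive_gauss1' (t : R) : is_derive t (1 : R) gauss1 (- (t / 2) * gauss1 t).
Proof.
have := is_derive_gauss1 1 t; rewrite derivC sub0r hornerN hornerZ mulr1 hornerX.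
congr is_derive; first by apply/funext => s; rewrite hornerC mul1r.
by rewrite (mulrC 2^-1).
Qed.

Lemma partial_gauss j x : partial j gauss x = - (coord j x / 2) * gauss x.
Proof.
have s b := smooth1_coord b smooth1_gauss1.
have H b := partial_coord b j x is_derive_gauss1'.
transitivity (partial j (fun x => gauss1 (coord false x) * gauss1 (coord true x)) x); first by [].
rewrite (partialM j x (s false) (s true)) !H /gauss {H}.
case: j; rewrite /= ?mul0r ?mulr0 ?addr0 ?add0r; ring.
Qed.

Lemma smooth_gauss : smooth gauss.
Proof. exact: smoothM (smooth1_coord false smooth1_gauss1) (smooth1_coord true smooth1_gauss1). Qed.

Lemma gaussE x : gauss x = expR (- ((x.1 ^+ 2 + x.2 ^+ 2) / 4)).
Proof. by rewrite /gauss /gauss1 -expRD; congr expR; ring. Qed.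

(** The Gaussian is a ground state of the magnetic Laplacian: up to a divergence,
    the energy density of a localized Gaussian is its square plus a term in the
    gradient of the cutoff. *)
Lemma gauss_energy Om chi : test_fun Om chi ->
  let phi x := chi x * gauss x in
  I2 (fun x => partial false phi x ^+ 2 + partial true phi x ^+ 2 + (A0 false x ^+ 2 + A0 true x ^+ 2) * phi x ^+ 2) =
  I2 (fun x => phi x ^+ 2) + I2 (fun x => (partial false chi x ^+ 2 + partial true chi x ^+ 2) * gauss x ^+ 2).
Proof.
move=> tc phi; have sc := test_fun_smooth tc; have sg := smooth_gauss.
have tphi : test_fun Om phi.
  have := test_funMl tc sg; congr test_fun.
  by apply/funext => x; rewrite mulrC.
have sphi := test_fun_smooth tphi.
have sx j : smooth (coord j : R * R -> R) := smooth1_coord j smooth1_id.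
have tx j : test_fun Om (fun x => coord j x * (phi x * phi x)).
  exact: test_funMl (test_funMl tphi sphi) (sx j).
have pphi j x : partial j phi x = chi x * (- (coord j x / 2) * gauss x) + partial j chi x * gauss x.
  by rewrite /phi (partialM j x sc sg) partial_gauss.
have pc j x : partial j (coord j) x = 1.
  have := @partial_coord _ (fun t => t) (fun=> 1) j j x (fun t => is_derive_id t 1).
  by rewrite eqxx.
have pt j x : partial j (fun x => coord j x * (phi x * phi x)) x =
    coord j x * (2 * phi x * partial j phi x) + phi x ^+ 2.
  rewrite (partialM j x (sx j) (smoothM sphi sphi)) (partialM j x sphi sphi) pc; ring.
have isq f : test_fun Om f -> intg (fun x => f x ^+ 2).
  by move=> tf; exact: (test_fun_sqi tf).2.
have i0 := isq _ tphi.
have tdg j : test_fun Om (fun x => partial j chi x * gauss x).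
  have := test_funMl (test_fun_partial j tc) sg; congr test_fun.
  by apply/funext => x; rewrite mulrC.
have i1 j := isq _ (tdg j).
have it j : intg (partial j (fun x => coord j x * (phi x * phi x))).
  exact: test_fun_intg (test_fun_partial j (tx j)).
pose F j x : R := (partial j chi x * gauss x) ^+ 2 - 2^-1 * partial j (fun x => coord j x * (phi x * phi x)) x.
have iF j : intg (F j) by apply: intgB => //; exact: intgZ.
have IF j : I2 (F j) = I2 (fun x => (partial j chi x * gauss x) ^+ 2).
  by rewrite /F I2B//; [rewrite I2Z// (I2_partial0 j (tx j)) mulr0 subr0|exact: intgZ].
rewrite (I2_ext (g := fun x => phi x ^+ 2 + (F false x + F true x))); last first.
  by move=> x; rewrite /F !pt !pphi /phi /A0 /=; field.
rewrite I2D//; last exact: intgD.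
rewrite I2D// !IF -I2D//; congr (_ + _); apply: I2_ext => x; ring.
Qed.

(** A quadratic lower bound for the exponential is enough: the layer where the
    cutoff varies has area [O(s ^+ 2)]. *)
Lemma gauss_small (s : R) x : 1 <= s -> (s <= `|x.1| \/ s <= `|x.2|) -> gauss x ^+ 2 <= 8 / s ^+ 4.
Proof.
move=> s1 H; have s0 : 0 < s by lra.
have ss : s ^+ 2 <= x.1 ^+ 2 + x.2 ^+ 2.
  have := sqr_ge0 x.1; have := sqr_ge0 x.2.
  have mono (t : R) : s <= `|t| -> s ^+ 2 <= t ^+ 2.
    by move=> st; rewrite -(real_normK (num_real t)) lerXn2r ?nnegrE// ltW.
  by case: H => /mono; lra.
have -> : gauss x ^+ 2 = expR (- ((x.1 ^+ 2 + x.2 ^+ 2) / 2)).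
  by rewrite gaussE expr2 -expRD; congr expR; field.
rewrite expRN; set y := _ / 2.
have y0 : s ^+ 2 / 2 <= y by rewrite /y; lra.
have yp : 0 <= s ^+ 2 / 2 by rewrite divr_ge0// sqr_ge0.
have yp' := le_trans yp y0.
rewrite -[leRHS]invrK lef_pV2 ?posrE ?expR_gt0//; last by rewrite invr_gt0 divr_gt0// exprn_gt0.
rewrite invf_div; apply: le_trans (expR_ge1Dxn 1 yp').
have : (s ^+ 2 / 2) ^+ 2 <= y ^+ 2 by rewrite lerXn2r ?nnegrE.
rewrite exprMn -exprM /=; rewrite (_ : 2`!%:R = 2 :> R)//.
lra.
Qed.

(** For a Gaussian cut off at distance [s], the linear energy is at most
    [(b - 1)] times its squared norm plus [O(1 / s ^+ 2)]. Multiplying by a small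
    constant makes the quartic term negligible. *)
Lemma ebulk_lt0 b : 0 < b < 1 -> @ebulk R b < 0.
Proof.
move=> /andP[b0 b1]; have [K K0 KP] := @cutoff_exists R.
(* Cutoff distance for which the error [256 * K ^+ 2 / s ^+ 2] is smaller than
   [(1 - b) * exp (- 1)]. *)
pose s : R := 1 + (1 + 256 * K ^+ 2 * expR 1) / (1 - b).
have b10 : 0 < 1 - b by lra.
have T0 : 0 < 1 + 256 * K ^+ 2 * expR 1 :=
  ltr_pwDl ltr01 (mulr_ge0 (mulr_ge0 (ler0n _ 256) (sqr_ge0 K)) (expR_ge0 1)).
have s1 : 1 <= s by rewrite lerDl; exact: ltW (divr_gt0 T0 b10).
pose r := 2 * s + 2; have r0 : 0 < r by rewrite /r; lra.
have [chi [eta [h [schi e01 chiE [dchi hK eta1 eta0]]]]] := KP r.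
have chi0 x : ~ square (r - 1) x -> chi x = 0.
  by move=> nx; rewrite chiE eta1// expr1n subrr.
have tchi : test_fun (square r) chi.
  by apply: (test_fun_rect (r := r - 1) (s := r)) => //; lra.
pose phi x := chi x * gauss x.
have tphi : test_fun (square r) phi.
  have := test_funMl tchi smooth_gauss; congr test_fun.
  by apply/funext => x; rewrite mulrC.
have dK j x : partial j chi x ^+ 2 <= K ^+ 2.
  rewrite -(real_normK (num_real (partial j chi x))) lerXn2r ?nnegrE// dchi normrM.
  have /andP[a0 a1] := e01 x.
  by rewrite -[leRHS]mul1r ler_pM// ger0_norm ?exprn_ge0// exprn_ile1.
pose D x : R := (partial false chi x ^+ 2 + partial true chi x ^+ 2) * gauss x ^+ 2.
have sqg j : intg (fun x => (partial j chi x * gauss x) ^+ 2).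
  apply: (test_fun_sqi (Om := square r) _).2.
  have := test_funMl (test_fun_partial j tchi) smooth_gauss; congr test_fun.
  by apply/funext => x; rewrite mulrC.
have iD : intg D.
  by apply: intg_ext (intgD (sqg false) (sqg true)) => x; rewrite /D; ring.
have ID : I2 D <= 256 * K ^+ 2 / s ^+ 2.
  have s40 : 0 < s ^+ 4 by rewrite exprn_gt0//; lra.
  apply: (@le_trans _ _ (I2 (fun x => (16 * K ^+ 2 / s ^+ 4) * (\1_(square r) : R * R -> R) x))).
    apply: le_I2 => //; first by apply: intgZ; exact: intg_indic_square.
    move=> x; rewrite indicE; have [sx|nx] := pselect (square r x); last first.
      by rewrite memNset// mulr0 /D !(test_fun_out (test_fun_partial _ tchi) nx) expr0n addr0 mul0r.
    rewrite mem_set// mulr1; have [sx2|nx2] := pselect (square (r - 2) x).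
      rewrite /D !dchi eta0// !expr0n /= !mul0r expr0n addr0 mul0r.
      exact: divr_ge0 (mulr_ge0 (ler0n _ 16) (sqr_ge0 K)) (ltW s40).
    have g8 : gauss x ^+ 2 <= 8 / s ^+ 4.
      apply: gauss_small => //.
      have [x1|x1] := leP s `|x.1|; first by left.
      have [x2|x2] := leP s `|x.2|; first by right.
      exfalso; apply: nx2; apply/squareP.
      have -> : (r - 2) / 2 = s by rewrite /r; field.
      by split.
    have -> : 16 * K ^+ 2 / s ^+ 4 = (K ^+ 2 + K ^+ 2) * (8 / s ^+ 4) by field; lra.
    rewrite /D; apply: ler_pM => //; rewrite ?addr_ge0 ?sqr_ge0//.
    exact: lerD.
  rewrite I2Z; last exact: intg_indic_square.
  rewrite I2_indic_square; last exact: ltW.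
  have rs : r ^+ 2 <= 16 * s ^+ 2.
    have -> : 16 * s ^+ 2 = (4 * s) ^+ 2 by ring.
    by rewrite lerXn2r ?nnegrE//; rewrite /r; lra.
  apply: le_trans (ler_wpM2l _ rs) _; first exact: divr_ge0 (mulr_ge0 (ler0n _ 16) (sqr_ge0 K)) (ltW s40).
  rewrite le_eqVlt; apply/orP; left; apply/eqP; field; lra.
have iphi : intg (fun x => phi x ^+ 2) by exact: (test_fun_sqi tphi).2.
have Iphi : expR (- 1) <= I2 (fun x => phi x ^+ 2).
  have i1 := @intg_indic_square R 1.
  have : I2 (fun x => expR (- 1) * (\1_(square 1) : R * R -> R) x) <= I2 (fun x => phi x ^+ 2).
    apply: le_I2 => //; first exact: intgZ.
    move=> x; rewrite indicE; have [sx|nx] := pselect (square 1 x); last first.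
      by rewrite memNset// mulr0 sqr_ge0.
    rewrite mem_set// mulr1 /phi chiE eta0; last by apply: square_le sx; rewrite /r; lra.
    rewrite expr0n subr0 mul1r gaussE expr2 -expRD ler_expR.
    move: sx => /squareP[x1 x2].
    have H (t : R) : `|t| < 1 / 2 -> t ^+ 2 <= 1.
      by move=> ht; rewrite -(real_normK (num_real t)) exprn_ile1//; lra.
    by have := H _ x1; have := H _ x2; lra.
  by rewrite I2Z// I2_indic_square// expr1n mulr1.
have E1 := gauss_energy tchi; rewrite /= -/phi -/D in E1.
pose u (i : bool) x : R := if i then 0 else phi x.
have tu i : test_fun (square r) (u i).
  case: i; last exact: tphi.
  apply: (test_fun_rect (r := r - 1) (s := r) (smooth_cst 0)); [lra|exact: subset_refl|by []].
have wu := W_test tu.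
set du := (fun i j => partial j (u i)) in wu.
have du0 j x : du true j x = 0 := pd_partial (pd_cst j 0 x).
have gE x : gsq u du x = partial false phi x ^+ 2 + partial true phi x ^+ 2 +
    (A0 false x ^+ 2 + A0 true x ^+ 2) * phi x ^+ 2.
  by rewrite /gsq /mgr /mgi !du0 /du /u; ring.
have ig := W_intg_gsq (@subset_refl _ _) wu.
have id_ := W_intg_dens wu.
have Ig : I2 (gsq u du) = I2 (fun x => phi x ^+ 2) + I2 D.
  by rewrite -E1; apply: I2_ext => x; exact: gE.
have Id : I2 (dens u) = I2 (fun x => phi x ^+ 2).
  by apply: I2_ext => x; rewrite /dens /u expr0n addr0.
have iq : intg (fun x => dens u x ^+ 2).
  have := (test_fun_sqi (test_funMl tphi (test_fun_smooth tphi))).2; apply: intg_ext => x.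
  by rewrite /dens /u; ring.
set q := I2 (fun x => dens u x ^+ 2).
have q0 : 0 <= q by apply: I2_ge0 => x; exact: sqr_ge0.
set P := I2 (fun x => phi x ^+ 2) in Iphi Ig Id.
pose l := b * (P + I2 D) - P.
have l0 : l < 0.
  have e1 : 0 < expR 1 :> R by exact: expR_gt0.
  have eN : expR (- 1) = (expR 1)^-1 :> R by rewrite expRN.
  have D0 : 0 <= I2 D.
    by apply: I2_ge0 => x; rewrite mulr_ge0 ?addr_ge0 ?sqr_ge0.
  have bD : b * I2 D <= I2 D by rewrite -[leRHS]mul1r ler_wpM2r// ltW.
  have s0 : 0 < s by lra.
  have key : 256 * K ^+ 2 / s ^+ 2 < (1 - b) * expR (- 1).
    rewrite eN ltr_pdivrMr ?exprn_gt0// mulrAC ltr_pdivlMr//.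
    have ss : s <= s ^+ 2 by rewrite expr2 -[leLHS]mulr1 ler_pM2l.
    apply: (@lt_le_trans _ _ ((1 - b) * s)); last by rewrite ler_pM2l.
    have -> : (1 - b) * s = (1 - b) + (1 + 256 * K ^+ 2 * expR 1) by rewrite /s; field; lra.
    by lra.
  have : (1 - b) * expR (- 1) <= (1 - b) * P by rewrite ler_pM2l.
  by rewrite /l; move: ID key bD; lra.
have en (k : R) : ebulk b * r ^+ 2 <= k ^+ 2 * (l + k ^+ 2 / 2 * q).
  have wk := WZ k wu.
  set uk := (fun i x => k * u i x) in wk; set dk := (fun i j x => k * du i j x) in wk.
  have dE x : dens uk x = k ^+ 2 * dens u x by rewrite /dens /uk; ring.
  have ik : intg (fun x => dens uk x ^+ 2).
    by apply: intg_ext (intgZ (k ^+ 4) iq) => x; rewrite dE; ring.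
  apply: le_trans (ebulk_le (ltW b0) r0) _.
  apply: le_trans (einf_le (ltW b0) (ltW r0) (conj wk ik)) _.
  have EE x : eblkd b uk dk x = k ^+ 2 * (b * gsq u du x - dens u x) + 2^-1 * k ^+ 4 * dens u x ^+ 2.
    by rewrite /eblkd /elin /gsq /mgr /mgi /dens /uk /dk; ring.
  rewrite /energy (I2_ext EE).
  rewrite I2D; [|by apply: intgZ; apply: intgB => //; exact: intgZ|exact: intgZ].
  rewrite !I2Z//; last by apply: intgB => //; exact: intgZ.
  rewrite I2B//; last exact: intgZ.
  rewrite I2Z// Ig Id -/q /l le_eqVlt; apply/orP; left; apply/eqP; by field.
have rr0 : 0 < r ^+ 2 by rewrite exprn_gt0.
rewrite -(pmulr_llt0 _ rr0).
(* A squared amplitude for which the quartic term is less than half of [- l]. *)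
pose k2 := - l / (q + 1).
have q1 : 0 < q + 1 by lra.
have k20 : 0 < k2 by rewrite divr_gt0// oppr_gt0.
have := en (Num.sqrt k2); rewrite sqr_sqrtr; last exact: ltW.
move/le_lt_trans; apply; rewrite pmulr_rlt0//.
have kq : k2 * q < - l.
  rewrite /k2 mulrAC ltr_pdivrMr// mulrDr mulr1 ltrDl; lra.
lra.
Qed.

End Negativity.

(** * Magnetic periodic functions *)

Section Periodic.
Context {R : realType}.
Local Notation plane := (measurableTypeR R * measurableTypeR R)%type.
Local Notation mu2 := (@lebesgue2 R).
Implicit Types (f g phi psi : R * R -> R) (x c : R * R) (Om S : set (R * R)).
Implicit Types (u v : bool -> R * R -> R) (d e : bool -> bool -> R * R -> R) (U : R * R -> R[i]).

(** A function is the pointwise limit of its restrictions to squares. *)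
Lemma meas2_local f : (forall n : nat, meas2 (zx (square n%:R) f)) -> meas2 f.
Proof.
move=> H; apply: (measurable_fun_cvg (h := fun n => zx (square n%:R) f)) => // x _.
apply: cvg_near_cst; exists (Num.truncn (2 * (`|x.1| + `|x.2|))).+1 => // n /= nN.
apply/eqP; rewrite zx_in//; apply/squareP.
have := truncnS_gt (2 * (`|x.1| + `|x.2|)).
have : (Num.truncn (2 * (`|x.1| + `|x.2|))).+1%:R <= n%:R :> R by rewrite ler_nat.
by have := normr_ge0 x.1; have := normr_ge0 x.2; split; lra.
Qed.

Lemma zxT f : zx setT f = f.
Proof. by apply/funext => x; rewrite zx_in. Qed.

Lemma sqi_zx Om f : measurable (Om : set plane) -> sqi f -> sqi (zx Om f).
Proof.
move=> mO hf; apply: sqi_ext (sqi_mulb (M := 1) hf (meas2_indic mO) _) => x.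
  by rewrite indicE /zx; case: (_ \in _); rewrite ?mul1r ?mul0r.
by rewrite indicE; case: (_ \in _); rewrite ?normr0 ?normr1.
Qed.

Section Local.
Context (u : bool -> R * R -> R) (d : bool -> bool -> R * R -> R).
Context (loc : forall M : R, exists v e (N : R), W setT (square N) v e /\
  forall x, square M x -> (forall i, u i x = v i x) /\ (forall i j, d i j x = e i j x)).

Lemma loc_compact K : compact K -> exists v e (N : R), W setT (square N) v e /\
  forall x, K x -> (forall i, u i x = v i x) /\ (forall i j, d i j x = e i j x).
Proof.
move=> cK; have [r r0 Kr] := compact_sub_square cK.
have [v [e [N [w H]]]] := loc r; exists v, e, N; split => // x /Kr; exact: H.
Qed.

Lemma loc_meas_u i : meas2 (u i).
Proof.
apply: meas2_local => n; have [v [e [N [[a1 _ _ _ _] H]]]] := loc n%:R.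
have := (sqi_zx (measurable_square n%:R) (a1 i)).1; congr meas2; apply/funext => x.
have [sx|nx] := pselect (square n%:R x); last by rewrite !zx_out.
by rewrite !zx_in// (H x sx).1.
Qed.

Lemma loc_meas_d i j : meas2 (d i j).
Proof.
apply: meas2_local => n; have [v [e [N [[_ a2 _ _ _] H]]]] := loc n%:R.
have := (sqi_zx (measurable_square n%:R) (a2 i j)).1; congr meas2; apply/funext => x.
have [sx|nx] := pselect (square n%:R x); last by rewrite !zx_out.
by rewrite !zx_in// (H x sx).2.
Qed.

Lemma L1loc_local f : meas2 f -> (forall K, compact K -> sqi (zx K f)) -> L1loc setT f.
Proof.
move=> mf H; split; first exact: mf.
move=> K cK _; have mK := compact_measurable2 cK.
have [_ h] := sqi_L1loc mK (H K cK); exact: h.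
Qed.

(** A test function has compact support, so the identity only concerns one of
    the local representatives. *)
Lemma loc_weak i j : is_weak_partial setT j (u i) (d i j).
Proof.
have l1 : L1loc setT (u i).
  apply: L1loc_local; first exact: loc_meas_u.
  move=> K cK; have [v [e [N [[a1 _ _ _ _] H]]]] := loc_compact cK.
  apply: sqi_ext (sqi_zx (compact_measurable2 cK) (a1 i)) => x.
  by have [kx|nx] := pselect (K x); [rewrite !zx_in// (H x kx).1|rewrite !zx_out].
have l2 : L1loc setT (d i j).
  apply: L1loc_local; first exact: loc_meas_d.
  move=> K cK; have [v [e [N [[_ a2 _ _ _] H]]]] := loc_compact cK.
  apply: sqi_ext (sqi_zx (compact_measurable2 cK) (a2 i j)) => x.
  by have [kx|nx] := pselect (K x); [rewrite !zx_in// (H x kx).2|rewrite !zx_out].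
apply/is_weak_partialP => // phi tphi; rewrite !zxT.
have [K [cK _ p0]] := test_fun_supp tphi.
have [K' [cK' _ p0']] := test_fun_supp (test_fun_partial j tphi).
have [v [e [N [[_ _ _ _ a5] H]]]] := loc_compact (compactU cK cK').
rewrite (I2_ext (g := fun x => v i x * partial j phi x)); last first.
  move=> x; have [kx|/p0' ->] := pselect (K' x); last by rewrite !mulr0.
  by rewrite (H x (or_intror kx)).1.
rewrite a5//; congr (- _); apply: I2_ext => x.
have [kx|/p0 ->] := pselect (K x); last by rewrite !mulr0.
by rewrite (H x (or_introl kx)).2.
Qed.

Lemma loc_weak_ae i j : {ae mu2, forall x, weak_partial setT j (u i) x = d i j x}.
Proof.
have H (n : nat) : {ae mu2, forall x, square n%:R x -> weak_partial setT j (u i) x = d i j x}.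
  have S := weak_partialS (@subsetT _ _) (measurable_square (n%:R : R)) measurableT.
  exact: weak_partial_unique (S _ _ _ (weak_partial_spec (loc_weak i j))) (S _ _ _ (loc_weak i j)).
have := @ae_foralln _ _ _ mu2 _ H.
apply: (@filterS _ (almost_everywhere mu2)) => x {}H.
apply: (H (Num.truncn (2 * (`|x.1| + `|x.2|))).+1); apply/squareP.
have := truncnS_gt (2 * (`|x.1| + `|x.2|)).
by have := normr_ge0 x.1; have := normr_ge0 x.2; split; lra.
Qed.

Lemma loc_L2loc V (v : bool -> R * R -> R) : (forall i, uof V i = v i) -> (forall i, meas2 (v i)) ->
  (forall K, compact K -> forall i, exists2 g, sqi g & {ae mu2, forall x, zx K (v i) x = g x}) ->
  L2loc setT V.
Proof.
move=> Vv mv H; split; first by split; [have := mv false|have := mv true]; rewrite -Vv.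
move=> K cK _; have mK := compact_measurable2 cK.
have [g1 [m1 h1] e1] := H K cK false; have [g2 [m2 h2] e2] := H K cK true.
have mz i : meas2 (zx K (v i)).
  by apply/(meas2_zx _ mK); exact: measurable_funTS (mv i).
have -> : (\int[mu2]_(x in K) (normC (V x) ^+ 2)%:E = \int[mu2]_x (dens (fun i => zx K (v i)) x)%:E)%E.
  rewrite [LHS]int_zx; apply: eq_integral => x _; rewrite zx_dens /zx normC_dens.
  by rewrite /dens !Vv.
have -> : (\int[mu2]_x (dens (fun i => zx K (v i)) x)%:E =
           \int[mu2]_x (g1 x ^+ 2 + g2 x ^+ 2)%:E)%E.
  apply: ae_eq_integral => //.
  - by apply/measurable_EFinP; exact: meas2_dens.
  - by apply/measurable_EFinP; apply: meas2D; exact: meas2X.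
  - apply: (@filterS2 _ (almost_everywhere mu2) _ _ _ _ _ e1 e2) => x E1 E2 _.
    by rewrite /dens E1 E2.
by rewrite (I2_EFin (intgD h1 h2)) ltry.
Qed.

(** Membership in the local space follows from finite-energy representatives on
    each square; the covariance relations hold at every point. *)
Lemma loc_H1_mag_per (r : R) :
  (forall x, cof u (x.1 + r, x.2) = expi (r * x.2 / 2) * cof u x) ->
  (forall x, cof u (x.1, x.2 + r) = expi (- (r * x.1 / 2)) * cof u x) -> H1_mag_per r (cof u).
Proof.
move=> p1 p2; have uE i : uof (cof u) i = u i by case: i.
split; [| | |exact: aeW|exact: aeW].
- apply: (loc_L2loc uE loc_meas_u) => K cK i.
  have [v [e [N [[a1 _ _ _ _] H]]]] := loc_compact cK.
  exists (zx K (v i)); first exact: sqi_zx (compact_measurable2 cK) (a1 i).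
  apply: aeW => x; have [kx|nx] := pselect (K x); last by rewrite !zx_out.
  by rewrite !zx_in// (H x kx).1.
- by move=> j; split; [exists (d false j); exact: (loc_weak false j)|exists (d true j); exact: (loc_weak true j)].
- move=> j; pose w i k := weak_partial setT k (u i).
  pose q (i : bool) : R * R -> R := if i then mgi u w j else mgr u w j.
  have mw i k : meas2 (w i k) by have [_ [m _] _] := weak_partial_spec (loc_weak i k).
  have mA := @meas2_A0 R j.
  have qE i : uof (mag_partial setT j (cof u)) i = q i.
    apply/funext => x.
    have E : mag_partial setT j (cof u) x = Complex (q false x) (q true x).
      rewrite /mag_partial /weak_partialC /q /mgr /mgi /w /cof.
      have -> : weak_partial setT j (Re_fun (cof u)) x = weak_partial setT j (u false) x by [].
      have -> : weak_partial setT j (Im_fun (cof u)) x = weak_partial setT j (u true) x by [].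
      by simpc.
    by case: i; rewrite /uof /Re_fun /Im_fun E.
  apply: (loc_L2loc qE).
    move=> i; case: i; rewrite /q.
      by apply: meas2B => //; apply: meas2M => //; exact: loc_meas_u.
    by apply: meas2D => //; apply: meas2M => //; exact: loc_meas_u.
  move=> K cK i; have [v [e [N [wv H]]]] := loc_compact cK.
  have [s1 s2] := W_sqi_mg j (@subset_refl _ _) wv.
  exists (zx K (if i then mgi v e j else mgr v e j)).
    by apply: sqi_zx; [exact: compact_measurable2|case: i].
  apply: (@filterS2 _ (almost_everywhere mu2) _ _ _ _ _ (loc_weak_ae false j) (loc_weak_ae true j)) => x E1 E2.
  have [kx|nx] := pselect (K x); last by rewrite !zx_out.
  have [Hu Hd] := H x kx; rewrite !zx_in//.
  by case: i; rewrite /q /mgr /mgi /w ?E1 ?E2 !Hu !Hd.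
Qed.

End Local.

(** Weak derivatives restrict to open subsets; those of the function itself are
    recovered from the magnetic ones by adding the bounded potential times [U]. *)
Lemma H1_mag_per_H1 r U : H1_mag_per r U -> H1 (square r) U.
Proof.
move=> [l2 wdf l2m _ _]; pose S := square r; have mS : measurable (S : set plane) := measurable_square r.
pose w i j := weak_partial setT j (uof U i).
have hw i j : is_weak_partial setT j (uof U i) (w i j).
  by have [[g1 h1] [g2 h2]] := wdf j; case: i; [exact: weak_partial_spec h2|exact: weak_partial_spec h1].
have L V : L2loc setT V -> forall i, sqi (zx S (uof V i)).
  move=> [[m1 m2] h]; apply/L2_sqi; split; first by split; [exact: measurable_funS m1|exact: measurable_funS m2].
  have cK := @closed_rect_compact R r; set K := _ `*` _ in cK.
  apply: le_lt_trans (h K cK (@subsetT _ _)); apply: ge0_subset_integral => //.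
  - exact: compact_measurable2.
  - apply/measurable_EFinP.
    have -> : (fun x => normC (V x) ^+ 2) = dens (uof V) by apply/funext => x; exact: normC_dens.
    by apply: measurable_funTS; apply: meas2_dens; case; [exact: m2|exact: m1].
  - by move=> x _; rewrite lee_fin sqr_ge0.
  - move=> x /square_rect[a1 a2 a3 a4].
    by split; rewrite /= in_itv/=; apply/andP; split; lra.
have su := L _ l2; have sm j := L _ (l2m j).
have wW : W S S (fun i => zx S (uof U i)) (fun i j => zx S (w i j)).
  split => //.
  - move=> i j.
    have z0 k x : ~ S x -> zx S (uof U k) x = 0 by exact: zx_out.
    have sA k := A0_sqi j (@subset_refl _ _) (su k) (z0 k).
    have E x : S x -> mag_partial setT j U x = Complex (w false j x + A0 j x * uof U true x)
       (w true j x - A0 j x * uof U false x).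
      move=> _; rewrite /mag_partial /weak_partialC /w.
      have e1 : weak_partial setT j (Re_fun U) x = weak_partial setT j (uof U false) x by [].
      have e2 : weak_partial setT j (Im_fun U) x = weak_partial setT j (uof U true) x by [].
      rewrite e1 e2; have -> : U x = Complex (uof U false x) (uof U true x).
        by rewrite /uof /Re_fun /Im_fun; case: (U x).
      by simpc.
    case: i.
      apply: sqi_ext (sqiD (sm j true) (sA false)) => x.
      have [Sx|nx] := pselect (S x); last by rewrite !zx_out// mulr0 addr0.
      by rewrite !zx_in// /uof /Im_fun E//= /uof /Re_fun; ring.
    apply: sqi_ext (sqiB (sm j false) (sA true)) => x.
    have [Sx|nx] := pselect (S x); last by rewrite !zx_out// mulr0 subr0.
    by rewrite !zx_in// /uof /Re_fun E//= /uof /Im_fun; ring.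
  - by move=> i x; exact: zx_out.
  - by move=> i j x; exact: zx_out.
  - move=> i j; have h := weak_partialS (@subsetT _ _) mS measurableT (hw i j).
    have [lf lg _] := h.
    exact: (is_weak_partialP j mS lf lg).1.
apply: (tuple_H1 wW) => x i sx; rewrite zx_in//.
Qed.

Lemma expiD (a b : R) : expi (a + b) = expi a * expi b.
Proof. by rewrite /expi cosD sinD; simpc; congr Complex; ring. Qed.

Lemma expi_period (a : R) (z : int) : expi (a + pi *+ 2 * z%:~R) = expi a.
Proof.
have P n b : expi (b + pi *+ 2 * n%:R) = expi b :> R[i].
  by rewrite mulr_natr /expi (periodicn (@cosD2pi R)) (periodicn (@sinD2pi R)).
case: z => n; first exact: P.
rewrite NegzE mulrNz mulrN -[in RHS](subrK (pi *+ 2 * n.+1%:R) a).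
by rewrite P.
Qed.

Lemma cof_mt c ka u x : cof (mtu c ka u) x = expi (th c ka x) * cof u (shift2 (opp2 c) x).
Proof. by rewrite /cof /expi /mtu; simpc; congr Complex; ring. Qed.

Definition nctr (r : R) x : R * R :=
  (r * (Num.floor (x.1 / r + 2^-1))%:~R, r * (Num.floor (x.2 / r + 2^-1))%:~R).
Definition phc c : R := c.1 * c.2 / 2.
(** Magnetic periodic extension: on the cell centred at [c] it is the magnetic
    translate by [c], with the additional phase [c.1 * c.2 / 2] that makes the
    pieces compatible when the flux through a cell is a multiple of [2 * pi]. *)
Definition peru (r : R) u i x : R := mtu (nctr r x) (phc (nctr r x)) u i x.
Definition perd (r : R) u d i j x : R := mtd (nctr r x) (phc (nctr r x)) u d i j x.

(** The centres of the [(2 * p + 1) ^ 2] cells are the points of the lattice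
    [r * Z ^ 2] with coordinates at most [p * r], hence the odd number of cells. *)
Lemma floor_ctr p (r t : R) : 0 < r -> `|t| < (2 * p + 1)%:R * r / 2 ->
  exists k : 'I_(2 * p + 1), r * (Num.floor (t / r + 2^-1))%:~R = r * (k%:R - ((2 * p + 1)%:R - 1) / 2).
Proof.
move=> r0; rewrite natrD natrM ltr_norml => /andP[t1 t2].
set m := Num.floor _.
have [/= f1 f2] : m%:~R <= t / r + 2^-1 /\ t / r + 2^-1 < (m + 1)%:~R.
  by apply/andP; exact: floor_itv.
have rt : t / r * r = t by rewrite mulfVK// gt_eqF.
have g1 : - p%:R < t / r + 2^-1 by rewrite -(ltr_pM2r r0) mulrDl rt; lra.
have g2 : t / r + 2^-1 < p%:R + 1 by rewrite -(ltr_pM2r r0) mulrDl rt; lra.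
have m1 : (0 <= m + p%:Z)%R.
  rewrite -ltzD1 -(ltr_int R) !rmorphD/= .
  have -> : (p%:Z)%:~R = p%:R :> R by [].
  by move: f2; rewrite rmorphD/= => f2; lra.
have m2 : (m + p%:Z < (2 * p + 1)%N%:Z)%R.
  rewrite -(ltr_int R) rmorphD/=.
  have -> : ((2 * p + 1)%N%:Z)%:~R = 2 * p%:R + 1 :> R by rewrite -[LHS]/((2 * p + 1)%:R) natrD natrM.
  have -> : (p%:Z)%:~R = p%:R :> R by [].
  lra.
case E : (m + p%:Z) m1 m2 => [k|//] _; rewrite ltz_nat => kp.
exists (Ordinal kp) => /=; congr (_ * _).
have -> : m = k%:Z - p%:Z by rewrite -[k%:Z]E addrK.
rewrite rmorphB /=.
have -> : (p%:Z)%:~R = p%:R :> R by [].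
have -> : (k%:Z)%:~R = k%:R :> R by [].
by field.
Qed.

Lemma nctr_cell p (r : R) (k : 'I_(2 * p + 1) * 'I_(2 * p + 1)) x : 0 < r -> cell r k x -> nctr r x = ctr r k.
Proof.
move=> r0 /cellP[]; rewrite /ctr /nctr /=.
have H (t : R) (i : 'I_(2 * p + 1)) : `|t - r * (i%:R - ((2 * p + 1)%:R - 1) / 2)| < r / 2 ->
    r * (Num.floor (t / r + 2^-1))%:~R = r * (i%:R - ((2 * p + 1)%:R - 1) / 2).
  rewrite natrD natrM ltr_norml => /andP[a1 a2]; congr (_ * _).
  have rt : t / r * r = t by rewrite mulfVK// gt_eqF.
  have -> : Num.floor (t / r + 2^-1) = (i%:Z - p%:Z)%R.
    apply: floor_def; rewrite !rmorphD rmorphN /=.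
    have -> : (i%:Z)%:~R = i%:R :> R by [].
    have -> : (p%:Z)%:~R = p%:R :> R by [].
    apply/andP; split; first by rewrite -(ler_pM2r r0) (mulrDl (t / r)) rt; lra.
    by rewrite -(ltr_pM2r r0) (mulrDl (t / r)) rt; lra.
  rewrite rmorphB /=.
  have -> : (i%:Z)%:~R = i%:R :> R by [].
  have -> : (p%:Z)%:~R = p%:R :> R by [].
  by field.
by move=> /H -> /H ->.
Qed.

(** On a bounded set the extension is a finite sum of magnetic translates. *)
Lemma per_local (r : R) u d : 0 < r -> W setT (square r) u d ->
  forall M : R, exists v e (N : R), W setT (square N) v e /\
  forall x, square M x -> (forall i, peru r u i x = v i x) /\ (forall i j, perd r u d i j x = e i j x).
Proof.
move=> r0 w M; have [a1 a2 a3 a4 a5] := w.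
pose p := (Num.truncn (`|M| / r)).+1; pose n := (2 * p + 1)%N.
pose uk (k : 'I_n * 'I_n) := mtu (ctr r k) (phc (ctr r k)) u.
pose dk (k : 'I_n * 'I_n) := mtd (ctr r k) (phc (ctr r k)) u d.
have wk k : W setT (square (n%:R * r)) (uk k) (dk k).
  by apply: WS (W_mt (ctr r k) _ w) => // x; exact: cell_sub.
have ws := W_sum (s := index_enum ('I_n * 'I_n)%type) (fun k _ => wk k).
do 2 eexists; exists (n%:R * r); split; first exact: ws.
move=> x sx.
have Mn : M <= n%:R * r.
  have := truncnS_gt (`|M| / r); rewrite ltr_pdivrMr// -/p => Mp.
  have p0 : 0 <= p%:R * r by rewrite mulr_ge0// ltW.
  by rewrite /n natrD natrM; have := ler_norm M; lra.
have /squareP[x1 x2] := square_le Mn sx.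
have [k1 K1] := floor_ctr r0 x1; have [k2 K2] := floor_ctr r0 x2.
pose k0 : 'I_n * 'I_n := (k1, k2).
have E : nctr r x = ctr r k0 by rewrite /nctr K1 K2.
have nc (k : 'I_n * 'I_n) : k != k0 -> ~ cell r k x.
  move=> kk0 ck; have := nctr_cell r0 ck; rewrite E => -[].
  have rn0 : r != 0 by rewrite gt_eqF.
  move=> /(mulfI rn0)/addIr/eqP; rewrite eqr_nat => /eqP e1.
  move=> /(mulfI rn0)/addIr/eqP; rewrite eqr_nat => /eqP e2.
  move: kk0; apply/negP; rewrite negbK; apply/eqP.
  by case: k ck e1 e2 => i j _ /= e1 e2; congr pair; exact/val_inj.
have [_ _ u0 d0 _] := w.
have uk0 k i : ~ cell r k x -> uk k i x = 0.
  by have [_ _ H _ _] := W_mt (ctr r k) (phc (ctr r k)) w; exact: H.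
have dk0 k i j : ~ cell r k x -> dk k i j x = 0.
  by have [_ _ _ H _] := W_mt (ctr r k) (phc (ctr r k)) w; exact: H.
split.
  by move=> i; rewrite (bigD1 k0)//= big1 ?addr0 /peru ?E// => k /nc/uk0.
by move=> i j; rewrite (bigD1 k0)//= big1 ?addr0 /perd ?E// => k /nc/dk0.
Qed.

(** Moving by [r] in the first direction changes the phase by exactly
    [r * x.2 / 2]; in the second direction there is an additional phase
    [r ^+ 2 * m], with [m] an integer, which is a multiple of [2 * pi]. *)
Lemma H1_mag_per_ext (r : R) (n : nat) u d : 0 < r -> r ^+ 2 = 2 * pi * n%:R ->
  W setT (square r) u d -> H1_mag_per r (cof (peru r u)).
Proof.
move=> r0 rn w; have rn0 : r != 0 by rewrite gt_eqF.
have fl (t : R) : (Num.floor ((t + r) / r + 2^-1))%:~R = (Num.floor (t / r + 2^-1))%:~R + 1 :> R.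
  have -> : (t + r) / r + 2^-1 = (t / r + 2^-1) + 1 by rewrite mulrDl divff//; ring.
  set y := t / r + 2^-1; have /andP[a1 a2] := floor_itv y.
  rewrite (@floor_def _ (y + 1) (Num.floor y + 1)); first by rewrite rmorphD.
  by move: a1 a2; rewrite !rmorphD /= => *; apply/andP; split; lra.
apply: (loc_H1_mag_per (per_local r0 w)) => x; rewrite ![cof (peru _ _) _]cof_mt.
  have -> : nctr r (x.1 + r, x.2) = ((nctr r x).1 + r, (nctr r x).2).
    by rewrite /nctr /= fl mulrDr mulr1.
  rewrite mulrA -expiD; congr (expi _ * cof u _); rewrite /th /phc /shift2 /opp2 /=; first ring.
  by congr pair; ring.
have -> : nctr r (x.1, x.2 + r) = ((nctr r x).1, (nctr r x).2 + r).
  by rewrite /nctr /= fl mulrDr mulr1.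
rewrite mulrA -expiD -(expi_period (- _ + _) (Num.floor (x.1 / r + 2^-1) * n)).
congr (expi _ * cof u _); rewrite /th /phc /shift2 /opp2 /=; last by congr pair; ring.
rewrite rmorphM /= -[(_ n)%:~R]/(n%:R).
set m := (Num.floor _)%:~R; set l := (Num.floor _)%:~R.
have -> : pi *+ 2 * (l * n%:R) = l * r ^+ 2 by rewrite rn -mulr_natl; ring.
by field.
Qed.

Lemma peru_in (r : R) u x i : 0 < r -> square r x -> peru r u i x = u i x.
Proof.
move=> r0 /squareP[x1 x2].
have H (t : R) : `|t| < r / 2 -> Num.floor (t / r + 2^-1) = 0.
  rewrite ltr_norml => /andP[a1 a2]; apply: floor_def.
  have rt : t / r * r = t by rewrite mulfVK// gt_eqF.
  apply/andP; split; first by rewrite -(ler_pM2r r0) (mulrDl (t / r)) rt; lra.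
  by rewrite add0r -(ltr_pM2r r0) (mulrDl (t / r)) rt; lra.
rewrite /peru /nctr (H _ x1) (H _ x2) mulr0 /mtu /th /phc /shift2 /opp2 /=.
rewrite oppr0 !mul0r !addr0 cos0 sin0 -surjective_pairing.
by case: i; ring.
Qed.

End Periodic.

(** * The bulk energy for the three boundary conditions *)

Section BoundaryConditions.
Context {R : realType}.
Local Notation plane := (measurableTypeR R * measurableTypeR R)%type.
Local Notation mu2 := (@lebesgue2 R).
Implicit Types (f g phi psi : R * R -> R) (x c : R * R) (Om S : set (R * R)).
Implicit Types (u v : bool -> R * R -> R) (d e : bool -> bool -> R * R -> R) (U : R * R -> R[i]).

(** The domain on which the weak derivatives of a function of [Hspace o r],
    extended by zero, can be tested. *)
Definition test_dom (o : bdry_cond) (r : R) : set (R * R) :=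
  if o is Dirichlet then setT else square r.

Lemma Hspace_H1 o r U : Hspace o r U -> H1 (square r) U.
Proof. by case: o => //= [[]//|]; exact: H1_mag_per_H1. Qed.

Lemma Hspace_W o r U : Hspace o r U -> W (test_dom o r) (square r) (zu r U) (zd r U).
Proof.
by case: o => [|hU|hU]; [exact: H10_W|exact/H1_W/hU|exact/H1_W/(Hspace_H1 (o := MagPeriodic))/hU].
Qed.

(** Functions vanishing off a smaller square are competitors for all three
    boundary conditions. *)
Lemma Hspace_ext o (q r : R) u d : 0 < r -> q < r -> admissible o r -> W setT (square q) u d ->
  exists2 U, Hspace o r U & forall x i, square r x -> uof U i x = u i x.
Proof.
move=> r0 qr ad w; have wr : W setT (square r) u d.
  by apply: WS w => //; exact/square_le/ltW.
have cu x i : uof (cof u) i x = u i x by case: i.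
have wrr : W (square r) (square r) u d by apply: WS wr.
case: o ad => ad.
- by exists (cof u); [exact: W_H10 w qr|move=> x i _].
- exists (cof u); [|by move=> x i _].
  by apply: (tuple_H1 wrr) => x i _.
- have [n rn] := ad erefl; exists (cof (peru r u)); first exact: H1_mag_per_ext r0 rn wr.
  move=> x i sx; rewrite -(peru_in u i r0 sx).
  by case: i.
Qed.

(** A nearly optimal function for the square of side [r - 1]; the loss of area is
    [O(r)]. *)
Lemma ebulk_trial b : 0 <= b -> exists2 C : R, 0 <= C & forall r, 3 <= r ->
  exists q u d, [/\ q < r, trial q u d & energy b u d <= ebulk b * r ^+ 2 + C * r].
Proof.
move=> b0; have [C C0 CP] := einf_le_ebulk b0; exists (C + 2); first by rewrite addr_ge0.
move=> r r3; have r10 : 0 <= r - 1 by lra.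
have /(einf_lt b0 r10)[u [d [t lt_e]]] : einf b (r - 1) < einf b (r - 1) + 1 by rewrite ltrDl.
exists (r - 1), u, d; split => //; first lra.
apply: le_trans (ltW lt_e) _.
have r2 : 2 <= r - 1 by lra.
apply: le_trans (lerD (CP _ r2) (lexx 1)) _.
have e0 := ebulk_le0 b0; have e1 := ebulk_ge b0.
have : ebulk b * (- (2 * r) + 1) <= r.
  have : - ebulk b * (2 * r - 1) <= 2^-1 * (2 * r - 1) by rewrite ler_wpM2r//; lra.
  lra.
have -> : ebulk b * (r - 1) ^+ 2 = ebulk b * r ^+ 2 + ebulk b * (- (2 * r) + 1) by ring.
lra.
Qed.

(** Under the Dirichlet condition the extension by zero is counted in [einf];
    otherwise a cutoff near the sides costs [C * r]. *)
Lemma ebulk_lower b : 0 <= b -> exists2 C : R, 0 <= C & forall o r u d,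
  (if o is Dirichlet then 0 < r else 2 <= r) ->
  W (test_dom o r) (square r) u d -> intg (fun x => dens u x ^+ 2) ->
  ebulk b * r ^+ 2 - (if o is Dirichlet then 0 else C * r) <= energy b u d.
Proof.
move=> b0; have [C C0 CP] := energy_ge b0; exists C => // o r u d; case: o => /= rr w h.
- by rewrite subr0 (le_trans (ebulk_le b0 rr))// einf_le// ltW.
- exact: CP.
- exact: CP.
Qed.

(** The negative part is integrable, so the positive part is not. *)
Lemma int_pinfty f g : meas2 f -> intg g -> (forall x, 0 <= g x) -> (forall x, - g x <= f x) -> ~ intg f ->
  (\int[mu2]_x (f x)%:E = +oo)%E.
Proof.
move=> mf ig g0 gf nf; have mfE : measurable_fun setT (EFin \o f : plane -> \bar R) by exact/measurable_EFinP.
have mfg : meas2 (fun x => f x + g x) by apply: meas2D => //; exact: intg_meas.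
have fg0 x : 0 <= f x + g x by have := gf x; lra.
have H : (\int[mu2]_x (f x + g x)%:E = +oo)%E.
  apply/eqP; apply: contrapT => /negP ny; apply: nf.
  have ifg : intg (fun x => f x + g x).
    apply/integrableP; split; first exact/measurable_EFinP.
    by under eq_integral do rewrite /= ger0_norm//; rewrite ltey.
  by apply: intg_ext (intgB ifg ig) => x; rewrite addrK.
have nfin : (\int[mu2]_x ((EFin \o f)^\- x) < +oo)%E.
  case/integrableP : (ig) => _; apply: le_lt_trans; apply: ge0_le_integral => //.
  - exact: measurable_funeneg.
  - by apply/measurable_EFinP; exact: (meas2_norm (intg_meas ig)).
  - move=> x _; rewrite funenegE /= ger0_norm// -EFin_max lee_fin ge_max g0 andbT.
    by have := gf x; lra.
have pfin : (\int[mu2]_x ((EFin \o f)^\+ x) = +oo)%E.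
  apply/eqP; apply: contrapT => /negP; rewrite -ltey => pl; apply: nf; apply/integrableP; split => //.
  have -> : (\int[mu2]_x `|(EFin \o f) x| = \int[mu2]_x ((EFin \o f)^\+ x + (EFin \o f)^\- x))%E.
    by apply: eq_integral => x _; rewrite -[LHS]/((abse \o (EFin \o f)) x) fune_abse.
  rewrite ge0_integralD//; last by exact: measurable_funeneg.
    exact: lte_add_pinfty.
  exact: measurable_funepos.
rewrite integralE pfin addye// -ltNye lteNr.
by rewrite -[X in (_ < X)%E]/(+oo)%E.
Qed.

(** If the quartic term is not integrable, then the energy is infinite. *)
Lemma Eblk_ge o b r U a : 0 <= b -> Hspace o r U ->
  (forall u d, W (test_dom o r) (square r) u d -> intg (fun x => dens u x ^+ 2) -> a <= energy b u d) ->
  (a%:E <= Eblk_fun U b r)%E.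
Proof.
move=> b0 hU H; have w := Hspace_W hU; rewrite Eblk_zE.
have [h|nh] := pselect (intg (fun x => dens (zu r U) x ^+ 2)).
  by rewrite (I2_EFin (intg_eblkd b (@subset_refl _ _) w h)) lee_fin; exact: H.
have [a1 a2 _ _ _] := w.
have ie := W_intg_elin b (@subset_refl _ _) w.
have md : meas2 (dens (zu r U)) := intg_meas (W_intg_dens w).
rewrite (@int_pinfty _ (fun x => 2^-1 * (\1_(square r) : R * R -> R) x)) ?leey//.
- by apply: meas2D; [exact: intg_meas ie|apply: meas2M; [exact: meas2_cst|exact: meas2X]].
- by apply: intgZ; exact: intg_indic_square.
- move=> x; rewrite indicE; have [_|/negP nx] := boolP (x \in square r).
    by rewrite mulr1 eblkd_lb.
  by rewrite mulr0 oppr0 (W_out _ w)// => sx; apply: nx; exact/mem_set.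
- move=> hb; apply: nh; apply: intg_ext (intgZ 2 (intgB hb ie)) => x.
  by rewrite /eblkd; field.
Qed.

Lemma Eblk_le o (b q r : R) u d : 0 < r -> q < r -> admissible o r -> trial q u d ->
  (eblk o b r <= (energy b u d)%:E)%E.
Proof.
move=> r0 qr ad [w h]; have [U hU UE] := Hspace_ext r0 qr ad w.
have wr : W (square r) (square r) u d by apply: WS w => //; exact/square_le/ltW.
apply: ge_ereal_inf; exists (Eblk_fun U b r); first by exists U.
by rewrite (tuple_Eblk wr UE) (I2_EFin (intg_eblkd b (@subset_refl _ _) wr h)).
Qed.

Lemma eblk_bounds b : 0 <= b -> exists2 C : R, 0 <= C & forall o r, 3 <= r -> admissible o r ->
  ((ebulk b * r ^+ 2 - C * r)%:E <= eblk o b r)%E /\ (eblk o b r <= (ebulk b * r ^+ 2 + C * r)%:E)%E.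
Proof.
move=> b0; have [C C0 CP] := ebulk_lower b0; have [D D0 DP] := ebulk_trial b0.
exists (C + D); first by rewrite addr_ge0.
move=> o r r3 ad; have r0 : 0 < r by lra.
have Cr : 0 <= C * r by rewrite mulr_ge0// ltW.
have Dr : 0 <= D * r by rewrite mulr_ge0// ltW.
split.
  apply: le_ereal_inf_tmp => _ [U hU <-]; apply: (Eblk_ge b0 hU) => u d w h.
  apply: le_trans (CP o r u d _ w h); first by case: (o); rewrite mulrDl; lra.
  by case: (o); lra.
have [q [u [d [qr t le_e]]]] := DP r r3.
apply: le_trans (Eblk_le b r0 qr ad t) _.
by rewrite lee_fin; apply: le_trans le_e _; rewrite mulrDl; lra.
Qed.

(** Errors of order [1 / r] vanish in the limit. *)
Lemma side_squeeze o (F : R -> \bar R) (l k R0 : R) :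
  (forall r, R0 <= r -> admissible o r -> ((l - k / r)%:E <= F r)%E /\ (F r <= (l + k / r)%:E)%E) ->
  F r @[r --> side_to_infty o] --> l%:E.
Proof.
move=> H.
have lim (k' : R) : (l + k' / r)%:E @[r --> side_to_infty o] --> l%:E.
  apply: cvg_within_filter; apply/fine_cvgP; split; first exact: nearW.
  apply/cvgrPdist_lt => e e0; near=> r.
  have r0 : 0 < r by near: r; exact: nbhs_pinfty_gt.
  rewrite /= opprD addrA subrr add0r normrN normrM normfV (gtr0_norm r0) ltr_pdivrMr// mulrC -ltr_pdivrMr//.
  by near: r; apply: nbhs_pinfty_gt; exact: num_real.
have FF : Filter (side_to_infty (R := R) o) by exact: within_filter.
apply: (squeeze_cvge _ (lim (- k)) (lim k)).
rewrite /side_to_infty near_withinE; near=> r => ad.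
have rR0 : R0 <= r by near: r; apply: nbhs_pinfty_ge; exact: num_real.
have [h1 h2] := H r rR0 ad.
by rewrite mulNr h1 h2.
Unshelve. all: by end_near. Qed.

(** Any value satisfying the definition of [Eblk] is the Dirichlet limit, and
    limits are unique. *)
Lemma Eblk_ebulk b : 0 <= b -> Eblk b = @ebulk R b.
Proof.
move=> b0; have [C C0 CP] := eblk_bounds b0.
have lim o : (eblk o b r / (r ^+ 2)%:E)%E @[r --> side_to_infty o] --> (ebulk b)%:E.
  apply: (@side_squeeze _ _ _ C 3) => r r3 ad; have r0 : 0 < r by lra.
  have r20 : 0 < r ^+ 2 by rewrite exprn_gt0.
  have [h1 h2] := CP o r r3 ad.
  have E : C / r * r ^+ 2 = C * r by field; lra.
  rewrite inver (gt_eqF r20) lee_pdivlMr// lee_pdivrMr// -!EFinM mulrBl mulrDl E.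
  by split.
have ex : exists E : R, forall o, (eblk o b r / (r ^+ 2)%:E)%E @[r --> side_to_infty o] --> E%:E.
  by exists (ebulk b).
have := getPex ex; rewrite -/(Eblk b) => /(_ Dirichlet) lim'.
have FF : ProperFilter (side_to_infty (R := R) Dirichlet).
  apply: Build_ProperFilter_ex.
  move=> P /= [M [Mr MP]]; exists (M + 1); apply: MP => //.
  by rewrite ltrDl.
apply: EFin_inj; exact: (cvg_unique (@ereal_hausdorff R) lim' (lim Dirichlet)).
Qed.

End BoundaryConditions.

(** * The linear energy *)

Section LinearEnergy.
Context {R : realType}.
Local Notation plane := (measurableTypeR R * measurableTypeR R)%type.
Local Notation mu2 := (@lebesgue2 R).
Implicit Types (f g phi psi : R * R -> R) (x c : R * R) (Om S : set (R * R)).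
Implicit Types (u v : bool -> R * R -> R) (d e : bool -> bool -> R * R -> R) (U : R * R -> R[i]).

Lemma I2_dens0 u : intg (fun x => dens u x ^+ 2) -> I2 (fun x => dens u x ^+ 2) = 0 ->
  {ae mu2, forall x, dens u x = 0}.
Proof.
move=> h I0; have mf := intg_meas h.
have H : (\int[mu2]_x `|(dens u x ^+ 2)%:E| = 0)%E.
  under eq_integral do rewrite /= ger0_norm ?sqr_ge0//.
  by rewrite I2_EFin// I0.
have mfE : measurable_fun setT (EFin \o (fun x => dens u x ^+ 2) : plane -> \bar R) by exact/measurable_EFinP.
have := (ae_eq_integral_abs mu2 measurableT mfE).1 H.
apply: (@filterS _ (almost_everywhere mu2)) => x /(_ I)/= [] /eqP.
by rewrite sqrf_eq0 => /eqP.
Qed.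

Lemma dens_eq0 u x : dens u x = 0 -> forall i, u i x = 0.
Proof.
move=> /eqP; rewrite /dens paddr_eq0 ?sqr_ge0// !sqrf_eq0 => /andP[/eqP a /eqP b].
by case.
Qed.

Lemma ae_zeroP (r : R) U : {ae mu2, forall x, dens (zu r U) x = 0} <-> ae_zero r U.
Proof.
split; apply: (@filterS _ (almost_everywhere mu2)) => x H.
  move=> sx; have := dens_eq0 H; move=> H0; have := H0 false; have := H0 true.
  rewrite /zu !zx_in// /uof /Re_fun /Im_fun.
  by case: (U x) => a b /= -> ->.
rewrite /zu zx_dens; have [sx|nx] := pselect (square r x); last by rewrite zx_out.
by rewrite zx_in// -normC_dens H// normC_sq /= expr0n addr0.
Qed.

Lemma energyE Om S (N b : R) u d : S `<=` square N -> W Om S u d -> intg (fun x => dens u x ^+ 2) ->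
  energy b u d = I2 (elin b u d) + 2^-1 * I2 (fun x => dens u x ^+ 2).
Proof.
move=> SN w h; rewrite /energy I2D; [|exact: W_intg_elin SN w|exact: intgZ].
by rewrite I2Z.
Qed.

(** Scaling: minimizing [t ^+ 2 * l + t ^+ 4 * q / 2] over [t] turns a lower
    bound for the nonlinear energy into one for the quotient [l / sqrt q]. *)
Lemma quotient_ge (l q A : R) : 0 < q -> 0 <= A ->
  (forall t, - A <= t ^+ 2 * l + t ^+ 4 * (2^-1 * q)) -> - Num.sqrt (2 * A) <= l / Num.sqrt q.
Proof.
move=> q0 A0 H; have sq0 : 0 < Num.sqrt q by rewrite sqrtr_gt0.
have [l0|l0] := leP 0 l.
  by apply: (@le_trans _ _ 0); [rewrite oppr_le0 sqrtr_ge0|rewrite divr_ge0// ltW].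
have k0 : 0 <= - l / q by rewrite divr_ge0 ?oppr_ge0// ltW.
have := H (Num.sqrt (- l / q)).
have -> : Num.sqrt (- l / q) ^+ 4 = (- l / q) ^+ 2 by rewrite -[in RHS](sqr_sqrtr k0) -exprM.
rewrite sqr_sqrtr//.
have -> : - l / q * l + (- l / q) ^+ 2 * (2^-1 * q) = - (l ^+ 2 / q / 2) by field; lra.
move=> h; have {h} lA : l ^+ 2 / q <= 2 * A by lra.
rewrite lerNl.
have -> : - (l / Num.sqrt q) = Num.sqrt (l ^+ 2 / q).
  by rewrite sqrtrM ?sqr_ge0// sqrtr_sqr sqrtrV ?ltW// ltr0_norm// mulNr.
by rewrite ler_sqrt// mulr_ge0.
Qed.

(** The inequality between arithmetic and geometric means, for [A] and [q / 2]. *)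
Lemma quotient_le (l q A : R) : 0 < q -> 0 <= A -> l + 2^-1 * q <= - A ->
  l / Num.sqrt q <= - Num.sqrt (2 * A).
Proof.
move=> q0 A0 H; have sq0 : 0 < Num.sqrt q by rewrite sqrtr_gt0.
rewrite ler_pdivrMr// mulNr -sqrtrM ?mulr_ge0//.
suff : Num.sqrt (2 * A * q) <= A + 2^-1 * q by lra.
have X0 : 0 <= A + 2^-1 * q by rewrite addr_ge0// mulr_ge0// ltW.
rewrite -(ger0_norm X0) -sqrtr_sqr ler_sqrt ?sqr_ge0//.
have := sqr_ge0 (A - 2^-1 * q); lra.
Qed.

Lemma densZ (t : R) u x : dens (fun i x => t * u i x) x = t ^+ 2 * dens u x.
Proof. by rewrite /dens; ring. Qed.

Lemma elinZ (b t : R) u d x :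
  elin b (fun i x => t * u i x) (fun i j x => t * d i j x) x = t ^+ 2 * elin b u d x.
Proof. by rewrite /elin densZ /gsq /mgr /mgi; ring. Qed.

(** If the fourth power is not integrable, then the quotient is zero. *)
Lemma mlin_ge o (b r A : R) : 0 <= A ->
  (forall u d, W (test_dom o r) (square r) u d -> intg (fun x => dens u x ^+ 2) -> - A <= energy b u d) ->
  ((- Num.sqrt (2 * A))%:E <= mlin o b r)%E.
Proof.
move=> A0 H; apply: le_ereal_inf_tmp => _ [U [hU nz] <-]; have w := Hspace_W hU.
have hU1 := Hspace_H1 hU; have wU := H1_W hU1.
have SS := @subset_refl _ (square r).
have Uu x i : square r x -> uof U i x = zu r U i x by move=> sx; rewrite /zu zx_in.
rewrite (tuple_Elin wU Uu) /L4_sq (tuple_L4 wU Uu).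
have md : meas2 (dens (zu r U)) := intg_meas (W_intg_dens w).
have [h|nh] := pselect (intg (fun x => dens (zu r U) x ^+ 2)); last first.
  rewrite (@int_pinfty _ _ (fun=> 0) _ (@intg0 R))//=; last 2 first.
  - exact: meas2X.
  - by move=> x; rewrite oppr0 sqr_ge0.
  by rewrite invey mule0 lee_fin oppr_le0 sqrtr_ge0.
rewrite (I2_EFin h) /=; set l := I2 _; set q := I2 _.
have q0 : 0 < q.
  rewrite lt_neqAle eq_sym; apply/andP; split; last by apply: I2_ge0 => x; exact: sqr_ge0.
  by apply/negP => /eqP /(I2_dens0 h)/ae_zeroP.
rewrite inver gt_eqF ?sqrtr_gt0// -EFinM lee_fin; apply: quotient_ge => // t.
have wt := WZ t w; set v := (fun i x => _) in wt; set e := (fun i j x => _) in wt.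
have vE x : dens v x = t ^+ 2 * dens (zu r U) x := densZ t (zu r U) x.
have hv : intg (fun x => dens v x ^+ 2).
  by apply: intg_ext (intgZ (t ^+ 4) h) => x; rewrite vE; ring.
have := H _ _ wt hv; rewrite (energyE b SS wt hv).
rewrite (I2_ext (f := fun x => dens v x ^+ 2) (g := fun x => t ^+ 4 * dens (zu r U) x ^+ 2)); last first.
  by move=> x; rewrite vE; ring.
rewrite (I2_ext (f := elin b v e) (g := fun x => t ^+ 2 * elin b (zu r U) (zd r U) x)); last first.
  by move=> x; exact: elinZ.
rewrite I2Z ?I2Z//; last exact: W_intg_elin SS w.
by rewrite -/q -/l; lra.
Qed.

(** The quartic integral is positive, since otherwise the function would vanish
    almost everywhere and its energy would not be negative. *)
Lemma mlin_le o (b q r A : R) u d : 0 <= b -> 0 < r -> q < r -> admissible o r -> trial q u d ->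
  0 < A -> energy b u d <= - A -> (mlin o b r <= (- Num.sqrt (2 * A))%:E)%E.
Proof.
move=> b0 r0 qr ad [w h] A0 eA; have [U hU UE] := Hspace_ext r0 qr ad w.
have SS := @subset_refl _ (square r).
have wr : W (square r) (square r) u d by apply: WS w => //; exact/square_le/ltW.
have zE : zu r U = u := zu_eq wr UE.
rewrite (energyE b SS wr h) in eA.
set Q := I2 (fun x => _ ^+ 2) in eA; set l := I2 _ in eA.
have Q0 : 0 <= Q by apply: I2_ge0 => x; exact: sqr_ge0.
have dl : - I2 (dens u) <= l.
  rewrite -I2N; last exact: W_intg_dens wr.
  apply: le_I2; [exact/intgN/(W_intg_dens wr)|exact: W_intg_elin SS wr|].
  by move=> x; rewrite /elin lerBrDr addNr mulr_ge0// gsq_ge0.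
have nz : ~ {ae mu2, forall x, dens u x = 0}.
  move=> ae0; suff : I2 (dens u) = 0 by move=> I0; rewrite I0 in dl; lra.
  rewrite -[RHS](@I2_0 R); congr fine; apply: ae_eq_integral => //.
  - by apply/measurable_EFinP; exact: (intg_meas (W_intg_dens wr)).
  - by apply: (@filterS _ (almost_everywhere mu2)) ae0 => x -> _.
have Qp : 0 < Q.
  rewrite lt_neqAle eq_sym Q0 andbT; apply/negP => /eqP /(I2_dens0 h).
  exact: nz.
apply: ge_ereal_inf; exists (Elin_fun U b r / L4_sq U r)%E.
  by exists U => //; split => // /ae_zeroP; rewrite zE.
rewrite (tuple_Elin wr UE) /L4_sq (tuple_L4 wr UE) (I2_EFin h) /=.
rewrite inver gt_eqF ?sqrtr_gt0// -EFinM lee_fin; apply: quotient_le => //.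
exact: ltW.
Qed.

Lemma sqrt_add_le (s h : R) : 0 < s -> 0 <= h ->
  Num.sqrt (s + 2 * h) <= Num.sqrt s + h * (Num.sqrt s)^-1.
Proof.
move=> s0 h0; have k0 : 0 < Num.sqrt s by rewrite sqrtr_gt0.
have X0 : 0 <= Num.sqrt s + h * (Num.sqrt s)^-1.
  by rewrite addr_ge0 ?mulr_ge0 ?invr_ge0 ?sqrtr_ge0.
rewrite -(ger0_norm X0) -sqrtr_sqr ler_sqrt ?sqr_ge0// sqrrD (sqr_sqrtr (ltW s0)).
have -> : Num.sqrt s * (h * (Num.sqrt s)^-1) = h by field; lra.
by rewrite -[h *+ 2]mulr_natl lerDl sqr_ge0.
Qed.

Lemma sqrt_sub_ge (s h : R) : 0 < s -> 0 <= h -> 2 * h <= s ->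
  Num.sqrt s - 2 * h * (Num.sqrt s)^-1 <= Num.sqrt (s - 2 * h).
Proof.
move=> s0 h0 hs; have k0 : 0 < Num.sqrt s by rewrite sqrtr_gt0.
have [X0|X0] := leP 0 (Num.sqrt s - 2 * h * (Num.sqrt s)^-1); last first.
  by apply: le_trans (ltW X0) _; exact: sqrtr_ge0.
rewrite -(ger0_norm X0) -sqrtr_sqr ler_sqrt ?subr_ge0//.
rewrite sqrrB (sqr_sqrtr (ltW s0)).
have -> : Num.sqrt s * (2 * h * (Num.sqrt s)^-1) = 2 * h by field; lra.
rewrite expr_div_n (sqr_sqrtr (ltW s0)).
have : (2 * h) ^+ 2 / s <= 2 * h.
  by rewrite ler_pdivrMr// expr2 ler_wpM2l// mulr_ge0.
by rewrite -[2 * h *+ 2]mulr_natl; lra.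
Qed.

Lemma sqrt_div (a r : R) : 0 <= a -> 0 < r -> Num.sqrt a / r = Num.sqrt (a / r ^+ 2).
Proof.
by move=> a0 r0; rewrite sqrtrM// sqrtrV ?sqr_ge0// sqrtr_sqr gtr0_norm.
Qed.

Lemma mlin_bounds b : 0 < b < 1 -> exists C R0 : R, [/\ 0 < C, 1 < R0 &
  forall (r : R) (o : bdry_cond), R0 <= r -> admissible o r ->
    ((- Num.sqrt (- 2 * ebulk b) - C / r * (Num.sqrt (- 2 * ebulk b))^-1)%R%:E <= mlin o b r / r%:E)%E /\
    (mlin o b r / r%:E <= (- Num.sqrt (- 2 * ebulk b) + C / r)%R%:E)%E].
Proof.
move=> b01; have /andP[b0' _] := b01; have b0 := ltW b0'.
have E0 := ebulk_lt0 b01; set s := - 2 * ebulk b; have s0 : 0 < s by rewrite /s; lra.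
have [C C0 CP] := ebulk_lower b0; have [D D0 DP] := ebulk_trial b0.
pose k := Num.sqrt s; have k0 : 0 < k by rewrite sqrtr_gt0.
(* [r] is taken so large that [s - 2 * D / r] is positive: the upper bound uses a
   function of negative energy. *)
exists (C + 2 * D / k + 1), (3 + 2 * D / s + 1).
have Ds : 0 <= 2 * D / s by apply: divr_ge0; [exact: mulr_ge0|exact: ltW].
have Dk : 0 <= 2 * D / k by apply: divr_ge0; [exact: mulr_ge0|exact: ltW].
split; [by lra|by lra|] => r o rR ad.
have r0 : 0 < r by lra.
have ri : 0 <= r^-1 by rewrite invr_ge0 ltW.
have r2 : 0 < r ^+ 2 by rewrite exprn_gt0.
rewrite inver (gt_eqF r0) lee_pdivlMr// lee_pdivrMr// -!EFinM.
split.
  pose A := - ebulk b * r ^+ 2 + C * r.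
  have A0 : 0 <= A by rewrite /A addr_ge0 ?mulr_ge0 ?oppr_ge0// ltW.
  apply: le_trans (mlin_ge (A := A) A0 _).
    rewrite lee_fin mulrDl mulNr mulNr -opprD lerN2 -mulrDl -ler_pdivrMr// sqrt_div ?mulr_ge0//.
    have -> : 2 * A / r ^+ 2 = s + 2 * (C / r) by rewrite /A /s; field; lra.
    apply: le_trans (sqrt_add_le s0 _) _; first exact: divr_ge0 C0 (ltW r0).
    rewrite lerD2l ler_wpM2r ?invr_ge0 ?sqrtr_ge0// ler_wpM2r//; lra.
  move=> u d w h; apply: le_trans (CP o r u d _ w h); last by case: (o); lra.
  have Cr : 0 <= C * r by rewrite mulr_ge0// ltW.
  by rewrite /A; case: (o); lra.
have r3 : 3 <= r by lra.
have [q [u [d [qr t le_e]]]] := DP r r3.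
pose A := - (ebulk b * r ^+ 2 + D * r).
have Dr : 2 * (D / r) < s.
  rewrite mulrA ltr_pdivrMr// -ltr_pdivrMl// mulrC; lra.
have AE : 2 * A / r ^+ 2 = s - 2 * (D / r) by rewrite /A /s; field; lra.
have A0 : 0 < A.
  have : 0 < 2 * A / r ^+ 2 by rewrite AE subr_gt0.
  by rewrite pmulr_lgt0 ?invr_gt0// pmulr_rgt0.
apply: le_trans (mlin_le b0 r0 qr ad t A0 _) _; first by rewrite opprK.
rewrite lee_fin -ler_pdivrMr// mulNr sqrt_div ?mulr_ge0 ?(ltW A0)// AE.
have H := sqrt_sub_ge s0 (divr_ge0 D0 (ltW r0)) (ltW Dr).
have : 2 * (D / r) * (Num.sqrt s)^-1 <= (C + 2 * D / k + 1) / r.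
  have -> : 2 * (D / r) * (Num.sqrt s)^-1 = 2 * D / k / r by rewrite -/k; ring.
  rewrite ler_wpM2r//; lra.
by lra.
Qed.

End LinearEnergy.

Theorem theorem1p1 (R : realType) :
  [/\ forall b : R, 0 < b < 1 ->
        exists C R0 : R, [/\ 0 < C, 1 < R0 &
          forall (r : R) (o : bdry_cond), R0 <= r -> admissible o r ->
            ((- Num.sqrt (- 2 * Eblk b)
                - C / r * (Num.sqrt (- 2 * Eblk b))^-1)%R%:E
               <= mlin o b r / r%:E)%E /\
            (mlin o b r / r%:E
               <= (- Num.sqrt (- 2 * Eblk b) + C / r)%R%:E)%E],
      forall (b : R) (o : bdry_cond), 0 < b < 1 ->
        exists l : R,
          (mlin o b r / r%:E)%E @[r --> side_to_infty o] --> l%:E /\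
          Eblk b = - (2^-1) * l ^+ 2
    & forall b r : R, 0 < b <= 1 -> 1 <= r ->
        ((- Num.sqrt (- 2 * Eblk b))%R%:E <= mlin Dirichlet b r / r%:E)%E].
Proof.
split.
- by move=> b b01; rewrite Eblk_ebulk; [exact: mlin_bounds|case/andP: b01 => /ltW].
- move=> b o b01; have /andP[/ltW b0 _] := b01.
  have e0 := ebulk_le0 b0; have s0 : 0 <= - 2 * ebulk b by lra.
  rewrite Eblk_ebulk//; exists (- Num.sqrt (- 2 * ebulk b)); split; last first.
    by rewrite sqrrN sqr_sqrtr//; field.
  have [C [R0 [C0 R1 H]]] := mlin_bounds b01.
  set k := Num.sqrt _ in H *.
  have ki : 0 <= k^-1 by rewrite invr_ge0 sqrtr_ge0.
  have K0 : 0 <= C * k^-1 by rewrite mulr_ge0// ltW.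
  apply: (@side_squeeze _ _ _ _ (C + C * k^-1) R0) => r rR ad.
  have [h1 h2] := H r o rR ad; have ri : 0 <= r^-1 by rewrite invr_ge0; lra.
  have Cr : 0 <= C / r by rewrite mulr_ge0// ltW.
  have Kr : 0 <= C * k^-1 / r by rewrite mulr_ge0.
  split.
    apply: le_trans h1; rewrite lee_fin mulrDl.
    have -> : C / r * k^-1 = C * k^-1 / r by ring.
    by lra.
  by apply: le_trans h2 _; rewrite lee_fin mulrDl; lra.
- move=> b r /andP[/ltW b0 _] r1; have r0 : 0 < r by lra.
  have e0 := ebulk_le0 b0; rewrite Eblk_ebulk// inver (gt_eqF r0) lee_pdivlMr// -EFinM.
  have [C C0 CP] := ebulk_lower b0.
  have A0 : 0 <= - ebulk b * r ^+ 2 by rewrite mulr_ge0 ?sqr_ge0// oppr_ge0.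
  apply: le_trans (mlin_ge (A := - ebulk b * r ^+ 2) A0 _); last first.
    move=> u d w h; have := CP Dirichlet r u d r0 w h.
    by rewrite subr0 mulNr opprK.
  rewrite lee_fin (mulNr (Num.sqrt _)) lerN2 -ler_pdivrMr//.
  rewrite sqrt_div//; last exact: mulr_ge0.
  by rewrite le_eqVlt; apply/orP; left; apply/eqP; congr Num.sqrt; field; lra.
Qed.
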